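(* Let $d=1$, and let $w,\psi,\phi$ satisfy the standing assumptions listed in the context. Write $$\lambda_k(r)=\begin{cases}\dfrac{\psi(r)^2}{|\phi'(r)|}\bigl(\|w\|_{L^1(\mathbb R)}+F_w(2r^2)\bigr), & k=0,\\[3mm] \dfrac{\psi(r)^2}{|\phi'(r)|}\bigl(\|w\|_{L^1(\mathbb R)}-F_w(2r^2)\bigr), & k=1,\end{cases}$$ $$\lambda^*=\sup_{r>0}\max_{k=0,1}\lambda_k(r)=\sup_{r>0}\frac{\psi(r)^2}{|\phi'(r)|}\bigl(\|w\|_{L^1(\mathbb R)}+|F_w(2r^2)|\bigr),\qquad E_k=\{r>0:\lambda_k(r)=\lambda^*\}.$$ Then $$\|S\|^2=2\pi\lambda^*.$$ Regarding extremisers, fix $f\in L^2(\mathbb R)$ and decompose it as $f(\xi)=f_0(|\xi|)+\operatorname{sgn}(\xi)f_1(|\xi|)$. Then the following are equivalent: (i) The equality $\|Sf\|_{L^2(\mathbb R^2)}^2=2\pi\lambda^*\|f\|_{L^2(\mathbb R)}^2$ holds. (ii) The functions $f_0,f_1$ satisfy $\operatorname{supp} f_k\subset E_k$ for each $k=0,1$. As a consequence, extremisers exist if and only if there exists $k\in\{0,1\}$ such that $|E_k|>0$.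
   Context: Fourier transform: $\hat f(\xi)=\int_{\mathbb R} f(x)e^{-ix\xi}\,dx$. Standing assumptions ($d=1$): the spatial weight $w(|\cdot|)\in L^1(\mathbb R)$ is positive and even, and one writes $\widehat{w(|\cdot|)}(\xi)=F_w(\tfrac12|\xi|^2)$ for some $F_w:[0,\infty)\to\mathbb R$ that is uniformly continuous and bounded; $\|w\|_{L^1(\mathbb R)}=\int_{\mathbb R}w(|x|)\,dx$. The smoothing function $\psi:(0,\infty)\to\mathbb R$ is continuous and non-negative. The dispersion relation $\phi:(0,\infty)\to\mathbb R$ is continuously differentiable and injective. The linear operator $S:L^2(\mathbb R)\to L^2(\mathbb R^2)$ is defined by $$Sf(x,t)=w(|x|)^{1/2}\int_{\mathbb R}e^{ix\xi}\psi(|\xi|)e^{it\phi(|\xi|)}f(\xi)\,d\xi,$$ and $\|S\|=\|S\|_{L^2(\mathbb R)\to L^2(\mathbb R^2)}$ is its operator norm. Extremisers are nonzero $f\in L^2(\mathbb R)$ for which the equality in (i) holds. $|E|$ denotes Lebesgue measure, and $\operatorname{supp} g\subset E$ means that $g=0$ almost everywhere outside $E$. *)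

(* Defs.v *)
From HB Require Import structures.
From mathcomp Require Import all_boot all_order all_algebra.
From mathcomp Require Import complex.
From mathcomp Require Import all_classical all_reals all_analysis.

Set Implicit Arguments.
Unset Strict Implicit.
Unset Printing Implicit Defensive.

Import Order.TTheory GRing.Theory Num.Theory.
Import numFieldNormedType.Exports.

Local Open Scope classical_set_scope.
Local Open Scope ring_scope.
Local Open Scope complex_scope.

Definition expi (R : realType) (a : R) : R[i] := cos a +i* sin a.

Definition cmeasurable (d : measure_display) (T : measurableType d)
    (R : realType) (f : T -> R[i]) : Prop :=
  measurable_fun setT (fun x => complex.Re (f x)) /\
  measurable_fun setT (fun x => complex.Im (f x)).

Definition cintegrable (d : measure_display) (T : measurableType d)
    (R : realType) (mu : {measure set T -> \bar R}) (f : T -> R[i]) : Prop :=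
  mu.-integrable setT (fun x => (complex.Re (f x))%:E) /\
  mu.-integrable setT (fun x => (complex.Im (f x))%:E).

Definition cintegral (d : measure_display) (T : measurableType d)
    (R : realType) (mu : {measure set T -> \bar R}) (f : T -> R[i]) : R[i] :=
  Rintegral mu setT (fun x => complex.Re (f x)) +i*
  Rintegral mu setT (fun x => complex.Im (f x)).

(* Elements of L^2 are represented by functions; equality in L^2 is equality
   almost everywhere. *)
Definition L2norm (d : measure_display) (T : measurableType d)
    (R : realType) (mu : {measure set T -> \bar R}) (f : T -> R[i]) : \bar R :=
  Lnorm mu 2%:E (fun x => (complex.Re `|f x|)%:E).

Definition L2 (d : measure_display) (T : measurableType d)
    (R : realType) (mu : {measure set T -> \bar R}) (f : T -> R[i]) : Prop :=
  cmeasurable f /\ (L2norm mu f < +oo)%E.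

Definition leb1 (R : realType) : {measure set (measurableTypeR R) -> \bar R} :=
  @lebesgue_measure R.

Definition leb2 (R : realType) :
    {measure set (measurableTypeR R * measurableTypeR R) -> \bar R} :=
  (@lebesgue_measure R \x @lebesgue_measure R)%E.

Definition fourier (R : realType) (f : R -> R[i]) (xi : R) : R[i] :=
  cintegral (leb1 R) (fun x => f x * expi (- (x * xi))).

Definition weightL1 (R : realType) (w : R -> R) : R :=
  Rintegral (leb1 R) setT (fun x => w `|x|).

(* Functions on (0, oo) or [0, oo) are represented by functions on R whose
   remaining values are arbitrary; in particular w may be singular at 0. *)
Definition weight_assumption (R : realType) (w : R -> R) : Prop :=
  (forall r : R, 0 < r -> 0 < w r) /\
  (leb1 R).-integrable setT (fun x => (w `|x|)%:E).

Definition Fw_assumption (R : realType) (w Fw : R -> R) : Prop :=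
  [/\ forall xi : R, fourier (fun x => (w `|x|)%:C) xi
                     = (Fw (2^-1 * `|xi| ^+ 2))%:C,
      forall e : R, 0 < e -> exists2 d : R, 0 < d &
        forall a b : R, 0 <= a -> 0 <= b -> `|a - b| < d ->
          `|Fw a - Fw b| < e
    & [bounded Fw a | a in `[0, +oo[ ] ].

Definition smoothing_assumption (R : realType) (psi : R -> R) : Prop :=
  {within `]0, +oo[, continuous psi} /\ (forall r : R, 0 < r -> 0 <= psi r).

Definition dispersion_assumption (R : realType) (phi : R -> R) : Prop :=
  [/\ forall r : R, 0 < r -> derivable phi r 1,
      {within `]0, +oo[, continuous (derive1 phi)}
    & {in `]0, +oo[ &, injective phi}].

(* The formula for S, meaningful when psi(|.|) f is integrable. *)
Definition S_formula (R : realType) (w psi phi : R -> R) (f : R -> R[i])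
    (p : R * R) : R[i] :=
  (Num.sqrt (w `|p.1|))%:C *
  cintegral (leb1 R) (fun xi : R =>
    expi (p.1 * xi) * (psi `|xi|)%:C * expi (p.2 * phi `|xi|) * f xi).

Definition S_domain (R : realType) (w psi phi : R -> R) (f : R -> R[i]) : Prop :=
  [/\ L2 (leb1 R) f,
      cintegrable (leb1 R) (fun xi => (psi `|xi|)%:C * f xi)
    & L2 (leb2 R) (S_formula w psi phi f)].

(* S_op w psi phi f g means "f is in L^2(R) and S f = g in L^2(R^2)".  For a
   general f in L^2(R) the integral defining S f need not converge absolutely
   and is understood by L^2 continuity: S is the closure of the operator given
   by the formula on S_domain (if that one is bounded, S is its unique
   continuous extension, defined on all of L^2(R)). *)
Definition S_op (R : realType) (w psi phi : R -> R) (f : R -> R[i])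
    (g : R * R -> R[i]) : Prop :=
  [/\ L2 (leb1 R) f, L2 (leb2 R) g
    & exists2 u : nat -> R -> R[i],
        forall n, S_domain w psi phi (u n)
      & (fun n => L2norm (leb1 R) (fun xi => u n xi - f xi)) @ \oo --> 0%E /\
        (fun n => L2norm (leb2 R) (fun p => S_formula w psi phi (u n) p - g p))
          @ \oo --> 0%E].

Definition S_opnorm (R : realType) (w psi phi : R -> R) : \bar R :=
  ereal_sup [set y : \bar R | exists f, exists g,
    [/\ S_op w psi phi f g, (L2norm (leb1 R) f <= 1)%E
      & y = L2norm (leb2 R) g]].

(* At a zero of phi' the quotient psi^2 / |phi'| is 0 by the convention
   x / 0 = 0.  This does not affect lambda_star: the zeros of phi' have empty
   interior (phi is injective) and |Fw (2 r^2)| < |w|_1, so if psi does not vanish at such a zero then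
   lambda is unbounded near it and lambda_star = +oo. *)
Definition lambda (R : realType) (w Fw psi phi : R -> R) (k : 'I_2) (r : R) : R :=
  if k == 0 then
    psi r ^+ 2 / `|derive1 phi r| * (weightL1 w + Fw (2 * r ^+ 2))
  else
    psi r ^+ 2 / `|derive1 phi r| * (weightL1 w - Fw (2 * r ^+ 2)).

Definition lambda_star (R : realType) (w Fw psi phi : R -> R) : \bar R :=
  ereal_sup [set (Num.max (lambda w Fw psi phi 0 r)
                          (lambda w Fw psi phi 1 r))%:E
            | r in `]0, +oo[%classic].

Definition E_set (R : realType) (w Fw psi phi : R -> R) (k : 'I_2) : set R :=
  [set r | 0 < r /\ (lambda w Fw psi phi k r)%:E = lambda_star w Fw psi phi].

(* supp g \subset E for a function g on (0, oo). *)
Definition supp_in (R : realType) (g : R -> R[i]) (E : set R) : Prop :=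
  {ae (leb1 R), forall r, 0 < r -> ~ E r -> g r = 0}.

Definition S_equality (R : realType) (w Fw psi phi : R -> R) (f : R -> R[i]) :
    Prop :=
  exists2 g, S_op w psi phi f g &
    (L2norm (leb2 R) g ^+ 2
     = (2 * pi)%:E * lambda_star w Fw psi phi * L2norm (leb1 R) f ^+ 2)%E.

Definition extremiser (R : realType) (w Fw psi phi : R -> R) (f : R -> R[i]) :
    Prop :=
  [/\ L2 (leb1 R) f, ~ {ae (leb1 R), forall xi, f xi = 0}
    & S_equality w Fw psi phi f].

(* Main.v *)
Require Import Defs.
From HB Require Import structures.
From mathcomp Require Import all_boot all_order all_algebra.
From mathcomp Require Import complex.
From mathcomp Require Import ring lra.
From mathcomp Require Import all_classical all_reals all_analysis.
From mathcomp Require Import measurable_realfun.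
Import Order.TTheory GRing.Theory Num.Theory.
Import numFieldNormedType.Exports.
Local Open Scope classical_set_scope.
Local Open Scope ring_scope.
Local Open Scope complex_scope.

Set Implicit Arguments.
Unset Strict Implicit.
Unset Printing Implicit Defensive.

(** Why the theorem is true. Fold the frequency line onto r > 0 by pairing xi
with -xi. For fixed x the function t |-> S f (x, t) is then, up to the factor
w(|x|)^{1/2}, the Fourier integral along the phase phi of
  A_x(r) = psi(r) (e^{ixr} f(r) + e^{-ixr} f(-r)).
Since phi is injective and C^1, Plancherel in the variable phi(r) gives
  int |S f (x, t)|^2 dt = 2 pi w(|x|) int_0^oo |A_x(r)|^2 / |phi'(r)| dr.
Expanding |A_x(r)|^2 leaves a constant, a multiple of cos(2xr) and a multiple
of sin(2xr); against w(|x|) these integrate to |w|_1, F_w(2 r^2) and 0. The two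
surviving terms recombine into the even and odd parts of f:
  ||S f||^2 = 2 pi int_0^oo (lambda_0 |f(r) + f(-r)|^2
                             + lambda_1 |f(r) - f(-r)|^2) / 2 dr,
which is [energy_identity]. As ||f||^2 is int_0^oo of the same expression with
both multipliers replaced by 1, S is diagonal: the norm is the supremum of the multipliers,
approached by even or odd bumps at frequencies where lambda_k is nearly
maximal ([opnorm_sqr]), and equality holds exactly when lambda^* - lambda_k
vanishes wherever the corresponding part of f does not ([energy_defect]).

The Plancherel identity is [plancherel_phase]. It is obtained without a change
of variables, so that the zeros of phi' need no separate treatment. Damping the
t-integral by e^{-e|t|} turns it into a double integral of the Poisson kernel
P_e(phi(r) - phi(s)). Against |phi'(s)| ds this kernel has mass at most 2 pi, by
the arctangent primitive, whence an inequality; its mass concentrates at s = r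
and tends to 2 pi as e -> 0, whence equality for bounded almost everywhere
continuous functions. Those are dense, and the inequality transports the
equality to every function.

The integral defining S f converges only for some f, so S is a closure. The
identity survives the closure because both sides satisfy
|x + y|^2 <= (1 + d) |x|^2 + (1 + 1/d) |y|^2 for every d > 0 ([S_op_energy]);
that S f exists for every f when lambda^* is finite follows from truncation to
compact sets of frequencies and the completeness of L^2 ([S_op_exists]). This
uses psi^2 <= C |phi'| at every point, including the zeros of phi': if psi did
not vanish at such a zero, injectivity would provide nearby points with small
nonzero phi' and hence lambda^* = +oo ([psi_sqr_le]). When lambda^* = +oo the sets
E_k are empty, and only f = 0 gives equality, because ||S f|| is finite. *)

(** * The Poisson kernel as the Fourier transform of a damping factor *)

Section poisson.
Context {R : realType}.
Local Notation mu := (@lebesgue_measure R).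

Definition poisson (e y : R) : R := 2 * e / (e ^+ 2 + y ^+ 2).

Lemma poissonN e y : poisson e (- y) = poisson e y.
Proof. by rewrite /poisson sqrrN. Qed.

Lemma poisson_ge0 e y : 0 < e -> 0 <= poisson e y.
Proof.
by move=> e0; rewrite /poisson divr_ge0 ?mulr_ge0 ?addr_ge0 ?sqr_ge0 ?ltW.
Qed.

Lemma poisson_den_gt0 (e y : R) : 0 < e -> 0 < e ^+ 2 + y ^+ 2.
Proof. by move=> e0; rewrite ltr_wpDr ?sqr_ge0// exprn_gt0. Qed.

(** The primitive of e^{-et} (1 + cos(ty)) that vanishes at infinity. Adding 1 to the cosine keeps the integrand nonnegative, which is what
the fundamental theorem of calculus on an unbounded interval requires. *)
Let F (e y t : R) : R :=
  expR (- e * t) * ((y * sin (t * y) - e * cos (t * y)) / (e ^+ 2 + y ^+ 2) - e^-1).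

Let dF (e y t : R) : 0 < e ->
  is_derive t 1 (F e y) (expR (- e * t) * (1 + cos (t * y))).
Proof.
move=> e0; rewrite /F.
apply: is_derive_eq.
have := lt0r_neq0 (poisson_den_gt0 y e0); have := lt0r_neq0 e0.
rewrite -!/(GRing.scale _ _) /=.
rewrite /GRing.scale/=.
move=> H1 H2.
field.
by rewrite H1 H2.
Qed.

Let F_cvg (e y : R) : 0 < e -> F e y t @[t --> +oo] --> (0 : R).
Proof.
move=> e0.
pose M : R := (`|y| + e) / (e ^+ 2 + y ^+ 2) + e^-1.
have H : (expR (- e * t) * M) @[t --> +oo] --> (0 : R).
  rewrite -(mul0r M); apply: cvgM; last exact: cvg_cst.
  have -> : (fun t => expR (- e * t)) = (fun t => expR (- (e * t))).
    by apply/funext => t; rewrite mulNr.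
  apply: (cvg_comp (fun t => e * t) (fun t => expR (- t))); last exact: cvgr_expR.
  exact: gt0_cvgMry.
apply/norm_cvg0P.
apply: (@squeeze_cvgr _ _ _ _ (fun=> 0) (fun t => expR (- e * t) * M)) => //; last exact: cvg_cst.
near=> t.
rewrite normr_ge0/= /F normrM ger0_norm ?expR_ge0// ler_wpM2l ?expR_ge0//.
have D0 := poisson_den_gt0 y e0.
rewrite (le_trans (ler_normB _ _))// /M lerD//; last first.
  by rewrite ger0_norm// invr_ge0 ltW.
rewrite normrM normfV (gtr0_norm D0) ler_wpM2r ?invr_ge0 ?(ltW D0)//.
rewrite (le_trans (ler_normB _ _))// lerD//.
  by rewrite normrM ler_piMr// ler_norml sin_geN1 sin_le1.
by rewrite normrM (gtr0_norm e0) ler_piMr ?(ltW e0)// ler_norml cos_geN1 cos_le1.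
Unshelve. all: by end_near. Qed.

Let int_half (e y : R) : 0 < e ->
  (\int[mu]_(t in `[0%R, +oo[) (expR (- e * t) * (1 + cos (t * y)))%:E
   = (e^-1 + e / (e ^+ 2 + y ^+ 2))%:E)%E.
Proof.
move=> e0.
rewrite (@ge0_continuous_FTC2y _ _ (F e y) 0 0) => //.
- by rewrite /F !mulr0 mul0r expR0 sin0 cos0 -EFinB mulr0 mulr1 mul1r sub0r; congr _%:E; rewrite sub0r; lra.
- apply: continuous_subspaceT => t.
  apply: cvgM.
    apply: continuous_comp; last exact: continuous_expR.
    by apply: cvgM; [exact: cvg_cst|exact: cvg_id].
  apply: cvgD; first exact: cvg_cst.
  apply: continuous_comp; last exact: continuous_cos.
  by apply: cvgM; [exact: cvg_id|exact: cvg_cst].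
- exact: F_cvg.
- apply: cvg_at_right_filter.
  have [/derivable1_diffP/differentiable_continuous ? _] := @dF e y 0 e0.
  done.
- by move=> t _; rewrite derive1E; have [_ ->] := @dF e y t e0.
Qed.

Lemma integral_exp_abs_cos (e y : R) : 0 < e ->
  (\int[mu]_t (expR (- e * `|t|) * (1 + cos (t * y)))%:E
   = (2 * (e^-1 + e / (e ^+ 2 + y ^+ 2)))%:E)%E.
Proof.
move=> e0.
rewrite ge0_symfun_integralT.
- rewrite EFinM -(int_half y e0) -set_itvcy; congr (_ * _)%E.
  apply: eq_integral => t; rewrite inE/= in_itv/= andbT => t0.
  by rewrite ger0_norm.
- by move=> t; rewrite mulr_ge0 ?expR_ge0// -lerBlDl sub0r cos_geN1.
- move=> t; apply: cvgM.
    apply: continuous_comp; last exact: continuous_expR.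
    by apply: cvgM; [exact: cvg_cst|exact: norm_continuous].
  apply: cvgD; first exact: cvg_cst.
  apply: continuous_comp; last exact: continuous_cos.
  by apply: cvgM; [exact: cvg_id|exact: cvg_cst].
- by move=> t; rewrite /comp normrN [(- t * y)]mulNr cosN.
Qed.

Lemma integral_exp_abs (e : R) : 0 < e ->
  (\int[mu]_t (expR (- e * `|t|))%:E = (2 / e)%:E)%E.
Proof.
move=> e0; have := integral_exp_abs_cos 0 e0.
under eq_integral do rewrite mulr0 cos0 mulrC EFinM.
rewrite ge0_integralZl//=; last first.
  apply/measurable_EFinP; apply: measurableT_comp => //.
  by apply: measurable_funM => //; exact: measurableT_comp.
have -> : e / (e ^+ 2 + 0 ^+ 2) = e^-1 by field; rewrite lt0r_neq0.
have -> : (2 * (e^-1 + e^-1))%:E = ((1 + 1)%:E * (2 / e)%:E)%E.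
  by rewrite -EFinM; congr EFin; field; rewrite lt0r_neq0.
move=> /(congr1 (fun z => (2^-1)%:E * z)%E).
have h2 : ((2^-1)%:E * (1 + 1)%:E = 1%:E :> \bar R)%E.
  by rewrite -EFinM -[(1 + 1)%R]/(2%:R) mulVf.
by rewrite !muleA h2 !mul1e.
Qed.

Lemma measurable_exp_abs (e : R) : measurable_fun setT (fun t : R => expR (- e * `|t|)).
Proof.
apply: measurableT_comp => //.
by apply: measurable_funM => //; exact: measurableT_comp.
Qed.

Lemma integrable_exp_abs (e : R) : 0 < e ->
  mu.-integrable setT (fun t : R => (expR (- e * `|t|))%:E).
Proof.
move=> e0; apply/integrableP; split.
  by apply/measurable_EFinP; exact: measurable_exp_abs.
under eq_integral do rewrite gee0_abs ?lee_fin ?expR_ge0//.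
by rewrite integral_exp_abs// ltry.
Qed.

(** The difference of the integrals of e^{-e|t|} (1 + cos(ty)) and of e^{-e|t|}. *)
Lemma poisson_fourier (e y : R) : 0 < e ->
  \int[mu]_t (expR (- e * `|t|) * cos (t * y)) = poisson e y.
Proof.
move=> e0.
have mc : measurable_fun setT (fun t : R => cos (t * y)).
  apply: measurableT_comp; last exact: measurable_funM.
  apply: continuous_measurable_fun; exact: continuous_cos.
have ic : mu.-integrable setT (fun t : R => (expR (- e * `|t|) * cos (t * y))%:E).
  apply: (le_integrable _ _ _ (integrable_exp_abs e0)) => //.
    by apply/measurable_EFinP/measurable_funM => //; exact: measurable_exp_abs.
  move=> t _ /=; rewrite lee_fin normrM ler_piMr// ler_norml cos_geN1 cos_le1//.
have := integral_exp_abs_cos y e0.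
under eq_integral do rewrite mulrDr mulr1 EFinD.
rewrite integralD//=; last exact: integrable_exp_abs.
rewrite integral_exp_abs// => h.
have /(congr1 fine) : (\int[mu]_t (expR (- e * `|t|) * cos (t * y))%:E = (poisson e y)%:E)%E.
  have -> : poisson e y = (2 * (e^-1 + e / (e ^+ 2 + y ^+ 2))) - 2 / e.
    rewrite /poisson; field.
    by rewrite (lt0r_neq0 e0) (lt0r_neq0 (poisson_den_gt0 y e0)).
  by rewrite EFinB -h addeAC subee// add0e.
by [].
Qed.
End poisson.

(** * The Poisson kernel pulled back along an increasing phase *)

Section kernel.
Context {R : realType}.
Local Notation mu := (@lebesgue_measure R).
Local Notation D := (`]0%R, +oo[%classic : set R).
Variable phi : R -> R.
Hypothesis dphi : forall r : R, 0 < r -> derivable phi r 1.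
Hypothesis cphi : {within `]0, +oo[, continuous (derive1 phi)}.
(** A general dispersion relation reduces to the increasing case up to a sign, see
[phase_kernel_increasing]. *)
Hypothesis iphi : {in `]0, +oo[ &, {homo phi : x y / x < y}}.

Lemma phi_continuous r : 0 < r -> {for r, continuous phi}.
Proof. by move=> r0; apply/differentiable_continuous/derivable1_diffP/dphi. Qed.

Lemma dphi_continuous r : 0 < r -> {for r, continuous (derive1 phi)}.
Proof.
move=> r0; move: cphi; rewrite continuous_open_subspace; last exact: interval_open.
by apply; rewrite inE/= in_itv/= r0.
Qed.

Lemma derive1_phi_ge0 r : 0 < r -> 0 <= derive1 phi r.
Proof.
move=> r0; apply: (@incr_derive1_ge0_itvy _ phi false 0 r) => //.
- by move=> s; rewrite inE/= in_itv/= andbT; exact: dphi.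
- by rewrite in_itv/= r0.
Qed.

Lemma poisson_continuous (e : R) : 0 < e -> continuous (poisson e).
Proof.
move=> e0 y; apply: cvgM; first exact: cvg_cst.
apply: cvgV; first exact/lt0r_neq0/poisson_den_gt0.
apply: cvgD; first exact: cvg_cst.
exact: exprn_continuous.
Qed.

(** The primitive in s is 2 atan((phi(s) - phi(r)) / e). *)
Lemma integral_poisson_segment (e r c d : R) : 0 < e -> 0 < c -> c < d ->
  (\int[mu]_(s in `[c, d]) (poisson e (phi r - phi s) * derive1 phi s)%:E
   = (2 * atan ((phi d - phi r) / e) - 2 * atan ((phi c - phi r) / e))%:E)%E.
Proof.
move=> e0 c0 cd.
pose H s : R := 2 * atan ((phi s - phi r) / e).
have cH (s : R) : 0 < s -> {for s, continuous H}.
  move=> s0; apply: cvgM; first exact: cvg_cst.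
  apply: (continuous_comp (f := fun s => (phi s - phi r) / e)); last exact: continuous_atan.
  by apply: cvgM; [apply: cvgB; [exact: phi_continuous|exact: cvg_cst]|exact: cvg_cst].
have dH (s : R) : 0 < s -> is_derive s 1 H (poisson e (phi r - phi s) * derive1 phi s).
  move=> s0; have Hs := dphi s0.
  have Ds : is_derive s 1 phi (derive1 phi s) by rewrite derive1E; exact: DeriveDef.
  have D1 : is_derive s 1 (fun s => (phi s - phi r) / e) (derive1 phi s / e).
    by apply: is_derive_eq; rewrite subr0 scaler0 add0r /GRing.scale/= mulrC.
  have D2 := @is_derive1_comp _ atan (fun s => (phi s - phi r) / e) s _ _ (is_derive1_atan _) D1.
  rewrite /H; apply: is_derive_eq.
  rewrite /GRing.scale/= /poisson.
  have h := poisson_den_gt0 (phi r - phi s) e0.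
  field.
  by rewrite (lt0r_neq0 h) (lt0r_neq0 e0).
rewrite (@continuous_FTC2 _ _ H c d cd).
- by rewrite -EFinB.
- apply: continuous_in_subspaceT => s; rewrite inE/= in_itv/= => /andP[cs _].
  have s0 := lt_le_trans c0 cs.
  apply: cvgM; last exact: dphi_continuous.
  apply: (continuous_comp (f := fun s => phi r - phi s)); last exact: poisson_continuous.
  by apply: cvgB; [exact: cvg_cst|exact: phi_continuous].
- split.
  + move=> s; rewrite in_itv/= => /andP[cs _].
    by have [] := dH s (lt_trans c0 cs).
  + exact/cvg_at_right_filter/cH.
  + exact/cvg_at_left_filter/cH/(lt_trans c0).
- move=> s; rewrite in_itv/= => /andP[cs _].
  by rewrite derive1E; have [_ ->] := dH s (lt_trans c0 cs).
Qed.

Lemma measurable_phi : measurable_fun D phi.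
Proof.
apply: open_continuous_measurable_fun; first exact: interval_open.
by move=> r; rewrite inE/= in_itv/= andbT; exact: phi_continuous.
Qed.

Lemma measurable_dphi : measurable_fun D (derive1 phi).
Proof.
apply: open_continuous_measurable_fun; first exact: interval_open.
by move=> r; rewrite inE/= in_itv/= andbT; exact: dphi_continuous.
Qed.

Lemma measurable_poisson (e : R) : 0 < e -> measurable_fun setT (poisson e).
Proof. by move=> e0; apply: continuous_measurable_fun; exact: poisson_continuous. Qed.

Lemma measurable_poisson_dphi (e r : R) : 0 < e ->
  measurable_fun D (fun s => poisson e (phi r - phi s) * derive1 phi s).
Proof.
move=> e0; apply: measurable_funM; last exact: measurable_dphi.
apply: measurableT_comp; first exact: measurable_poisson.
by apply: measurable_funB; [exact: measurable_cst|exact: measurable_phi].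
Qed.

(** An arctangent varies by less than pi on each segment; the half-line is exhausted
by the segments [1/(n+1), n+2]. *)
Lemma integral_poisson_le (e r : R) : 0 < e ->
  (\int[mu]_(s in D) (poisson e (phi r - phi s) * derive1 phi s)%:E
   <= (2 * pi)%:E)%E.
Proof.
move=> e0.
pose F n : set R := `[n.+1%:R^-1, n.+2%:R]%classic.
have FD n : F n `<=` `]0%R, +oo[.
  move=> s; rewrite /F/= !in_itv/= => /andP[ns _].
  by rewrite andbT (lt_le_trans _ ns)// invr_gt0.
have UF : \bigcup_i F i = `]0%R, +oo[%classic.
  apply/seteqP; split; first by move=> s [n _ /FD].
  move=> s; rewrite /= in_itv/= andbT => s0.
  pose n := (Num.truncn s + Num.truncn s^-1)%N.
  exists n => //; rewrite /F /= in_itv/=; apply/andP; split.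
    rewrite -[leRHS]invrK lef_pV2 ?posrE ?invr_gt0//.
    rewrite (le_trans (ltW (truncnS_gt _)))// ler_nat ltnS /n leq_addl//.
  by rewrite (le_trans (ltW (truncnS_gt _)))// ler_nat /n !ltnS (leq_trans (leq_addr (Num.truncn s^-1) _))//.
have ndF : nondecreasing_seq F.
  apply/nondecreasing_seqP => n; rewrite subsetEset => s; rewrite /F /= !in_itv/= => /andP[a b].
  apply/andP; split; last by rewrite (le_trans b)// ler_nat.
  by rewrite (le_trans _ a)// lef_pV2 ?posrE// ler_nat.
have mF n : measurable (F n) by rewrite /F; exact: measurable_itv.
have mf n : measurable_fun (F n) (fun s => (poisson e (phi r - phi s) * derive1 phi s)%:E).
  apply/measurable_EFinP; apply: measurable_funS (measurable_poisson_dphi r e0) => //.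
have f0 n s : F n s -> (0 <= (poisson e (phi r - phi s) * derive1 phi s)%:E)%E.
  move/FD; rewrite /= in_itv/= andbT => s0.
  by rewrite lee_fin mulr_ge0 ?poisson_ge0// derive1_phi_ge0.
have := @ge0_nondecreasing_set_cvg_integral _ (measurableTypeR R) R F _ mu ndF mF mf f0.
rewrite UF => /cvg_lim => <- //.
apply: lime_le.
  apply: ereal_nondecreasing_is_cvgn.
  exact: ge0_nondecreasing_set_nondecreasing_integral.
apply: nearW => n.
rewrite integral_poisson_segment//.
- rewrite lee_fin -mulrBr ler_pM2l//.
  have := atan_ltpi2 ((phi n.+2%:R - phi r) / e); have := atan_gtNpi2 ((phi n.+1%:R^-1 - phi r) / e).
  lra.
- by rewrite (@le_lt_trans _ _ 1) ?ltr1n// invf_le1 ?ler1n.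
Qed.

Lemma cvg_atan_scale (c : R) : 0 < c -> atan (c / n.+1%:R^-1) @[n --> \oo] --> pi / 2.
Proof.
move=> c0.
apply: (cvg_comp (fun n : nat => c / n.+1%:R^-1) atan); last exact: cvgy_atan.
under eq_fun do rewrite invrK.
suff : c * n.+1%:R @[n --> \oo] --> (+oo : set_system R) by [].
apply/cvgryPge => A; near=> n.
have : A / c <= n%:R by near: n; exact: nbhs_infty_ger.
rewrite ler_pdivrMr// mulrC => /le_trans; apply.
by rewrite ler_pM2l// ler_nat.
Unshelve. all: by end_near. Qed.

(** Strict monotonicity makes phi(r + d) - phi(r) and phi(r) - phi(r - d) positive,
so that both arctangents tend to pi/2: the kernel concentrates at s = r. *)
Lemma integral_poisson_cvg (r d : R) : 0 < d -> d < r ->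
  (\int[mu]_(s in `[(r - d)%R, (r + d)%R]) (poisson n.+1%:R^-1 (phi r - phi s) * derive1 phi s)%:E
   @[n --> \oo] --> (2 * pi)%:E)%E.
Proof.
move=> d0 dr.
have r0 : 0 < r by exact: lt_trans dr.
have rd0 : 0 < r - d by rewrite subr_gt0.
have H n : (\int[mu]_(s in `[(r - d)%R, (r + d)%R]) (poisson n.+1%:R^-1 (phi r - phi s) * derive1 phi s)%:E
  = (2 * atan ((phi (r + d) - phi r) / n.+1%:R^-1) + 2 * atan ((phi r - phi (r - d)) / n.+1%:R^-1))%:E)%E.
  rewrite integral_poisson_segment ?invr_gt0 ?ltr0n// ; last by lra.
  by rewrite -(opprB (phi r) (phi (r - d))) [X in _ - 2 * atan X]mulNr atanN mulrN opprK.
under eq_fun do rewrite H.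
apply: cvg_EFin; first by apply: nearW.
rewrite /comp/=.
have -> : 2 * pi = 2 * (pi / 2) + 2 * (pi / 2) :> R by field.
have lt1 : phi r < phi (r + d) by apply: iphi; rewrite ?in_itv/= ?andbT//; lra.
have lt2 : phi (r - d) < phi r by apply: iphi; rewrite ?in_itv/= ?andbT//; lra.
by apply: cvgD; apply: cvgM; (try exact: cvg_cst); apply: cvg_atan_scale; rewrite subr_gt0.
Qed.
End kernel.

(** * The Poisson kernel of a dispersion relation *)

Section phase.
Context {R : realType}.
Local Notation mu := (@lebesgue_measure R).
Local Notation D := (`]0%R, +oo[%classic : set R).
Variable phi : R -> R.
Hypothesis hphi : dispersion_assumption phi.

(** Extending phi and |phi'| by zero to the whole line makes them globally
measurable, whatever their arbitrary values off (0, oo). *)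
Definition phase : R -> R := phi \_ D.
Definition speed : R -> R := (fun r => `|derive1 phi r|) \_ D.

Lemma speed_ge0 r : 0 <= speed r.
Proof. by rewrite /speed patchE; case: ifP. Qed.

Lemma phaseE r : 0 < r -> phase r = phi r.
Proof. by move=> r0; rewrite /phase patchE mem_set//= in_itv/= r0. Qed.

Lemma speedE r : 0 < r -> speed r = `|derive1 phi r|.
Proof. by move=> r0; rewrite /speed patchE mem_set//= in_itv/= r0. Qed.

Lemma speed0 r : r <= 0 -> speed r = 0.
Proof. by move=> r0; rewrite /speed patchE memNset//= in_itv/= andbT; apply/negP; rewrite -leNgt. Qed.

Let dphi (r : R) : 0 < r -> derivable phi r 1. Proof. by case: hphi => + _ _; exact. Qed.
Let cphi : {within `]0, +oo[, continuous (derive1 phi)}. Proof. by case: hphi. Qed.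

Lemma measurable_phase : measurable_fun setT phase.
Proof. by apply/(measurable_restrictT _ _).1 => //; exact: measurable_phi dphi. Qed.

Lemma measurable_speed : measurable_fun setT speed.
Proof.
apply/(measurable_restrictT _ _).1 => //.
by apply: measurableT_comp => //; exact: measurable_dphi cphi.
Qed.

(** A continuous injective function on an interval is strictly monotone. *)
Lemma dispersion_mono : {in `]0, +oo[ &, {homo phi : x y / x < y}} \/
  {in `]0, +oo[ &, {homo (fun r => - phi r) : x y / x < y}}.
Proof.
case: hphi => _ _ inj.
have cp : {within [set` `]0, +oo[], continuous phi}.
  rewrite continuous_open_subspace; last exact: interval_open.
  by move=> r; rewrite inE/= in_itv/= andbT; exact: phi_continuous.
have [h|h] := itv_continuous_inj_mono cp inj; [left|right] => x y xI yI xy.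
  by rewrite h.
by rewrite ltrN2 h.
Qed.

Let dN (r : R) : 0 < r -> derive1 (fun r => - phi r) r = - derive1 phi r.
Proof. by move=> r0; rewrite derive1E deriveN ?derive1E//; exact: dphi. Qed.

Lemma phase_kernelE (e r : R) (A : set R) : measurable A -> A `<=` D -> 0 < r ->
  (\int[mu]_(s in A) (poisson e (phase r - phase s) * speed s)%:E
  = \int[mu]_(s in A) (poisson e (phi r - phi s) * `|derive1 phi s|)%:E)%E.
Proof.
move=> mA AD r0; apply: eq_integral => s; rewrite inE => /AD; rewrite /= in_itv/= andbT => s0.
by rewrite !phaseE// speedE.
Qed.

(** The Poisson kernel is even, so replacing phi by -phi changes nothing: one may
pass to the increasing one of the two. *)
Lemma phase_kernel_increasing :
  exists2 psi : R -> R, [/\ forall r : R, 0 < r -> derivable psi r 1,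
    {within `]0, +oo[, continuous (derive1 psi)} & {in `]0, +oo[ &, {homo psi : x y / x < y}} ] &
   forall e (r : R) (A : set R), measurable A -> A `<=` D -> 0 < r ->
  (\int[mu]_(s in A) (poisson e (phase r - phase s) * speed s)%:E
  = \int[mu]_(s in A) (poisson e (psi r - psi s) * derive1 psi s)%:E)%E.
Proof.
have [h|h] := dispersion_mono; [exists phi|exists (fun r => - phi r)] => //.
- move=> e r A mA AD r0; rewrite phase_kernelE//.
  apply: eq_integral => s; rewrite inE => /AD; rewrite /= in_itv/= andbT => s0.
  by rewrite ger0_norm//; exact: derive1_phi_ge0 dphi h _ s0.
- split => //.
  + by move=> r r0; apply: derivableN; exact: dphi.
  + rewrite continuous_open_subspace; last exact: interval_open.
    move=> r; rewrite inE/= in_itv/= andbT => r0.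
    rewrite /continuous_at dN//.
    have h1 : - derive1 phi s @[s --> r] --> - derive1 phi r.
      by apply: cvgN; exact: dphi_continuous.
    apply: (cvg_trans _ h1).
    apply: near_eq_cvg; near=> s; rewrite dN//.
    by near: s; exact: lt_nbhsr.
    Unshelve. all: try by end_near.
- move=> e r A mA AD r0; rewrite phase_kernelE//.
  apply: eq_integral => s; rewrite inE => /AD; rewrite /= in_itv/= andbT => s0.
  rewrite -opprB poissonN opprK addrC dN// ler0_norm//.
  rewrite -oppr_ge0 -dN//; apply: derive1_phi_ge0 => //.
  by move=> u u0; apply: derivableN; exact: dphi.
Qed.

Lemma phase_kernel_le (e r : R) : 0 < e -> 0 < r ->
  (\int[mu]_s (poisson e (phase r - phase s) * speed s)%:E <= (2 * pi)%:E)%E.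
Proof.
move=> e0 r0; have [psi [dpsi cpsi ipsi] psiE] := phase_kernel_increasing.
have <- : (\int[mu]_(s in D) (poisson e (phase r - phase s) * speed s)%:E =
  \int[mu]_s (poisson e (phase r - phase s) * speed s)%:E)%E.
  rewrite integral_mkcond; apply: eq_integral => s _; rewrite patchE.
  case: ifPn => //; rewrite notin_setE/= in_itv/= andbT => /negP; rewrite -leNgt => s0.
  by rewrite speed0// mulr0.
by rewrite psiE//; exact: integral_poisson_le.
Qed.

Lemma phase_kernel_cvg (r d : R) : 0 < d -> d < r ->
  (\int[mu]_(s in `[(r - d)%R, (r + d)%R]) (poisson n.+1%:R^-1 (phase r - phase s) * speed s)%:E
   @[n --> \oo] --> (2 * pi)%:E)%E.
Proof.
move=> d0 dr; have [psi [dpsi cpsi ipsi] psiE] := phase_kernel_increasing.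
have H n : (\int[mu]_(s in `[(r - d)%R, (r + d)%R])
    (poisson n.+1%:R^-1 (phase r - phase s) * speed s)%:E =
    \int[mu]_(s in `[(r - d)%R, (r + d)%R])
    (poisson n.+1%:R^-1 (psi r - psi s) * derive1 psi s)%:E)%E.
  apply: psiE => //; last exact: lt_trans dr.
  move=> s; rewrite /= !in_itv/= andbT => /andP[h _].
  by rewrite (lt_le_trans _ h)// subr_gt0.
by under eq_fun do rewrite H; exact: integral_poisson_cvg.
Qed.
End phase.

(** * Damped cosine and sine transforms along a phase *)

(** Integration in a parameter preserves joint measurability even where the inner
integral diverges: positive and negative parts are treated separately. *)
Lemma measurable_Rintegral_param d1 d2 (T1 : measurableType d1)
  (T2 : measurableType d2) (R : realType)
  (m2 : {sigma_finite_measure set T2 -> \bar R}) (F : T1 * T2 -> R) :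
  measurable_fun setT F ->
  measurable_fun setT (fun x => \int[m2]_y F (x, y)).
Proof.
move=> mF.
have mE : measurable_fun setT (EFin \o F) by exact/measurable_EFinP.
rewrite /Rintegral; apply: measurableT_comp => //.
have -> : (fun x => \int[m2]_y (F (x, y))%:E)%E =
   ((fun x => \int[m2]_y ((EFin \o F)^\+ (x, y))) \-
    (fun x => \int[m2]_y ((EFin \o F)^\- (x, y))))%E.
  apply/funext => x /=; rewrite integralE.
  by congr (_ - _)%E; apply: eq_integral => y _; rewrite !(funeposE, funenegE).
apply: emeasurable_funB.
- apply: (@measurable_fun_fubini_tonelli_F _ _ T1 T2 R m2 ((EFin \o F)^\+)%E) => //.
  exact: measurable_funepos.
- apply: (@measurable_fun_fubini_tonelli_F _ _ T1 T2 R m2 ((EFin \o F)^\-)%E) => //.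
  exact: measurable_funeneg.
Qed.

Section fubini.
Context d1 d2 (T1 : measurableType d1) (T2 : measurableType d2) (R : realType).
Variables (m1 : {sigma_finite_measure set T1 -> \bar R}).
Variables (m2 : {sigma_finite_measure set T2 -> \bar R}).
Implicit Types F : T1 * T2 -> R.

Lemma Fubini_Rintegral F : (m1 \x m2)%E.-integrable setT (EFin \o F) ->
  \int[m1]_x \int[m2]_y F (x, y) = \int[m2]_y \int[m1]_x F (x, y).
Proof.
move=> iF; rewrite /Rintegral; congr fine.
have mF := measurable_int _ iF.
transitivity (\int[m1]_x \int[m2]_y (F (x, y))%:E)%E.
  apply: ae_eq_integral => //.
  - apply/measurable_EFinP; apply: measurable_Rintegral_param; exact/measurable_EFinP.
  - exact: (measurable_fubini_F iF).
  - have := ae_integrable1 iF; apply: filterS => x ix _.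
    by rewrite fineK//; exact: integrable_fin_num ix.
rewrite (Fubini iF); apply: ae_eq_integral => //.
- exact: (measurable_fubini_G iF).
- apply/measurable_EFinP.
  apply: (@measurable_Rintegral_param _ _ T2 T1 R m1 (fun p : T2 * T1 => F (p.2, p.1))).
  apply: measurableT_comp => //; first exact/measurable_EFinP.
  exact: measurable_fun_pair.
- have := ae_integrable2 iF; apply: filterS => y iy _.
  by rewrite fineK//; exact: integrable_fin_num iy.
Qed.

(** Domination by a product of one-variable integrable functions is the form in
which every application of Fubini below is justified. *)
Lemma integrable_prod_bound F (a : T1 -> R) (b : T2 -> R) :
  measurable_fun setT F ->
  m1.-integrable setT (EFin \o a) -> m2.-integrable setT (EFin \o b) ->
  (forall x y, `|F (x, y)| <= `|a x| * `|b y|) ->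
  (m1 \x m2)%E.-integrable setT (EFin \o F).
Proof.
move=> mF ia ib Fab.
apply/integrable12ltyP; first exact/measurable_EFinP.
have /integrableP[/measurable_EFinP ma fa] := ia.
have /integrableP[/measurable_EFinP mb fb] := ib.
pose B := (\int[m2]_y `|(b y)%:E|)%E.
have B0 : (0 <= B)%E by apply: integral_ge0.
apply: (@le_lt_trans _ _ (\int[m1]_x (`|(a x)%:E| * B))%E); last first.
  rewrite ge0_integralZr//; last by apply: measurableT_comp => //; exact/measurable_EFinP.
  by apply: lte_mul_pinfty => //; [exact: integral_ge0|rewrite ge0_fin_numE//; exact: integral_ge0].
apply: ge0_le_integral => //.
- by move=> x _; exact: integral_ge0.
- apply: (@measurable_fun_fubini_tonelli_F _ _ T1 T2 R m2 (abse \o (EFin \o F))).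
    by apply: measurableT_comp => //; exact/measurable_EFinP.
  by move=> z; exact: abse_ge0.
- by apply: emeasurable_funM => //; apply: measurableT_comp => //; exact/measurable_EFinP.
- move=> x _; rewrite -ge0_integralZl//; last by apply: measurableT_comp => //; exact/measurable_EFinP.
  apply: ge0_le_integral => //.
  + apply: measurableT_comp => //; apply/measurable_EFinP.
    exact: measurableT_comp mF _.
  + by apply: emeasurable_funM => //; apply: measurableT_comp => //; exact/measurable_EFinP.
  + by move=> y _; rewrite /= -EFinM lee_fin Fab.
Qed.
End fubini.

Section regularized.
Context {R : realType}.
Local Notation mu := (@lebesgue_measure R).
Variables (Phi k : R -> R).
Hypothesis mPhi : measurable_fun setT Phi.
Hypothesis ik : mu.-integrable setT (EFin \o k).

(** Real and imaginary parts of the Fourier integral of k along the phase Phi. *)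
Definition ctrans (Phi k : R -> R) (t : R) : R := \int[mu]_s (cos (t * Phi s) * k s).
Definition strans (Phi k : R -> R) (t : R) : R := \int[mu]_s (sin (t * Phi s) * k s).

Let mk : measurable_fun setT k.
Proof. by case/integrableP : ik => /measurable_EFinP. Qed.

Lemma measurable_cosf d (T : measurableType d) (f : T -> R) :
  measurable_fun setT f -> measurable_fun setT (fun x => cos (f x)).
Proof.
move=> mf; apply: (@measurableT_comp _ _ _ _ _ _ cos) => //.
by apply: continuous_measurable_fun; exact: continuous_cos.
Qed.

Lemma measurable_sinf d (T : measurableType d) (f : T -> R) :
  measurable_fun setT f -> measurable_fun setT (fun x => sin (f x)).
Proof.
move=> mf; apply: (@measurableT_comp _ _ _ _ _ _ sin) => //.
by apply: continuous_measurable_fun; exact: continuous_sin.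
Qed.

Lemma normr_cos_le1 (x : R) : `|cos x| <= 1.
Proof. by rewrite ler_norml cos_geN1 cos_le1. Qed.

Lemma normr_sin_le1 (x : R) : `|sin x| <= 1.
Proof. by rewrite ler_norml sin_geN1 sin_le1. Qed.

Lemma integrable_mul_bounded (h g : R -> R) (M : R) :
  mu.-integrable setT (EFin \o g) -> measurable_fun setT h ->
  (forall x, `|h x| <= M) -> mu.-integrable setT (EFin \o (fun x => h x * g x)).
Proof.
move=> ig mh hM.
have /integrableP[/measurable_EFinP mg _] := ig.
apply: (le_integrable _ _ _ (integrableZl _ M ig)) => //.
  by apply/measurable_EFinP; exact: measurable_funM.
move=> x _ /=; rewrite lee_fin !normrM ler_wpM2r//.
by rewrite (le_trans (hM x))// ler_norm.
Qed.

Lemma integrable_cosM (h g : R -> R) : measurable_fun setT h ->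
  mu.-integrable setT (EFin \o g) ->
  mu.-integrable setT (EFin \o (fun s => cos (h s) * g s)).
Proof.
move=> mh jg; apply: (@integrable_mul_bounded _ _ 1) => //.
  exact: measurable_cosf.
by move=> x; exact: normr_cos_le1.
Qed.

Lemma integrable_sinM (h g : R -> R) : measurable_fun setT h ->
  mu.-integrable setT (EFin \o g) ->
  mu.-integrable setT (EFin \o (fun s => sin (h s) * g s)).
Proof.
move=> mh jg; apply: (@integrable_mul_bounded _ _ 1) => //.
  exact: measurable_sinf.
by move=> x; exact: normr_sin_le1.
Qed.

Let mtPhi (t : R) : measurable_fun setT (fun s => t * Phi s).
Proof. exact: measurable_funM. Qed.

Let ic t : mu.-integrable setT (EFin \o (fun s => cos (t * Phi s) * k s)).
Proof. exact: (integrable_cosM (mtPhi t) ik). Qed.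

Let isn t : mu.-integrable setT (EFin \o (fun s => sin (t * Phi s) * k s)).
Proof. exact: (integrable_sinM (mtPhi t) ik). Qed.

Let K : R := \int[mu]_s `|k s|.

Let K0 : 0 <= K. Proof. by apply: Rintegral_ge0. Qed.

Lemma ctrans_le t : `|ctrans Phi k t| <= \int[mu]_s `|k s|.
Proof.
apply: (le_trans (le_normr_Rintegral _ (ic t))) => //.
apply: le_Rintegral => //.
- exact: (integrable_abse (ic t)).
- exact: (integrable_abse ik).
- by move=> x _; rewrite normrM ler_piMl// normr_cos_le1.
Qed.

Lemma strans_le t : `|strans Phi k t| <= \int[mu]_s `|k s|.
Proof.
apply: (le_trans (le_normr_Rintegral _ (isn t))) => //.
apply: le_Rintegral => //.
- exact: (integrable_abse (isn t)).
- exact: (integrable_abse ik).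
- by move=> x _; rewrite normrM ler_piMl// normr_sin_le1.
Qed.

Lemma measurable_ctrans : measurable_fun setT (ctrans Phi k).
Proof.
apply: (@measurable_Rintegral_param _ _ _ _ _ mu (fun p : R * R => cos (p.1 * Phi p.2) * k p.2)).
apply: measurable_funM; last exact: measurableT_comp.
apply: measurable_cosf; apply: measurable_funM => //.
exact: measurableT_comp.
Qed.

Lemma measurable_strans : measurable_fun setT (strans Phi k).
Proof.
apply: (@measurable_Rintegral_param _ _ _ _ _ mu (fun p : R * R => sin (p.1 * Phi p.2) * k p.2)).
apply: measurable_funM; last exact: measurableT_comp.
apply: measurable_sinf; apply: measurable_funM => //.
exact: measurableT_comp.
Qed.

Let w e (t : R) : R := expR (- e * `|t|).

(** The damping factor makes Fubini available; the sum of products of cosines and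
sines is cos(t (Phi r - Phi s)), whose damped t-integral is the Poisson kernel. *)
Lemma regularized_inner e r : 0 < e ->
  \int[mu]_t (w e t * (cos (t * Phi r) * ctrans Phi k t + sin (t * Phi r) * strans Phi k t))
  = \int[mu]_s (poisson e (Phi r - Phi s) * k s).
Proof.
move=> e0.
pose F (p : R * R) : R := w e p.1 * (cos (p.1 * (Phi r - Phi p.2)) * k p.2).
have mF : measurable_fun setT F.
  apply: measurable_funM.
    apply: (measurableT_comp (f := w e)) => //; exact: measurable_exp_abs.
  apply: measurable_funM; last exact: measurableT_comp.
  apply: measurable_cosf; apply: measurable_funM => //.
  apply: measurable_funB => //; exact: measurableT_comp.
have iF : (mu \x mu)%E.-integrable setT (EFin \o F).
  apply: (@integrable_prod_bound _ _ _ _ _ mu mu F (w e) k) => //.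
    exact: integrable_exp_abs.
  move=> x y; rewrite /F /= !normrM ler_wpM2l// ler_piMl// normr_cos_le1//.
transitivity (\int[mu]_t \int[mu]_s F (t, s)).
  apply: eq_Rintegral => t _; rewrite /F /=.
  rewrite RintegralZl//; last first.
    apply: (@integrable_mul_bounded _ _ 1) => //.
      by apply: measurable_cosf; apply: measurable_funM => //; exact: measurable_funB.
    by move=> x; exact: normr_cos_le1.
  congr (_ * _); rewrite /ctrans /strans -!RintegralZl//.
  rewrite -RintegralD//.
  - apply: eq_Rintegral => s _; rewrite mulrBr cosB; ring.
  - exact: (integrableZl _ _ (ic t)).
  - exact: (integrableZl _ _ (isn t)).
rewrite (Fubini_Rintegral iF).
apply: eq_Rintegral => s _; rewrite /F /=.
under eq_Rintegral do rewrite mulrA.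
rewrite RintegralZr//; first by rewrite poisson_fourier.
under eq_fun do rewrite mulrC.
apply: (@integrable_mul_bounded _ _ 1).
- exact: integrable_exp_abs.
- by apply: measurable_cosf; exact: measurable_funM.
- by move=> x; exact: normr_cos_le1.
Qed.

(** One square of the transform is expanded as an integral in r and the remaining
transform is absorbed by [regularized_inner]. *)
Lemma regularized_identity e : 0 < e ->
  \int[mu]_t (w e t * (ctrans Phi k t ^+ 2 + strans Phi k t ^+ 2))
  = \int[mu]_r (k r * \int[mu]_s (poisson e (Phi r - Phi s) * k s)).
Proof.
move=> e0.
pose F (p : R * R) : R := w e p.1 * (cos (p.1 * Phi p.2) * ctrans Phi k p.1 + sin (p.1 * Phi p.2) * strans Phi k p.1) * k p.2.
have mF : measurable_fun setT F.
  apply: measurable_funM; last exact: measurableT_comp.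
  apply: measurable_funM.
    apply: (measurableT_comp (f := w e)) => //; exact: measurable_exp_abs.
  have mp : measurable_fun setT (fun p : R * R => p.1 * Phi p.2).
    by apply: measurable_funM => //; exact: measurableT_comp.
  apply: measurable_funD; apply: measurable_funM.
  - exact: measurable_cosf.
  - apply: (measurableT_comp (f := ctrans Phi k)) => //; exact: measurable_ctrans.
  - exact: measurable_sinf.
  - apply: (measurableT_comp (f := strans Phi k)) => //; exact: measurable_strans.
have iF : (mu \x mu)%E.-integrable setT (EFin \o F).
  apply: (@integrable_prod_bound _ _ _ _ _ mu mu F (fun t => (K + K) * w e t) k) => //.
    exact: (integrableZl _ (K + K) (integrable_exp_abs e0)).
  move=> x y; rewrite /F /= !normrM ler_wpM2r// mulrC ler_wpM2r//.
  rewrite (le_trans (ler_normD _ _))// [leRHS]ger0_norm ?addr_ge0//.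
  rewrite !normrM -[in leRHS](mul1r K).
  apply: lerD; apply: ler_pM => //.
  - exact: normr_cos_le1.
  - exact: ctrans_le.
  - exact: normr_sin_le1.
  - exact: strans_le.
transitivity (\int[mu]_t \int[mu]_s F (t, s)).
  apply: eq_Rintegral => t _; rewrite /F /=.
  have i1 := integrableZl measurableT (ctrans Phi k t) (ic t).
  have i2 := integrableZl measurableT (strans Phi k t) (isn t).
  under [RHS]eq_Rintegral => s _.
    rewrite (_ : _ * k s = w e t * (ctrans Phi k t * (cos (t * Phi s) * k s) +
      strans Phi k t * (sin (t * Phi s) * k s))); last by ring.
  over.
  rewrite RintegralZl//; last first.
    exact: (integrableD measurableT i1 i2).
  by rewrite RintegralD// !RintegralZl// !expr2.
rewrite (Fubini_Rintegral iF).
apply: eq_Rintegral => r _; rewrite /F /= -regularized_inner//.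
rewrite RintegralZr//; first by rewrite mulrC.
under eq_fun do rewrite mulrC.
apply: (@integrable_mul_bounded _ _ (K + K)).
- exact: integrable_exp_abs.
- have mp : measurable_fun setT (fun p : R => p * Phi r) by exact: measurable_funM.
  apply: measurable_funD; apply: measurable_funM.
  + exact: measurable_cosf.
  + exact: measurable_ctrans.
  + exact: measurable_sinf.
  + exact: measurable_strans.
- move=> x; rewrite (le_trans (ler_normD _ _))// !normrM -[in leRHS](mul1r K).
  apply: lerD; apply: ler_pM => //.
  - exact: normr_cos_le1.
  - exact: ctrans_le.
  - exact: normr_sin_le1.
  - exact: strans_le.
Qed.

Lemma integrable_regularized e : 0 < e ->
  mu.-integrable setT (EFin \o (fun t => w e t * (ctrans Phi k t ^+ 2 + strans Phi k t ^+ 2))).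
Proof.
move=> e0; under eq_fun do rewrite mulrC.
apply: (@integrable_mul_bounded _ _ (K ^+ 2 + K ^+ 2)).
- exact: integrable_exp_abs.
- by apply: measurable_funD; apply: measurable_funX; [exact: measurable_ctrans|exact: measurable_strans].
- move=> x; rewrite ger0_norm ?addr_ge0 ?sqr_ge0//.
  by apply: lerD; rewrite -[leLHS]real_normK ?num_real// lerXn2r ?nnegrE// ?ctrans_le ?strans_le.
Qed.
End regularized.

(** * Plancherel along a phase: the upper bound *)

Lemma abs_Rintegral_le d (T : measurableType d) (R : realType)
    (mu : {measure set T -> \bar R}) (f : T -> R) :
  measurable_fun setT f ->
  (`|\int[mu]_x f x|%:E <= \int[mu]_x `|f x|%:E)%E.
Proof.
move=> mf; apply: (@le_trans _ _ `|\int[mu]_x (f x)%:E|%E).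
  rewrite /Rintegral; case: (\int[mu]_x (f x)%:E)%E => [r||] //=; by rewrite normr0 leey.
by apply: le_abse_integral => //; exact/measurable_EFinP.
Qed.

Section plancherel_le.
Context {R : realType}.
Local Notation mu := (@lebesgue_measure R).
Variable phi : R -> R.
Hypothesis hphi : dispersion_assumption phi.
Local Notation Phi := (phase phi).
Local Notation rho := (speed phi).

Let mPhi : measurable_fun setT Phi. Proof. exact: measurable_phase. Qed.
Let mrho : measurable_fun setT rho. Proof. exact: measurable_speed. Qed.

Lemma speed_neq0 r : rho r != 0 -> 0 < r.
Proof. by apply: contraNT; rewrite -leNgt => /speed0 ->. Qed.

Lemma measurable_kernel (e : R) : 0 < e ->
  measurable_fun setT (fun p : R * R => poisson e (Phi p.1 - Phi p.2)).
Proof.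
move=> e0; apply: (measurableT_comp (f := poisson e)) => //.
  exact: measurable_poisson.
by apply: measurable_funB; exact: measurableT_comp.
Qed.

(** A function on frequencies enters as kap * rho: the weight rho = |phi'| is the
Jacobian of the phase, so that kap plays the role of a function of phi(r). *)
Section kap.
Variable kap : R -> R.
Hypothesis mkap : measurable_fun setT kap.
Let k r := kap r * rho r.
Hypothesis ik : mu.-integrable setT (EFin \o k).
Let mk : measurable_fun setT k. Proof. exact: measurable_funM. Qed.
Let E : \bar R := (\int[mu]_r (kap r ^+ 2 * rho r)%:E)%E.

(** Schur's test: |k(r) k(s)| <= rho(r) rho(s) (kap(r)^2 + kap(s)^2) / 2, the two halves
agree because the kernel is even, and the kernel integrates to at most 2 pi
against rho. *)
Lemma regularized_le (e : R) : 0 < e ->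
  ((\int[mu]_t (expR (- e * `|t|) * (ctrans Phi k t ^+ 2 + strans Phi k t ^+ 2)))%:E
   <= (2 * pi)%:E * E)%E.
Proof.
move=> e0; rewrite (regularized_identity mPhi ik e0).
have mP := measurable_kernel e0.
pose P r s := poisson e (Phi r - Phi s).
have mPr r : measurable_fun setT (P r).
  apply: (measurableT_comp (f := poisson e)) => //; first exact: measurable_poisson.
  exact: measurable_funB.
have mPk r : measurable_fun setT (fun s => P r s * k s) by exact: measurable_funM.
have P0 r s : 0 <= P r s by exact: poisson_ge0.
pose G (p : R * R) : R := P p.1 p.2 * (rho p.1 * rho p.2) * kap p.1 ^+ 2.
have mG : measurable_fun setT G.
  by apply: measurable_funM; [apply: measurable_funM => //; apply: measurable_funM|apply: measurable_funX]; exact: measurableT_comp.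
have G0 p : 0 <= G p.
  by rewrite /G; apply: mulr_ge0; [apply: mulr_ge0 => //; apply: mulr_ge0; exact: speed_ge0|exact: sqr_ge0].
pose H (p : R * R) : R := (G p + G (p.2, p.1)) / 2.
have mGs : measurable_fun setT (fun p : R * R => G (p.2, p.1)).
  by apply: measurableT_comp => //; exact: measurable_fun_pair.
have H0 p : 0 <= H p by rewrite /H divr_ge0 ?addr_ge0.
have mH : measurable_fun setT H by apply: measurable_funM => //; exact: measurable_funD.
have kH r s : `|k r| * (P r s * `|k s|) <= H (r, s).
  rewrite /H /G /= -[P s r]poissonN opprB -/(P r s) /k !normrM !(ger0_norm (speed_ge0 _ _)).
  have -> : (P r s * (rho r * rho s) * kap r ^+ 2 + P r s * (rho s * rho r) * kap s ^+ 2) / 2 =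
    P r s * rho r * rho s * ((`|kap r| ^+ 2 + `|kap s| ^+ 2) / 2).
    by rewrite !real_normK ?num_real//; field.
  have -> : `|kap r| * rho r * (P r s * (`|kap s| * rho s)) = P r s * rho r * rho s * (`|kap r| * `|kap s|) by ring.
  apply: ler_wpM2l.
    by apply: mulr_ge0; [apply: mulr_ge0 => //; exact: speed_ge0|exact: speed_ge0].
  have := sqr_ge0 (`|kap r| - `|kap s|); rewrite sqrrB; lra.
have step1 : ((\int[mu]_r (k r * \int[mu]_s (poisson e (Phi r - Phi s) * k s)))%:E
    <= \int[mu]_r \int[mu]_s (H (r, s))%:E)%E.
  apply: (@le_trans _ _ (`|\int[mu]_r (k r * \int[mu]_s (P r s * k s))|%:E)%E).
    by rewrite lee_fin ler_norm.
  have mU : measurable_fun setT (fun r => \int[mu]_s (P r s * k s)).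
    apply: (@measurable_Rintegral_param _ _ _ _ _ mu (fun p : R * R => P p.1 p.2 * k p.2)).
    by apply: measurable_funM => //; exact: measurableT_comp.
  apply: (le_trans (abs_Rintegral_le _ _)); first exact: measurable_funM.
  apply: ge0_le_integral => //.
  - by apply/measurable_EFinP; apply: measurableT_comp => //; exact: measurable_funM.
  - apply: (@measurable_fun_fubini_tonelli_F _ _ _ _ R mu (EFin \o H)) => //.
    exact/measurable_EFinP.
  - move=> r _; rewrite normrM EFinM.
    apply: (@le_trans _ _ (`|k r|%:E * \int[mu]_s `|P r s * k s|%:E)%E).
      apply: lee_wpmul2l => //; apply: abs_Rintegral_le.
      exact: (measurable_funM (mPr r) mk).
    rewrite -ge0_integralZl//; last first.
      by apply/measurable_EFinP; apply: measurableT_comp => //; exact: (mPk r).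
    apply: ge0_le_integral => //.
    + apply/measurable_EFinP; apply: measurable_funM => //.
      by apply: measurableT_comp => //; exact: (mPk r).
    + by apply/measurable_EFinP; apply: measurableT_comp mH _.
    + by move=> s _; rewrite -EFinM lee_fin [`|P r s * _|]normrM (ger0_norm (P0 _ _)).
apply: (le_trans step1).
have mGr r : measurable_fun setT (fun s => G (r, s)) by apply: measurableT_comp mG _.
have mGsr r : measurable_fun setT (fun s => G (s, r)) by apply: measurableT_comp mG _.
have mGi : measurable_fun setT (fun r => \int[mu]_s (G (r, s))%:E)%E.
  apply: (@measurable_fun_fubini_tonelli_F _ _ _ _ R mu (EFin \o G)) => //.
  exact/measurable_EFinP.
have mGsi : measurable_fun setT (fun r => \int[mu]_s (G (s, r))%:E)%E.
  apply: (@measurable_fun_fubini_tonelli_G _ _ _ _ R mu (EFin \o G)) => //.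
  exact/measurable_EFinP.
have mEr r : measurable_fun setT (fun s => (G (r, s))%:E) by exact/measurable_EFinP.
have mEs r : measurable_fun setT (fun s => (G (s, r))%:E) by exact/measurable_EFinP.
have iG0 r : (0 <= \int[mu]_s (G (r, s))%:E)%E.
  by apply: integral_ge0 => s _; rewrite lee_fin.
have iGs0 r : (0 <= \int[mu]_s (G (s, r))%:E)%E.
  by apply: integral_ge0 => s _; rewrite lee_fin.
have GE0 p : (0 <= (G p)%:E)%E by rewrite lee_fin.
have inner r : (\int[mu]_s (H (r, s))%:E =
    (2^-1)%:E * (\int[mu]_s (G (r, s))%:E + \int[mu]_s (G (s, r))%:E))%E.
  have hD := @ge0_integralD _ _ R mu setT measurableT _ _
    (fun s _ => GE0 (r, s)) (mEr r) (fun s _ => GE0 (s, r)) (mEs r).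
  rewrite -[X in (_ * X)%E]hD.
  have h2 : (0 <= (2^-1)%:E :> \bar R)%E by rewrite lee_fin.
  rewrite -[RHS](@ge0_integralZl _ _ R mu setT measurableT _ _ _ _ h2).
  + by apply: eq_integral => s _; rewrite -EFinD -EFinM /H mulrC.
  + exact: (emeasurable_funD (mEr r) (mEs r)).
  + by move=> s _; rewrite -EFinD lee_fin addr_ge0.
have -> : (\int[mu]_r \int[mu]_s (H (r, s))%:E = \int[mu]_r \int[mu]_s (G (r, s))%:E)%E.
  under eq_integral do rewrite inner.
  have hD := @ge0_integralD _ _ R mu setT measurableT _ _
    (fun r _ => iG0 r) mGi (fun r _ => iGs0 r) mGsi.
  have h2 : (0 <= (2^-1)%:E :> \bar R)%E by rewrite lee_fin.
  rewrite (@ge0_integralZl _ _ R mu setT measurableT _ _ _ _ h2).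
  + rewrite hD.
    rewrite -(@fubini_tonelli _ _ _ _ _ mu mu (EFin \o G))//; last exact/measurable_EFinP.
    set I := (\int[mu]_x _)%E.
    have I0 : (0 <= I)%E by apply: integral_ge0 => r _; exact: iG0.
    by rewrite -mule2n -mule_natl muleA -EFinM mulVf// mul1e.
  + exact: (emeasurable_funD mGi mGsi).
  + by move=> r _; apply: adde_ge0.
have mkr : measurable_fun setT (fun r => (kap r ^+ 2 * rho r)%:E).
  by apply/measurable_EFinP; apply: measurable_funM => //; exact: measurable_funX.
have kr0 r : (0 <= (kap r ^+ 2 * rho r)%:E)%E.
  by rewrite lee_fin; apply: mulr_ge0; [exact: sqr_ge0|exact: speed_ge0].
have pi20 : (0 <= (2 * pi)%:E :> \bar R)%E by rewrite lee_fin mulr_ge0// pi_ge0.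
rewrite -(@ge0_integralZl _ _ R mu setT measurableT _ mkr _ (fun r _ => kr0 r) pi20).
apply: ge0_le_integral => //.
- exact: (measurable_funeM _ mkr).
- move=> r _; rewrite /G /=.
  under eq_integral => s _.
    rewrite (_ : _ * _ = (kap r ^+ 2 * rho r) * (P r s * rho s)); last by ring.
    rewrite EFinM.
  over.
  have mPrho : measurable_fun setT (fun s => (P r s * rho s)%:E).
    by apply/measurable_EFinP; exact: measurable_funM.
  have Prho0 s : (0 <= (P r s * rho s)%:E)%E.
    by rewrite lee_fin; apply: mulr_ge0 => //; exact: speed_ge0.
  rewrite (@ge0_integralZl _ _ R mu setT measurableT _ mPrho _ (fun s _ => Prho0 s) (kr0 r)).
  have [->|r0] := eqVneq (rho r) 0; first by rewrite mulr0 mul0e mule0.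
  rewrite muleC; apply: lee_wpmul2r => //.
  by apply: phase_kernel_le => //; exact: speed_neq0.
Qed.

(** The damping e^{-|t|/(n+1)} increases to 1, so monotone convergence applies. *)
Lemma plancherel_le :
  (\int[mu]_t (ctrans Phi k t ^+ 2 + strans Phi k t ^+ 2)%:E <= (2 * pi)%:E * E)%E.
Proof.
pose Q t := ctrans Phi k t ^+ 2 + strans Phi k t ^+ 2.
have Q0 t : 0 <= Q t by rewrite addr_ge0// sqr_ge0.
have mQ : measurable_fun setT Q.
  by apply: measurable_funD; apply: measurable_funX; [exact: measurable_ctrans|exact: measurable_strans].
pose g (n : nat) (t : R) : \bar R := (expR (- n.+1%:R^-1 * `|t|) * Q t)%:E.
have gQ t : g n t @[n --> \oo] --> (Q t)%:E.
  apply: cvg_EFin; first by apply: nearW.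
  rewrite /comp /= -[X in _ --> X]mul1r; apply: cvgM; last exact: cvg_cst.
  rewrite -[X in _ --> X]expR0; apply: continuous_cvg; first exact: continuous_expR.
  rewrite -(mul0r `|t|); apply: cvgM; last exact: cvg_cst.
  rewrite -oppr0; apply: cvgN; exact: cvg_harmonic.
have -> : (\int[mu]_t (Q t)%:E = \int[mu]_t limn (g ^~ t))%E.
  by apply: eq_integral => t _; apply/esym/cvg_lim.
have g0 n t : (0 <= g n t)%E by rewrite lee_fin mulr_ge0// expR_ge0.
have ndg t m n : (m <= n)%N -> (g m t <= g n t)%E.
  move=> mn; rewrite lee_fin ler_wpM2r// ler_expR ler_wpM2r// lerN2.
  by rewrite lef_pV2 ?posrE// ler_nat.
have mg n : measurable_fun setT (g n).
  by apply/measurable_EFinP; apply: measurable_funM => //; exact: measurable_exp_abs.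
rewrite monotone_convergence//.
- apply: lime_le.
    apply: ereal_nondecreasing_is_cvgn => m n mn.
    by apply: ge0_le_integral => //; [exact: mg|exact: mg|move=> t _; exact: ndg].
  apply: nearW => n.
  have := regularized_le (e := n.+1%:R^-1); rewrite invr_gt0 => /(_ (ltr0Sn _ _)).
  apply: le_trans; rewrite /Rintegral fineK//.
  apply: integrable_fin_num => //.
  by apply: integrable_regularized => //; rewrite invr_gt0.
- by move=> t _ m n; exact: ndg.
Qed.
End kap.
End plancherel_le.

(** * Plancherel along a phase: the identity *)

Lemma ge0_le_integral_comb d (T : measurableType d) (R : realType)
    (mu : {measure set T -> \bar R}) (a b c : T -> R) (x y : R) :
  measurable_fun setT a -> measurable_fun setT b -> measurable_fun setT c ->
  (forall t, 0 <= a t) -> (forall t, 0 <= b t) -> (forall t, 0 <= c t) ->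
  0 <= x -> 0 <= y -> (forall t, c t <= x * a t + y * b t) ->
  (\int[mu]_t (c t)%:E <= x%:E * \int[mu]_t (a t)%:E + y%:E * \int[mu]_t (b t)%:E)%E.
Proof.
move=> ma mb mc a0 b0 c0 x0 y0 cab.
have mA : measurable_fun setT (fun t => (a t)%:E) by exact/measurable_EFinP.
have mB : measurable_fun setT (fun t => (b t)%:E) by exact/measurable_EFinP.
rewrite -!ge0_integralZl//; last 2 first.
  by move=> t _; rewrite lee_fin.
  by move=> t _; rewrite lee_fin.
rewrite -ge0_integralD//; first last.
- exact: measurable_funeM.
- by move=> t _; rewrite -EFinM lee_fin mulr_ge0.
- exact: measurable_funeM.
- by move=> t _; rewrite -EFinM lee_fin mulr_ge0.
apply: ge0_le_integral => //.
- by move=> t _; rewrite lee_fin.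
- exact/measurable_EFinP.
- by apply: emeasurable_funD; exact: measurable_funeM.
- by move=> t _; rewrite -!EFinM -EFinD lee_fin.
Qed.

Lemma sqrD_le (R : realFieldType) (d x y : R) : 0 < d ->
  (x + y) ^+ 2 <= (1 + d) * x ^+ 2 + (1 + d^-1) * y ^+ 2.
Proof.
move=> d0.
suff -> : (1 + d) * x ^+ 2 + (1 + d^-1) * y ^+ 2 = (x + y) ^+ 2 + d^-1 * (d * x - y) ^+ 2.
  by rewrite lerDl mulr_ge0 ?sqr_ge0// invr_ge0 ltW.
by field; rewrite lt0r_neq0.
Qed.

(** The shape of the bound produced by two consecutive uses of [sqrD_le] with an
error e: let e tend to 0 first, then d. *)
Lemma le_two_step_approx (R : realType) (A B : R) : 0 <= B ->
  (forall d e, 0 < d -> 0 < e ->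
    A <= (1 + d) * ((1 + d) * B + (1 + d^-1) * e) + (1 + d^-1) * e) -> A <= B.
Proof.
move=> B0 h.
have h1 d : 0 < d -> A <= (1 + d) ^+ 2 * B.
  move=> d0; apply/ler_addgt0Pr => e e0.
  pose C := (1 + d) * (1 + d^-1) + (1 + d^-1).
  have C0 : 0 < C.
    by have i0 : 0 < d^-1 by [rewrite invr_gt0]; rewrite /C; nra.
  have := h d (e / C) d0 (divr_gt0 e0 C0).
  have -> : (1 + d) * ((1 + d) * B + (1 + d^-1) * (e / C)) + (1 + d^-1) * (e / C)
    = (1 + d) ^+ 2 * B + C * (e / C) by rewrite /C; ring.
  by rewrite mulrCA divff ?lt0r_neq0// mulr1.
apply/ler_addgt0Pr => e e0.
pose d := Num.min 1 (e / (3 * B + 1)).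
have D0 : 0 < 3 * B + 1 by lra.
have d0 : 0 < d by rewrite lt_min ltr01 divr_gt0.
have d1 : d <= 1 by rewrite ge_min lexx.
have dB : d * (3 * B + 1) <= e by rewrite -ler_pdivlMr// ge_min lexx orbT.
have := h1 d d0; nra.
Qed.

Section plancherel.
Context {R : realType}.
Local Notation mu := (@lebesgue_measure R).
Variable phi : R -> R.
Hypothesis hphi : dispersion_assumption phi.
Local Notation Phi := (phase phi).
Local Notation rho := (speed phi).

Let mPhi : measurable_fun setT Phi. Proof. exact: measurable_phase. Qed.
Let mrho : measurable_fun setT rho. Proof. exact: measurable_speed. Qed.

(** The kernels form an approximate identity at r for the measure rho(s) ds. The
mass off the window [r - d, r + d] is at most 2 pi minus the mass inside, and the
latter tends to 2 pi. *)
Lemma phase_kernel_pointwise_cvg (kap : R -> R) (M r : R) : measurable_fun setT kap ->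
  (forall s, `|kap s| <= M) -> 0 < r -> {for r, continuous kap} ->
  \int[mu]_s (poisson n.+1%:R^-1 (Phi r - Phi s) * (kap s * rho s)) @[n --> \oo]
   --> 2 * pi * kap r.
Proof.
move=> mkap kM r0 ck.
have M0 : 0 <= M by exact: le_trans (kM 0).
pose P (n : nat) s := poisson n.+1%:R^-1 (Phi r - Phi s).
have e0 (n : nat) : 0 < n.+1%:R^-1 :> R by rewrite invr_gt0.
have P0 n s : 0 <= P n s by exact: poisson_ge0.
have mP n : measurable_fun setT (P n).
  apply: (measurableT_comp (f := poisson n.+1%:R^-1)) => //; first exact: measurable_poisson.
  exact: measurable_funB.
pose q n s := P n s * rho s.
have q0 n s : 0 <= q n s by apply: mulr_ge0 => //; exact: speed_ge0.
have mq n : measurable_fun setT (q n) by exact: measurable_funM.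
have qle n : (\int[mu]_s (q n s)%:E <= (2 * pi)%:E)%E by exact: phase_kernel_le.
have iq n : mu.-integrable setT (EFin \o q n).
  apply/integrableP; split; first by apply/measurable_EFinP; exact: mq.
  under eq_integral do rewrite gee0_abs ?lee_fin//.
  by rewrite (le_lt_trans (qle n)) ?ltry.
pose T n := \int[mu]_s q n s.
have Tle n : T n <= 2 * pi.
  rewrite -lee_fin /T /Rintegral fineK ?qle//.
  by apply: integrable_fin_num => //; exact: iq.
apply/cvgrPdist_le => eps eps0.
pose eta := eps / (4 * pi).
have pi0 : 0 < pi :> R := pi_gt0 R.
have eta0 : 0 < eta by rewrite divr_gt0// mulr_gt0.
move/cvgrPdist_le : ck => /(_ _ eta0) /nbhs_ballP[d1 /= d10 ck].
pose d := Num.min (d1 / 2) (r / 2).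
have d0 : 0 < d by rewrite lt_min !divr_gt0.
have dr : d < r by rewrite (@le_lt_trans _ _ (r / 2))// ?ge_min ?lexx ?orbT// ltr_pdivrMr//; lra.
have dd1 : d < d1 by rewrite (@le_lt_trans _ _ (d1 / 2))// ?ge_min ?lexx// ltr_pdivrMr//; lra.
pose J : set R := `[(r - d)%R, (r + d)%R]%classic.
have mJ : measurable J by exact: measurable_itv.
have ckJ s : J s -> `|kap s - kap r| <= eta.
  rewrite /J /= in_itv/= => /andP[s1 s2]; rewrite distrC; apply: ck.
  by rewrite /ball/= ltr_norml; apply/andP; split; lra.
pose m n := \int[mu]_(s in J) q n s.
have mcvg : m n @[n --> \oo] --> 2 * pi.
  apply: fine_cvg; exact: phase_kernel_cvg.
have mE n : m n = \int[mu]_s (\1_J s * q n s).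
  rewrite /m Rintegral_mkcond; apply: eq_Rintegral => s _.
  by rewrite patchE indicE; case: ifPn => _; rewrite ?mul1r ?mul0r.
have mI : measurable_fun setT (\1_J : R -> R) by exact: measurable_indic.
have iJq n : mu.-integrable setT (EFin \o (fun s => \1_J s * q n s)).
  apply: (@integrable_mul_bounded _ _ _ 1) => // s.
  by rewrite indicE; case: (_ \in _); rewrite ?normr1 ?normr0.
have mT n : m n <= T n.
  rewrite mE; apply: le_Rintegral => // s _.
  by rewrite ler_piMl// indicE lern1 leq_b1.
have key n : `|2 * pi * kap r - \int[mu]_s (P n s * (kap s * rho s))|
    <= 2 * pi * eta + 3 * M * (2 * pi - m n).
  have -> : \int[mu]_s (P n s * (kap s * rho s)) = \int[mu]_s (kap s * q n s).
    by apply: eq_Rintegral => s _; rewrite /q; ring.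
  have ikq : mu.-integrable setT (EFin \o (fun s => kap s * q n s)).
    exact: (@integrable_mul_bounded _ _ _ M).
  have irq : mu.-integrable setT (EFin \o (fun s => kap r * q n s)).
    exact: (integrableZl measurableT (kap r) (iq n)).
  have E1 : \int[mu]_s (kap s * q n s) - kap r * T n = \int[mu]_s ((kap s - kap r) * q n s).
    rewrite /T -RintegralZl// -RintegralB//.
    by apply: eq_Rintegral => s _; rewrite mulrBl.
  have i1 : mu.-integrable setT (EFin \o (fun s => (kap s - kap r) * q n s)).
    apply: (@integrable_mul_bounded _ _ _ (M + M)) => //.
      exact: measurable_funB.
    by move=> s; rewrite (le_trans (ler_normB _ _))// lerD.
  have i2 : mu.-integrable setT (EFin \o (fun s => (eta + 2 * M) * q n s)).
    exact: (integrableZl measurableT _ (iq n)).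
  have i3 : mu.-integrable setT (EFin \o (fun s => 2 * M * (\1_J s * q n s))).
    exact: (integrableZl measurableT _ (iJq n)).
  have E2 : `|\int[mu]_s ((kap s - kap r) * q n s)| <= (eta + 2 * M) * T n - 2 * M * m n.
    apply: (le_trans (le_normr_Rintegral _ i1)) => //.
    rewrite mE /T -!RintegralZl// -RintegralB//.
    apply: le_Rintegral => //.
    - exact: (integrable_abse i1).
    - exact: (integrableB measurableT i2 i3).
    - move=> s _; rewrite normrM (ger0_norm (q0 _ _)).
      have -> : (eta + 2 * M) * q n s - 2 * M * (\1_J s * q n s) =
        (eta + 2 * M - 2 * M * \1_J s) * q n s by ring.
      apply: ler_wpM2r; first exact: q0.
      rewrite indicE; case: (boolP (s \in J)) => [/set_mem /ckJ|_]; rewrite ?mulr1 ?mulr0 ?subr0.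
        by rewrite addrK.
      rewrite (le_trans (ler_normB _ _))// (le_trans (lerD (kM s) (kM r)))//.
      by move: (ltW eta0); lra.
  have := kM r; have := mT n; have := Tle n.
  have -> : 2 * pi * kap r - \int[mu]_s (kap s * q n s) =
     (2 * pi - T n) * kap r - (\int[mu]_s (kap s * q n s) - kap r * T n) by ring.
  rewrite E1 => h1 h2 h3.
  have h4 : `|(2 * pi - T n) * kap r| <= M * (2 * pi - T n).
    by rewrite normrM ger0_norm ?subr_ge0// mulrC ler_wpM2r// subr_ge0.
  apply: (le_trans (ler_normB _ _)); apply: (le_trans (lerD h4 E2)).
  have h5 := ler_wpM2l M0 h2.
  have h6 : (eta + 2 * M) * T n <= (eta + 2 * M) * (2 * pi).
    by rewrite ler_wpM2l// addr_ge0 ?(ltW eta0)// mulr_ge0.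
  lra.
have D0 : 0 < 2 * (3 * M + 1) by lra.
near=> n.
apply: (le_trans (key n)).
have h : `|2 * pi - m n| <= eps / (2 * (3 * M + 1)).
  near: n; move/cvgrPdist_le : mcvg; apply; exact: divr_gt0.
have h1 : 2 * pi - m n <= eps / (2 * (3 * M + 1)) by rewrite (le_trans _ h)// ler_norm.
have h2 : (2 * pi - m n) * (2 * (3 * M + 1)) <= eps by rewrite -ler_pdivlMr.
have h3 : 2 * pi * eta = eps / 2.
  rewrite /eta; move: (pi : R) pi0 => p p0; field.
  by rewrite (lt0r_neq0 p0).
have h4 : 0 <= 2 * pi - m n by rewrite subr_ge0 (le_trans (mT n)).
rewrite h3; lra.
Unshelve. all: by end_near. Qed.

(** Boundedness gives an integrable majorant for the outer integral of the
regularized identity, and continuity almost everywhere the pointwise limit. *)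
Lemma plancherel_ge_ae_continuous (kap : R -> R) (M : R) : measurable_fun setT kap ->
  (forall s, `|kap s| <= M) ->
  {ae mu, forall r, 0 < r -> {for r, continuous kap}} ->
  mu.-integrable setT (EFin \o (fun r => kap r * rho r)) ->
  ((2 * pi)%:E * \int[mu]_r (kap r ^+ 2 * rho r)%:E <=
   \int[mu]_t (ctrans Phi (fun r => kap r * rho r) t ^+ 2 + strans Phi (fun r => kap r * rho r) t ^+ 2)%:E)%E.
Proof.
move=> mkap kM ck ik.
have M0 : 0 <= M by exact: le_trans (kM 0).
pose k r := kap r * rho r.
have mk : measurable_fun setT k by exact: measurable_funM.
have e0 (n : nat) : 0 < n.+1%:R^-1 :> R by rewrite invr_gt0.
pose U (n : nat) r := \int[mu]_s (poisson n.+1%:R^-1 (Phi r - Phi s) * k s).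
have mU n : measurable_fun setT (U n).
  apply: (@measurable_Rintegral_param _ _ _ _ _ mu (fun p : R * R => poisson n.+1%:R^-1 (Phi p.1 - Phi p.2) * k p.2)).
  apply: measurable_funM; first exact: measurable_kernel.
  exact: measurableT_comp.
have Ule n r : 0 < r -> `|U n r| <= 2 * pi * M.
  move=> r0; rewrite -lee_fin.
  have mP : measurable_fun setT (fun s => poisson n.+1%:R^-1 (Phi r - Phi s)).
    apply: (measurableT_comp (f := poisson n.+1%:R^-1)) => //; first exact: measurable_poisson.
    exact: measurable_funB.
  have mPk := measurable_funM mP mk.
  apply: (@le_trans _ _ (\int[mu]_s `|poisson n.+1%:R^-1 (Phi r - Phi s) * k s|%:E)%E).
    by apply: abs_Rintegral_le; exact: mPk.
  have mPr : measurable_fun setT (fun s => (poisson n.+1%:R^-1 (Phi r - Phi s) * rho s)%:E).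
    by apply/measurable_EFinP; exact: measurable_funM.
  have Pr0 s : (0 <= (poisson n.+1%:R^-1 (Phi r - Phi s) * rho s)%:E)%E.
    by rewrite lee_fin; apply: mulr_ge0; [exact: poisson_ge0|exact: speed_ge0].
  have ME : (0 <= M%:E)%E by rewrite lee_fin.
  apply: (@le_trans _ _ (\int[mu]_s (M%:E * (poisson n.+1%:R^-1 (Phi r - Phi s) * rho s)%:E))%E).
    apply: ge0_le_integral => //.
    - by apply/measurable_EFinP; apply: measurableT_comp => //; exact: mPk.
    - exact: measurable_funeM.
    - move=> s _; rewrite -EFinM lee_fin /k.
      have := poisson_ge0 (Phi r - Phi s) (e0 n); move: (poisson _ _) => p p0.
      rewrite 2!normrM (ger0_norm p0) (ger0_norm (speed_ge0 _ _)) mulrCA.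
      by apply: ler_wpM2r; [apply: mulr_ge0 => //; exact: speed_ge0|exact: kM].
  rewrite (@ge0_integralZl _ _ R mu setT measurableT _ mPr _ (fun s _ => Pr0 s) ME).
  rewrite muleC EFinM; apply: lee_wpmul2r => //.
  exact: phase_kernel_le.
have kU n r : `|k r * U n r| <= 2 * pi * M * `|k r|.
  rewrite normrM mulrC; have [r0|r0] := ltP 0 r.
    by apply: ler_wpM2r => //; exact: Ule.
  by rewrite /k speed0// !mulr0 normr0 !mulr0.
have ibk : mu.-integrable setT (fun r => (2 * pi * M * `|k r|)%:E).
  exact: (integrableZl measurableT (2 * pi * M) (integrable_abse ik)).
have piM0 : 0 <= 2 * pi * M by rewrite !mulr_ge0// pi_ge0.
have mkU n : measurable_fun setT (fun r => (k r * U n r)%:E).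
  by apply/measurable_EFinP; exact: measurable_funM.
pose Q t := ctrans Phi k t ^+ 2 + strans Phi k t ^+ 2.
have mQ : measurable_fun setT Q.
  by apply: measurable_funD; apply: measurable_funX; [exact: measurable_ctrans|exact: measurable_strans].
have Q0 t : 0 <= Q t by rewrite addr_ge0// sqr_ge0.
have Nle n : (\int[mu]_r (k r * U n r)%:E <= \int[mu]_t (Q t)%:E)%E.
  have iK : mu.-integrable setT (EFin \o (fun r => k r * U n r)).
    apply: (le_integrable _ _ _ ibk) => //; first exact: mkU.
    by move=> r _; rewrite /= lee_fin (le_trans (kU n r))// ler_norm.
  have -> : (\int[mu]_r (k r * U n r)%:E = (\int[mu]_r (k r * U n r))%:E)%E.
    by rewrite /Rintegral fineK//; exact: integrable_fin_num.
  rewrite -regularized_identity// /Rintegral fineK; last first.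
    by apply: integrable_fin_num => //; exact: integrable_regularized.
  apply: ge0_le_integral => //.
  - by move=> t _; rewrite lee_fin; apply: mulr_ge0; [exact: expR_ge0|exact: Q0].
  - by apply/measurable_EFinP; apply: measurable_funM => //; exact: measurable_exp_abs.
  - by apply/measurable_EFinP; exact: mQ.
  - move=> t _; rewrite lee_fin; apply: ler_piMl; first exact: Q0.
    by rewrite -[leRHS]expR0 ler_expR mulNr oppr_le0 mulr_ge0.
have := @dominated_convergence _ (measurableTypeR R) R mu setT measurableT (fun n r => (k r * U n r)%:E)
  (fun r => (k r * (2 * pi * kap r))%:E) (fun r => (2 * pi * M * `|k r|)%:E).
case.
- exact: mkU.
- by apply/measurable_EFinP; apply: measurable_funM => //; exact: measurable_funM.
- case: ck => N [mN N0 ckN]; exists N; split => // r /= nr; apply: ckN => /= cr; apply: nr => _.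
  have [r0|r0] := ltP 0 r; last first.
    have k0 : k r = 0 by rewrite /k speed0// mulr0.
    rewrite k0 mul0r (_ : (fun x => _) = cst 0%E); first exact: cvg_cst.
    by apply/funext => x; rewrite mul0r.
  apply: cvg_EFin; first by apply: nearW.
  rewrite /comp /=; apply: cvgM; first exact: cvg_cst.
  exact: (phase_kernel_pointwise_cvg mkap kM r0 (cr r0)).
- exact: ibk.
- by apply: aeW => r n _; rewrite lee_fin.
move=> _ _ h.
have -> : ((2 * pi)%:E * \int[mu]_r (kap r ^+ 2 * rho r)%:E = \int[mu]_r (k r * (2 * pi * kap r))%:E)%E.
  have mkr : measurable_fun setT (fun r => (kap r ^+ 2 * rho r)%:E).
    by apply/measurable_EFinP; apply: measurable_funM => //; exact: measurable_funX.
  have kr0 r : (0 <= (kap r ^+ 2 * rho r)%:E)%E.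
    by rewrite lee_fin; apply: mulr_ge0; [exact: sqr_ge0|exact: speed_ge0].
  have pi20 : (0 <= (2 * pi)%:E :> \bar R)%E by rewrite lee_fin mulr_ge0// pi_ge0.
  rewrite -(@ge0_integralZl _ _ R mu setT measurableT _ mkr _ (fun r _ => kr0 r) pi20).
  by apply: eq_integral => r _; rewrite -EFinM /k; congr (_%:E); ring.
rewrite -(cvg_lim _ h)//; apply: lime_le.
  by apply/cvg_ex; eexists; exact: h.
by apply: nearW => n; exact: Nle.
Qed.

Lemma speed_bounded (a b : R) : 0 < a -> a <= b ->
  exists L, forall r, a <= r <= b -> rho r <= L.
Proof.
move=> a0 ab.
have [c _ hc] : exists2 c, c \in `[a, b]%R & forall t, t \in `[a, b]%R -> `|derive1 phi t| <= `|derive1 phi c|.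
  apply: EVT_max => //.
  apply: continuous_in_subspaceT => s; rewrite inE/= in_itv/= => /andP[as_ _].
  apply: (continuous_comp (f := derive1 phi)); last exact: norm_continuous.
  by apply: dphi_continuous; [case: hphi|exact: lt_le_trans as_].
exists `|derive1 phi c| => r /andP[ar rb].
by rewrite speedE; [apply: hc; rewrite in_itv/= ar rb|exact: lt_le_trans ar].
Qed.

(** Truncate kap to a compact set of frequencies and to bounded values,
approximate the result in L^1 by a continuous function, and clip that function to
the same bound. On the compact set rho is bounded, and an L^1 error between
functions bounded by n controls the L^2 error. Only the two end points of the
compact set can be discontinuities. *)
Lemma ae_continuous_approx (kap : R -> R) (eta : R) : measurable_fun setT kap ->
  (\int[mu]_r (kap r ^+ 2 * rho r)%:E < +oo)%E -> 0 < eta ->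
  exists kap' : R -> R, exists M : R,
    [/\ measurable_fun setT kap', forall s, `|kap' s| <= M,
        {ae mu, forall r, 0 < r -> {for r, continuous kap'}},
        mu.-integrable setT (EFin \o (fun r => kap' r * rho r)) &
        (\int[mu]_r ((kap r - kap' r) ^+ 2 * rho r)%:E <= eta%:E)%E].
Proof.
move=> mkap fin eta0.
have mkr : measurable_fun setT (fun r => kap r ^+ 2 * rho r).
  by apply: measurable_funM => //; exact: measurable_funX.
have kr0 r : 0 <= kap r ^+ 2 * rho r by apply: mulr_ge0; [exact: sqr_ge0|exact: speed_ge0].
have ikr : mu.-integrable setT (EFin \o (fun r => kap r ^+ 2 * rho r)).
  apply/integrableP; split; first exact/measurable_EFinP.
  by under eq_integral do rewrite gee0_abs ?lee_fin//.
pose A (n : nat) : set R := [set r | n.+1%:R^-1 <= r <= n.+1%:R] `&` [set r | `|kap r| <= n%:R].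
have mA n : measurable (A n).
  apply: measurableI.
    rewrite (_ : [set r | _] = `[n.+1%:R^-1, n.+1%:R]%classic); first exact: measurable_itv.
    by apply/seteqP; split => r; rewrite /= in_itv.
  rewrite -[X in measurable X]setTI.
  apply: (measurable_fun_le measurableT); last exact: measurable_cst.
  exact: measurableT_comp.
pose k0 n r := kap r * \1_(A n) r.
have mI n : measurable_fun setT (\1_(A n) : R -> R) by exact: measurable_indic.
have mk0 n : measurable_fun setT (k0 n) by exact: measurable_funM.
have kk0 n r : (kap r - k0 n r) ^+ 2 * rho r = (1 - \1_(A n) r) * (kap r ^+ 2 * rho r).
  rewrite /k0 indicE; case: (_ \in _) => /=; ring.
have [n hn] : exists n, (\int[mu]_r ((kap r - k0 n r) ^+ 2 * rho r)%:E <= (eta / 4)%:E)%E.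
  have := @dominated_convergence _ (measurableTypeR R) R mu setT measurableT
    (fun n r => ((kap r - k0 n r) ^+ 2 * rho r)%:E) (fun=> 0%E) (fun r => (kap r ^+ 2 * rho r)%:E).
  case.
  - move=> n; apply/measurable_EFinP; apply: measurable_funM => //.
    exact: (measurable_funX 2 (measurable_funB mkap (mk0 n))).
  - exact: measurable_cst.
  - apply: aeW => r _.
    apply: cvg_near_cst; near=> n; rewrite kk0.
    have [r0|r0] := ltP 0 r; last by rewrite speed0// !mulr0.
    rewrite indicE mem_set ?subrr ?mul0r//; split => /=.
      apply/andP; split.
        rewrite -[leRHS]invrK lef_pV2 ?posrE ?invr_gt0//.
        have : r^-1 <= n%:R by near: n; exact: nbhs_infty_ger.
        by move=> /le_trans; apply; rewrite ler_nat.
      have : r <= n%:R by near: n; exact: nbhs_infty_ger.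
      by move=> /le_trans; apply; rewrite ler_nat.
    by near: n; exact: nbhs_infty_ger.
  - exact: ikr.
  - apply: aeW => r n _; rewrite kk0 lee_fin ger0_norm; last first.
      by apply: mulr_ge0 => //; rewrite subr_ge0 indicE lern1 leq_b1.
    by apply: ler_piMl => //; rewrite lerBlDr lerDl indicE ler0n.
  move=> _ _; rewrite integral0 => /fine_cvgP[hf /cvgrPdist_le].
  have e4 : 0 < eta / 4 by rewrite divr_gt0.
  move=> /(_ _ e4) h.
  have [m _ hm] := h; have [m' _ hm'] := hf.
  pose n := maxn m m'; exists n.
  have h1 := hm' n (leq_maxr _ _); have h2 := hm n (leq_maxl _ _).
  rewrite -[leLHS](fineK h1) lee_fin (le_trans _ h2)// sub0r normrN; exact: ler_norm.
have n10 : 0 < n.+1%:R^-1 :> R by rewrite invr_gt0.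
have n11 : n.+1%:R^-1 <= n.+1%:R :> R.
  by rewrite (@le_trans _ _ 1)// ?ler1n// invf_le1// ler1n.
have [L hL] := speed_bounded n10 n11.
pose E : set R := `[n.+1%:R^-1, n.+1%:R]%classic.
have mE : measurable E by exact: measurable_itv.
have EP r : E r = (n.+1%:R^-1 <= r <= n.+1%:R) by rewrite /E /= in_itv.
have Efin : (mu E < +oo)%E by rewrite /E lebesgue_measure_itv/= ; case: ifPn => _; rewrite ?ltry// -EFinB ltry.
have n0 : 0 <= n%:R :> R by [].
have k0n r : `|k0 n r| <= n%:R.
  rewrite /k0 indicE; case: (boolP (r \in A n)) => [/set_mem[_]|_]; rewrite ?mulr1 ?mulr0 ?normr0//.
have ik0 : mu.-integrable E (EFin \o k0 n).
  apply: (@measurable_bounded_integrable _ _ _ mu) => //.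
    by apply: measurable_funTS; exact: mk0.
  exists n%:R; split => // M nM r _ /=; exact: (le_trans (k0n r) (ltW nM)).
have L0 : 0 <= L by apply: (le_trans (speed_ge0 phi n.+1%:R^-1)); apply: hL; rewrite lexx.
have [g_ [gc ig gcvg]] := approximation_continuous_integrable mE Efin ik0.
pose C := 2 * n%:R * L + 1.
have C0 : 0 < C by rewrite ltr_wpDl// !mulr_ge0.
have eC : 0 < eta / (4 * C) by rewrite divr_gt0// mulr_gt0.
have [m hm] : exists m, (\int[mu]_(z in E) `|(k0 n z - g_ m z)%:E| <= (eta / (4 * C))%:E)%E.
  move: gcvg => /fine_cvgP[hf /cvgrPdist_le /(_ _ eC) h].
  have [m _ hm] := h; have [m' _ hm'] := hf.
  pose l := maxn m m'; exists l.
  have h1 := hm' l (leq_maxr _ _); have h2 := hm l (leq_maxl _ _).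
  rewrite -[leLHS](fineK h1) lee_fin (le_trans _ h2)// sub0r normrN; exact: ler_norm.
(* Nearest-point projection onto [-n, n]: it does not increase distances to
   values in that interval. *)
pose clip y : R := (`|y + n%:R| - `|y - n%:R|) / 2.
have cclip : continuous clip.
  have cl c : continuous (fun y : R => `|y + c|).
    by move=> y; apply: cvg_norm; apply: cvgD; [exact: cvg_id|exact: cvg_cst].
  by move=> y; apply: cvgM; [apply: cvgB; exact: cl|exact: cvg_cst].
have clipn y : `|clip y| <= n%:R.
  rewrite /clip ler_norml; case: (ger0P (y + n%:R)); case: (ger0P (y - n%:R)); move: n0; lra.
have clipL x y : `|x| <= n%:R -> `|x - clip y| <= `|x - y|.
  rewrite ler_norml => /andP[x1 x2]; rewrite /clip ler_norml.
  by case: (ger0P (y + n%:R)); case: (ger0P (y - n%:R)); case: (ger0P (x - y)); lra.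
pose kap' r := \1_E r * clip (g_ m r).
have mclip : measurable_fun setT (fun r => clip (g_ m r)).
  apply: continuous_measurable_fun => r; apply: continuous_comp; [exact: gc|exact: cclip].
have mIE : measurable_fun setT (\1_E : R -> R) by exact: measurable_indic.
have mkap' : measurable_fun setT kap' by exact: measurable_funM.
have kap'n r : `|kap' r| <= n%:R.
  rewrite /kap' indicE; case: (r \in E); rewrite ?mul1r ?mul0r ?normr0//.
exists kap', n%:R; split => //.
- exists [set n.+1%:R^-1; n.+1%:R]; split.
  + apply: measurableU; exact: measurable_set1.
  + by apply: null_set_setU; [exact: measurable_set1|exact: measurable_set1|exact: lebesgue_measure_set1|exact: lebesgue_measure_set1].
  + move=> r /= h; apply: contrapT => /not_orP[r1 r2]; apply: h => r0.
    have near_cvg (f : R -> R) : {for r, continuous f} ->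
        (\forall x \near r, f x = kap' x) -> {for r, continuous kap'}.
      move=> cf fk; rewrite /prop_for /continuous_at -(nbhs_singleton fk).
      by apply: cvg_trans cf; exact: near_eq_cvg.
    have [ra|ra|] := ltgtP r n.+1%:R^-1.
    + apply: (near_cvg (cst 0)); first exact: cvg_cst.
      near=> x; rewrite /kap' indicE memNset ?mul0r// EP.
      have -> : (n.+1%:R^-1 <= x) = false; last by [].
      by apply/negbTE; rewrite -ltNge; near: x; exact: lt_nbhsl.
    + have [rb|rb|] := ltgtP r n.+1%:R.
      * apply: (near_cvg (fun x => clip (g_ m x))).
          by apply: continuous_comp; [exact: gc|exact: cclip].
        near=> x; rewrite /kap' indicE mem_set ?mul1r// EP; apply/andP; split; apply: ltW.
          by near: x; exact: lt_nbhsr.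
        by near: x; exact: lt_nbhsl.
      * apply: (near_cvg (cst 0)); first exact: cvg_cst.
        near=> x; rewrite /kap' indicE memNset ?mul0r// EP.
        have -> : (x <= n.+1%:R) = false; last by rewrite andbF.
        by apply/negbTE; rewrite -ltNge; near: x; exact: lt_nbhsr.
      * by move=> /r2.
    + by move=> /r1.
- apply: (@le_integrable _ _ R mu setT measurableT _ (fun r => (n%:R * L * \1_E r)%:E)).
  + by apply/measurable_EFinP; exact: measurable_funM.
  + move=> r _; rewrite /= lee_fin /kap' indicE.
    case: (boolP (r \in E)) => [/set_mem|_]; last by rewrite !mul0r normr0 mulr0 normr0.
    rewrite EP => rE; rewrite mul1r mulr1 normrM [leRHS]ger0_norm ?mulr_ge0//.
    rewrite [`|rho r|](ger0_norm (speed_ge0 _ _)).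
    by apply: ler_pM => //; [exact: speed_ge0|exact: hL].
  + exact: (integrableZl measurableT (n%:R * L) (integrable_indic_itv _ _ true false)).
- have step : (\int[mu]_r ((k0 n r - kap' r) ^+ 2 * rho r)%:E <= (eta / 4)%:E)%E.
    apply: (@le_trans _ _ (\int[mu]_r (2 * n%:R * L * (`|k0 n r - g_ m r| * \1_E r))%:E)%E).
      apply: ge0_le_integral => //.
      - by move=> r _; rewrite lee_fin; apply: mulr_ge0; [exact: sqr_ge0|exact: speed_ge0].
      - apply/measurable_EFinP; apply: measurable_funM => //.
        exact: (measurable_funX 2 (measurable_funB (mk0 n) mkap')).
      - apply/measurable_EFinP; apply: measurable_funM; first exact: measurable_cst.
        apply: measurable_funM => //; apply: measurableT_comp => //.
        apply: measurable_funB; first exact: mk0.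
        exact: continuous_measurable_fun.
      - move=> r _; rewrite lee_fin /kap' indicE.
        case: (boolP (r \in E)) => [/set_mem|rE]; last first.
          rewrite mul0r subr0 !mulr0 /k0 indicE memNset ?mulr0 ?expr0n ?mul0r// => -[/= h _].
          by move: rE; rewrite notin_setE EP.
        rewrite EP => rE; rewrite mul1r mulr1.
        have h1 := clipL (k0 n r) (g_ m r) (k0n r).
        have h2 : `|k0 n r - clip (g_ m r)| <= 2 * n%:R.
          rewrite (le_trans (ler_normB _ _))// mulr_natl mulr2n lerD//; exact: clipn.
        rewrite -real_normK ?num_real// expr2.
        rewrite [leRHS](_ : _ = 2 * n%:R * `|k0 n r - g_ m r| * L); last by ring.
        apply: ler_pM; [exact: mulr_ge0|exact: speed_ge0| |exact: hL].
        exact: ler_pM.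
    have -> : (\int[mu]_r (2 * n%:R * L * (`|k0 n r - g_ m r| * \1_E r))%:E =
      (2 * n%:R * L)%:E * \int[mu]_(z in E) `|(k0 n z - g_ m z)%:E|)%E.
      rewrite [in RHS]integral_mkcond -ge0_integralZl//.
      + apply: eq_integral => r _; rewrite patchE indicE EFinM; congr (_ * _)%E.
        by case: (_ \in _); rewrite ?mulr1 ?mulr0.
      + have mF : measurable_fun setT (fun r => `|(k0 n r - g_ m r)%:E|%E).
          apply: measurableT_comp => //; apply/measurable_EFinP.
          by apply: measurable_funB; [exact: mk0|exact: continuous_measurable_fun].
        exact: ((measurable_restrictT _ mE).1 (measurable_funTS mF)).
      + by move=> r _; rewrite patchE; case: ifP.
      + by rewrite lee_fin !mulr_ge0.
    apply: (@le_trans _ _ ((2 * n%:R * L)%:E * (eta / (4 * C))%:E)%E).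
      by apply: lee_wpmul2l => //; rewrite lee_fin !mulr_ge0.
    rewrite -EFinM lee_fin (_ : 2 * n%:R * L = C - 1); last by rewrite /C addrK.
    rewrite (_ : (C - 1) * (eta / (4 * C)) = eta / 4 - eta / (4 * C)).
      by rewrite gerBl ltW.
    by field; rewrite (lt0r_neq0 C0).
  have := @ge0_le_integral_comb _ (measurableTypeR R) R mu (fun r => (kap r - k0 n r) ^+ 2 * rho r)
    (fun r => (k0 n r - kap' r) ^+ 2 * rho r) (fun r => (kap r - kap' r) ^+ 2 * rho r) 2 2.
  have m2 (f g : R -> R) : measurable_fun setT f -> measurable_fun setT g ->
     measurable_fun setT (fun r => (f r - g r) ^+ 2 * rho r).
    by move=> mf mg; apply: measurable_funM => //; apply: measurable_funX; exact: measurable_funB.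
  have p2 (f g : R -> R) r : 0 <= (f r - g r) ^+ 2 * rho r.
    by apply: mulr_ge0; [exact: sqr_ge0|exact: speed_ge0].
  move=> /(_ (m2 _ _ mkap (mk0 n)) (m2 _ _ (mk0 n) mkap') (m2 _ _ mkap mkap')
     (p2 _ _) (p2 _ _) (p2 _ _)) H.
  apply: (le_trans (H _ _ _)) => //.
    move=> r; rewrite [leRHS](_ : _ = (2 * (kap r - k0 n r) ^+ 2 + 2 * (k0 n r - kap' r) ^+ 2) * rho r); last by ring.
    apply: ler_wpM2r; first exact: speed_ge0.
    have := @sqrD_le R 1 (kap r - k0 n r) (k0 n r - kap' r) ltr01.
    by rewrite invr1 addrA subrK.
  have -> : eta%:E = (2%:E * (eta / 4)%:E + 2%:E * (eta / 4)%:E :> \bar R)%E.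
    by rewrite -!EFinM -EFinD; congr (_%:E); field.
  by apply: leeD; apply: lee_wpmul2l.
Unshelve. all: by end_near. Qed.

Lemma ctransB (f g : R -> R) t : mu.-integrable setT (EFin \o f) ->
  mu.-integrable setT (EFin \o g) ->
  ctrans Phi (fun r => f r - g r) t = ctrans Phi f t - ctrans Phi g t.
Proof.
have mt : measurable_fun setT (fun s => t * Phi s) by exact: measurable_funM.
move=> jf jg; rewrite /ctrans -RintegralB//; try exact: (integrable_cosM mt).
by apply: eq_Rintegral => s _; rewrite mulrBr.
Qed.

Lemma stransB (f g : R -> R) t : mu.-integrable setT (EFin \o f) ->
  mu.-integrable setT (EFin \o g) ->
  strans Phi (fun r => f r - g r) t = strans Phi f t - strans Phi g t.
Proof.
have mt : measurable_fun setT (fun s => t * Phi s) by exact: measurable_funM.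
move=> jf jg; rewrite /strans -RintegralB//; try exact: (integrable_sinM mt).
by apply: eq_Rintegral => s _; rewrite mulrBr.
Qed.

(** Approximate kap by kap' as above. The upper bound, applied to kap - kap', shows
that the transforms of kap and kap' are close in L^2 as well, so the equality for
kap' passes to kap. *)
Theorem plancherel_phase (kap : R -> R) : measurable_fun setT kap ->
  mu.-integrable setT (EFin \o (fun r => kap r * rho r)) ->
  (\int[mu]_r (kap r ^+ 2 * rho r)%:E < +oo)%E ->
  (\int[mu]_t (ctrans Phi (fun r => kap r * rho r) t ^+ 2 +
               strans Phi (fun r => kap r * rho r) t ^+ 2)%:E
   = (2 * pi)%:E * \int[mu]_r (kap r ^+ 2 * rho r)%:E)%E.
Proof.
move=> mkap ik fin.
pose N (h : R -> R) : \bar R := (\int[mu]_t (ctrans Phi (fun r => h r * rho r) t ^+ 2 +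
               strans Phi (fun r => h r * rho r) t ^+ 2)%:E)%E.
pose E (h : R -> R) : \bar R := (\int[mu]_r (h r ^+ 2 * rho r)%:E)%E.
have E0 (h : R -> R) : (0 <= E h)%E.
  by apply: integral_ge0 => r _; rewrite lee_fin; apply: mulr_ge0; [exact: sqr_ge0|exact: speed_ge0].
have N0 (h : R -> R) : (0 <= N h)%E by apply: integral_ge0 => r _; rewrite lee_fin addr_ge0 ?sqr_ge0.
rewrite -/(N kap) -/(E kap).
have NE : (N kap <= (2 * pi)%:E * E kap)%E by exact: plancherel_le.
apply/eqP; rewrite eq_le NE/=.
have Efin : E kap \is a fin_num by rewrite ge0_fin_numE.
have pi2 : 0 <= 2 * pi :> R by rewrite mulr_ge0// pi_ge0.
have Nfin : N kap \is a fin_num.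
  by rewrite ge0_fin_numE// (le_lt_trans NE)// -(fineK Efin) -EFinM ltry.
rewrite -(fineK Efin) -(fineK Nfin) -EFinM lee_fin.
apply: le_two_step_approx; first by rewrite fine_ge0.
move=> d e d0 e0.
have pi0 : 0 < 2 * pi :> R by rewrite mulr_gt0// pi_gt0.
have [kap' [M [mkap' kM ck ik' he]]] := ae_continuous_approx mkap fin (divr_gt0 e0 pi0).
have mrk (h : R -> R) : measurable_fun setT h -> measurable_fun setT (fun r => h r ^+ 2 * rho r).
  by move=> mh; apply: measurable_funM => //; exact: measurable_funX.
have rk0 (h : R -> R) r : 0 <= h r ^+ 2 * rho r by apply: mulr_ge0; [exact: sqr_ge0|exact: speed_ge0].
have i0 : 0 < d^-1 by rewrite invr_gt0.
pose dk r := kap r - kap' r.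
have mdiff : measurable_fun setT dk by exact: measurable_funB.
have h1 : (E kap <= (1 + d)%:E * E kap' + (1 + d^-1)%:E * (e / (2 * pi))%:E)%E.
  apply: (@le_trans _ _ ((1 + d)%:E * E kap' + (1 + d^-1)%:E * E dk)%E); last first.
    by apply: leeD2l; apply: lee_wpmul2l => //; rewrite lee_fin; lra.
  have d1 : 0 <= 1 + d by lra.
  have d2 : 0 <= 1 + d^-1 by lra.
  apply: (@ge0_le_integral_comb _ (measurableTypeR R) R mu _ _ _ _ _ (mrk _ mkap') (mrk _ mdiff) (mrk _ mkap) (rk0 _) (rk0 _) (rk0 _) d1 d2).
  move=> r; rewrite [leRHS](_ : _ = ((1 + d) * kap' r ^+ 2 + (1 + d^-1) * (kap r - kap' r) ^+ 2) * rho r); last by rewrite /dk; ring.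
    apply: ler_wpM2r; first exact: speed_ge0.
    have := sqrD_le (kap' r) (kap r - kap' r) d0.
    by rewrite addrC subrK.
have h2 : ((2 * pi)%:E * E kap' <= N kap')%E by exact: plancherel_ge_ae_continuous kM ck ik'.
have idiff : mu.-integrable setT (EFin \o (fun r => dk r * rho r)).
  have := integrableB measurableT ik ik'; apply: eq_integrable => // r _.
  by rewrite /= -EFinB /dk mulrBl.
have h3 : (N dk <= e%:E)%E.
  apply: (@le_trans _ _ ((2 * pi)%:E * E dk)%E).
    exact: plancherel_le.
  apply: (@le_trans _ _ ((2 * pi)%:E * (e / (2 * pi))%:E)%E).
    by apply: lee_wpmul2l => //; rewrite lee_fin.
  by rewrite -EFinM mulrCA divff ?mulr1// lt0r_neq0.
have mN (h : R -> R) : mu.-integrable setT (EFin \o (fun r => h r * rho r)) ->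
    measurable_fun setT (fun t => ctrans Phi (fun r => h r * rho r) t ^+ 2 +
               strans Phi (fun r => h r * rho r) t ^+ 2).
  by move=> ih; apply: measurable_funD; apply: measurable_funX; [exact: measurable_ctrans|exact: measurable_strans].
have h4 : (N kap' <= (1 + d)%:E * N kap + (1 + d^-1)%:E * e%:E)%E.
  apply: (@le_trans _ _ ((1 + d)%:E * N kap + (1 + d^-1)%:E * N dk)%E); last first.
    by apply: leeD2l; apply: lee_wpmul2l => //; rewrite lee_fin; lra.
  have Q0 (h : R -> R) t : 0 <= ctrans Phi (fun r => h r * rho r) t ^+ 2 + strans Phi (fun r => h r * rho r) t ^+ 2.
    by rewrite addr_ge0 ?sqr_ge0.
  have d1 : 0 <= 1 + d by lra.
  have d2 : 0 <= 1 + d^-1 by lra.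
  apply: (@ge0_le_integral_comb _ (measurableTypeR R) R mu _ _ _ _ _ (mN _ ik) (mN _ idiff) (mN _ ik') (Q0 _) (Q0 _) (Q0 _) d1 d2) => t.
    have kE : (fun r => kap' r * rho r) = (fun r => kap r * rho r - dk r * rho r).
      by apply/funext => r; rewrite /dk; ring.
    rewrite kE ctransB// stransB//.
    have := sqrD_le (ctrans Phi (fun r => kap r * rho r) t) (- ctrans Phi (fun r => dk r * rho r) t) d0.
    have := sqrD_le (strans Phi (fun r => kap r * rho r) t) (- strans Phi (fun r => dk r * rho r) t) d0.
    rewrite !sqrrN; lra.
have h5 : ((2 * pi)%:E * E kap <= (1 + d)%:E * N kap' + (1 + d^-1)%:E * e%:E)%E.
  apply: (@le_trans _ _ ((2 * pi)%:E * ((1 + d)%:E * E kap' + (1 + d^-1)%:E * (e / (2 * pi))%:E))%E).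
    by apply: lee_wpmul2l.
  have d1 : 0 <= 1 + d by lra.
  have d2 : 0 <= 1 + d^-1 by lra.
  rewrite ge0_muleDr; last 2 first.
  - by apply: mule_ge0.
  - by apply: mule_ge0 => //; rewrite lee_fin divr_ge0 ?(ltW e0).
  apply: leeD.
    by rewrite muleCA; apply: lee_wpmul2l.
  by rewrite -!EFinM lee_fin mulrCA [_ * (e / _)]mulrCA divff ?mulr1// lt0r_neq0.
have h6 : ((2 * pi)%:E * E kap <= (1 + d)%:E * ((1 + d)%:E * N kap + (1 + d^-1)%:E * e%:E) + (1 + d^-1)%:E * e%:E)%E.
  apply: (le_trans h5); apply: leeD; last exact: lexx.
  by apply: lee_wpmul2l; [rewrite lee_fin addr_ge0// ltW|exact: h4].
move: h6; clear - Efin Nfin.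
by case: (E kap) Efin => // x _; case: (N kap) Nfin => // y _; rewrite -!(EFinM, EFinD) lee_fin.
Qed.
End plancherel.

(** * Folding the line onto the positive half-line *)

Section reflection.
Context {R : realType}.
Local Notation mu := (@lebesgue_measure R).
Local Notation D := (`]0%R, +oo[%classic : set R).

Lemma ge0_integral_reflect (f : R -> \bar R) : measurable_fun setT f ->
  (forall x, 0 <= f x)%E -> (\int[mu]_x f (- x)%R = \int[mu]_x f x)%E.
Proof.
move=> mf f0.
have mN : measurable_fun setT (-%R : measurableTypeR R -> measurableTypeR R).
  exact: oppr_measurable.
have := @ge0_integral_pushforward _ _ (measurableTypeR R) (measurableTypeR R) R -%R
  mN mu setT f measurableT mf (fun x _ => f0 x).
rewrite preimage_setT => <-.
by apply: eq_measure_integral => A mA _; exact: lebesgue_measureN.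
Qed.

Lemma integral_reflect (f : R -> R) : measurable_fun setT f ->
  (\int[mu]_x (f (- x)%R)%:E = \int[mu]_x (f x)%:E)%E.
Proof.
move=> mf.
have mE : measurable_fun setT (EFin \o f) by exact/measurable_EFinP.
rewrite integralE [in RHS]integralE; congr (_ - _)%E.
  transitivity (\int[mu]_x ((EFin \o f)^\+ (- x)%R))%E.
    by apply: eq_integral => x _; rewrite !funeposE.
  by apply: ge0_integral_reflect => //; exact: measurable_funepos.
transitivity (\int[mu]_x ((EFin \o f)^\- (- x)%R))%E.
  by apply: eq_integral => x _; rewrite !funenegE.
by apply: ge0_integral_reflect => //; exact: measurable_funeneg.
Qed.

Lemma Rintegral_reflect (f : R -> R) : measurable_fun setT f ->
  \int[mu]_x f (- x) = \int[mu]_x f x.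
Proof. by move=> mf; rewrite /Rintegral integral_reflect. Qed.

Lemma integrable_reflect (f : R -> R) : mu.-integrable setT (EFin \o f) ->
  mu.-integrable setT (EFin \o (fun x => f (- x))).
Proof.
move=> /integrableP[mf fin]; apply/integrableP; split.
  apply/measurable_EFinP; apply: measurableT_comp; last exact: oppr_measurable.
  exact/measurable_EFinP.
rewrite (_ : (\int[mu]_x _ = \int[mu]_x `|(EFin \o f) x|)%E)//.
rewrite -[RHS]ge0_integral_reflect//.
by apply: measurableT_comp.
Qed.

(** Functions on (0, oo) are represented on the whole line by their extension by
zero, so that all integrals are over one space. *)
Definition half (f : R -> R) (r : R) : R := \1_D r * f r.

Lemma halfE f r : 0 < r -> half f r = f r.
Proof. by move=> r0; rewrite /half indicE mem_set ?mul1r//= in_itv/= r0. Qed.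

Lemma half0 f r : r <= 0 -> half f r = 0.
Proof.
by move=> r0; rewrite /half indicE memNset ?mul0r//= in_itv/= andbT; apply/negP; rewrite -leNgt.
Qed.

Lemma measurable_half f : measurable_fun setT f -> measurable_fun setT (half f).
Proof. by move=> mf; apply: measurable_funM. Qed.

Lemma integrable_half f : mu.-integrable setT (EFin \o f) ->
  mu.-integrable setT (EFin \o half f).
Proof.
move=> jf; apply: (@integrable_mul_bounded _ _ _ 1) => //.
by move=> x; rewrite indicE; case: (_ \in _); rewrite ?normr1 ?normr0.
Qed.

(** The indicator of 0 accounts for the only point that folding misses. *)
Let split0 (f : R -> R) x : f x = half f x + half (fun y => f (- y)) (- x) + \1_[set 0] x * f x.
Proof.
have [x0|x0|<-] := ltgtP 0 x.
- rewrite halfE// half0 ?oppr_le0 ?(ltW x0)// indicE memNset ?mul0r ?addr0//=.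
  by move=> x00; rewrite x00 ltxx in x0.
- rewrite half0 ?(ltW x0)// halfE ?oppr_gt0// opprK indicE memNset ?mul0r ?addr0 ?add0r//=.
  by move=> x00; rewrite x00 ltxx in x0.
- by rewrite !half0 ?oppr0// indicE mem_set// mul1r !add0r.
Qed.

Lemma Rintegral_fold f : mu.-integrable setT (EFin \o f) ->
  \int[mu]_x f x = \int[mu]_r half (fun r => f r + f (- r)) r.
Proof.
move=> jf.
have jr := integrable_half (integrable_reflect jf).
have jr2 := integrable_reflect jr.
have j0 : mu.-integrable setT (EFin \o (fun x => \1_[set 0] x * f x)).
  apply: (@integrable_mul_bounded _ _ _ 1) => //.
  by move=> x; rewrite indicE; case: (_ \in _); rewrite ?normr1 ?normr0.
under eq_Rintegral do rewrite split0.
have jh := integrable_half jf.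
rewrite RintegralD//; last exact: (integrableD measurableT jh jr2).
rewrite RintegralD//.
rewrite [X in _ + X](_ : _ = 0) ?addr0; last first.
  transitivity (\int[mu]_(x in [set (0:R)]) f x); last exact: Rintegral_set1.
  rewrite [RHS]Rintegral_mkcond.
  by apply: eq_Rintegral => x _; rewrite patchE indicE; case: (_ \in _); rewrite ?mul1r ?mul0r.
rewrite [X in _ + X](Rintegral_reflect (f := half (fun y => f (- y)))).
  rewrite -RintegralD//; apply: eq_Rintegral => r _.
  by rewrite /half mulrDr.
by case/integrableP : jr => /measurable_EFinP.
Qed.

Lemma ge0_integral_fold (f : R -> R) : measurable_fun setT f -> (forall x, 0 <= f x) ->
  (\int[mu]_x (f x)%:E = \int[mu]_r (half (fun r => f r + f (- r))%R r)%:E)%E.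
Proof.
move=> mf f0.
have mfN : measurable_fun setT (fun x : R => f (- x)).
  by apply: measurableT_comp => //; exact: oppr_measurable.
have h0 (g : R -> R) r : (forall x, 0 <= g x) -> (0 <= (half g r)%:E)%E.
  by move=> g0; rewrite lee_fin mulr_ge0// indicE ler0n.
have mh (g : R -> R) : measurable_fun setT g -> measurable_fun setT (fun r => (half g r)%:E).
  by move=> mg; apply/measurable_EFinP; exact: measurable_half.
transitivity (\int[mu]_x ((half f x)%:E + (half (fun y => f (- y)%R) (- x)%R)%:E))%E.
  apply: ae_eq_integral => //.
  - exact/measurable_EFinP.
  - apply: emeasurable_funD; first exact: mh.
    by apply: (measurableT_comp (mh _ mfN)); exact: oppr_measurable.
  - exists [set 0]; split; [exact: measurable_set1|exact: lebesgue_measure_set1|].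
    move=> x /= h; apply: contrapT => x0; apply: h => _.
    rewrite [LHS](_ : _ = (half f x + half (fun y => f (- y)) (- x) + \1_[set 0] x * f x)%:E); last by rewrite -split0.
    by rewrite indicE memNset// mul0r addr0 EFinD.
have mhN : measurable_fun setT (fun x : R => (half (fun y => f (- y)%R) (- x)%R)%:E).
  by apply: (measurableT_comp (mh _ mfN)); exact: oppr_measurable.
rewrite (@ge0_integralD _ _ R mu setT measurableT _ _ (fun r _ => h0 f r f0) (mh _ mf)
  (fun r _ => h0 _ (- r) (fun y => f0 (- y))) mhN).
rewrite [X in (_ + X)%E](ge0_integral_reflect (f := fun r => (half (fun y => f (- y)%R) r)%:E)).
- rewrite -(@ge0_integralD _ _ R mu setT measurableT _ _ (fun r _ => h0 f r f0) (mh _ mf)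
    (fun r _ => h0 _ r (fun y => f0 (- y))) (mh _ mfN)).
  by apply: eq_integral => r _; rewrite -EFinD /half mulrDr.
- exact: mh.
- by move=> r; apply: h0.
Qed.
End reflection.

Section complex_plancherel.
Context {R : realType}.
Local Notation mu := (@lebesgue_measure R).
Variable phi : R -> R.
Hypothesis hphi : dispersion_assumption phi.
Local Notation Phi := (phase phi).
Local Notation rho := (speed phi).

(** The convention 1/0 = 0 is that of the power function with exponent -1. *)
Lemma measurable_speedV : measurable_fun setT (fun r => (rho r)^-1).
Proof.
rewrite (_ : (fun r => (rho r)^-1) = (fun r => rho r `^ (-1))).
  apply: (@measurableT_comp _ _ _ _ _ _ (fun x : R => x `^ (-1)) _ rho); first exact: measurable_powR.
  exact: measurable_speed.
by apply/funext => r; rewrite powR_inv1// speed_ge0.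
Qed.

(** The substitution kap = a / rho, which recovers a = kap rho because a vanishes
with rho. *)
Lemma plancherel_quotient (a : R -> R) :
  mu.-integrable setT (EFin \o a) -> (forall r, rho r = 0 -> a r = 0) ->
  (\int[mu]_r (a r ^+ 2 / rho r)%:E < +oo)%E ->
  (\int[mu]_t (ctrans Phi a t ^+ 2 + strans Phi a t ^+ 2)%:E
   = (2 * pi)%:E * \int[mu]_r (a r ^+ 2 / rho r)%:E)%E.
Proof.
move=> ia a0 fin.
have ma : measurable_fun setT a by case/integrableP : ia => /measurable_EFinP.
have mrho : measurable_fun setT rho by exact: measurable_speed.
pose kap r := a r / rho r.
have mkap : measurable_fun setT kap.
  apply: measurable_funM => //.
  exact: measurable_speedV.
have kr : (fun r => kap r * rho r) = a.
  apply/funext => r; rewrite /kap; have [r0|r0] := eqVneq (rho r) 0.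
    by rewrite r0 mulr0 a0.
  by rewrite divfK.
have kr2 r : kap r ^+ 2 * rho r = a r ^+ 2 / rho r.
  rewrite /kap; have [->|r0] := eqVneq (rho r) 0; first by rewrite invr0 !mulr0.
  by field.
have := @plancherel_phase _ _ hphi kap mkap; rewrite kr.
under [X in (X < _)%E]eq_integral do rewrite kr2.
by under [X in _ = (_ * X)%E]eq_integral do rewrite kr2; apply.
Qed.

Lemma ctransN (a : R -> R) t : ctrans Phi a (- t) = ctrans Phi a t.
Proof. by apply: eq_Rintegral => s _; rewrite mulNr cosN. Qed.

Lemma stransN (a : R -> R) t : mu.-integrable setT (EFin \o a) ->
  strans Phi a (- t) = - strans Phi a t.
Proof.
move=> ia; rewrite /strans -[RHS]mulN1r -RintegralZl//; last first.
  by apply: integrable_sinM ia; apply: measurable_funM => //; exact: measurable_phase.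
by apply: eq_Rintegral => s _; rewrite mulNr sinN; ring.
Qed.

(** For the amplitude a + ib the cross terms are odd in t and cancel between t
and -t; the remaining terms are those of a and b separately. *)
Lemma plancherel_complex (a b : R -> R) :
  mu.-integrable setT (EFin \o a) -> mu.-integrable setT (EFin \o b) ->
  (forall r, rho r = 0 -> a r = 0) -> (forall r, rho r = 0 -> b r = 0) ->
  (\int[mu]_r (a r ^+ 2 / rho r)%:E < +oo)%E -> (\int[mu]_r (b r ^+ 2 / rho r)%:E < +oo)%E ->
  (\int[mu]_t ((ctrans Phi a t - strans Phi b t)%R ^+ 2 + (strans Phi a t + ctrans Phi b t)%R ^+ 2)%:E
   = (2 * pi)%:E * \int[mu]_r ((a r ^+ 2 + b r ^+ 2) / rho r)%:E)%E.
Proof.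
move=> ia ib a0 b0 fa fb.
have mPhi : measurable_fun setT Phi by exact: measurable_phase.
pose N t := (ctrans Phi a t - strans Phi b t) ^+ 2 + (strans Phi a t + ctrans Phi b t) ^+ 2.
have mca : measurable_fun setT (ctrans Phi a) by exact: measurable_ctrans.
have msa : measurable_fun setT (strans Phi a) by exact: measurable_strans.
have mcb : measurable_fun setT (ctrans Phi b) by exact: measurable_ctrans.
have msb : measurable_fun setT (strans Phi b) by exact: measurable_strans.
have mN : measurable_fun setT (fun t => (N t)%:E).
  apply/measurable_EFinP; apply: measurable_funD; apply: measurable_funX.
    exact: measurable_funB.
  exact: measurable_funD.
have N0 t : (0 <= (N t)%:E)%E by rewrite lee_fin addr_ge0 ?sqr_ge0.
pose A t := ctrans Phi a t ^+ 2 + strans Phi a t ^+ 2.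
pose B t := ctrans Phi b t ^+ 2 + strans Phi b t ^+ 2.
have mA : measurable_fun setT (fun t => (A t)%:E).
  by apply/measurable_EFinP; apply: measurable_funD; apply: measurable_funX.
have mB : measurable_fun setT (fun t => (B t)%:E).
  by apply/measurable_EFinP; apply: measurable_funD; apply: measurable_funX.
have A0 t : (0 <= (A t)%:E)%E by rewrite lee_fin addr_ge0 ?sqr_ge0.
have B0 t : (0 <= (B t)%:E)%E by rewrite lee_fin addr_ge0 ?sqr_ge0.
have mNN : measurable_fun setT (fun t : R => (N (- t))%:E).
  by apply: (measurableT_comp mN); exact: oppr_measurable.
have NN t : ((N t)%:E + (N (- t))%:E = 2%:E * ((A t)%:E + (B t)%:E))%E.
  rewrite -!EFinD -EFinM /N !ctransN !stransN// /A /B; congr (_%:E); ring.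
have h : (2%:E * \int[mu]_t (N t)%:E = 2%:E * (\int[mu]_t (A t)%:E + \int[mu]_t (B t)%:E))%E.
  rewrite -(@ge0_integralD _ _ R mu setT measurableT _ _ (fun r _ => A0 r) mA (fun r _ => B0 r) mB).
  have two0 : (0 <= 2%:E :> \bar R)%E by rewrite lee_fin.
  rewrite -(@ge0_integralZl _ _ R mu setT measurableT _ (emeasurable_funD mA mB) _ (fun r _ => adde_ge0 (A0 r) (B0 r)) two0).
  under [RHS]eq_integral do rewrite -NN.
  rewrite (@ge0_integralD _ _ R mu setT measurableT _ _ (fun r _ => N0 r) mN (fun r _ => N0 (- r)) mNN).
  rewrite [X in (_ = _ + X)%E](ge0_integral_reflect mN N0).
  by rewrite mule_natl mule2n.
have {h} : (\int[mu]_t (N t)%:E = \int[mu]_t (A t)%:E + \int[mu]_t (B t)%:E)%E.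
  move: h => /(congr1 (fun z => (2^-1)%:E * z)%E).
  have h2 : ((2^-1)%:E * 2%:E = 1%:E :> \bar R)%E by rewrite -EFinM mulVf.
  by rewrite !muleA h2 !mul1e.
rewrite /N /A /B => ->.
rewrite plancherel_quotient// plancherel_quotient//.
have ma : measurable_fun setT a by case/integrableP : ia => /measurable_EFinP.
have mb : measurable_fun setT b by case/integrableP : ib => /measurable_EFinP.
have q0 (c : R -> R) r : (0 <= (c r ^+ 2 / rho r)%:E)%E.
  by rewrite lee_fin; apply: mulr_ge0; [exact: sqr_ge0|rewrite invr_ge0; exact: speed_ge0].
have mq (c : R -> R) : measurable_fun setT c -> measurable_fun setT (fun r => (c r ^+ 2 / rho r)%:E).
  move=> mc; apply/measurable_EFinP; apply: measurable_funM; first exact: measurable_funX.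
  exact: measurable_speedV.
rewrite -ge0_muleDr; [|by apply: integral_ge0 => r _|by apply: integral_ge0 => r _].
rewrite -(@ge0_integralD _ _ R mu setT measurableT _ _ (fun r _ => q0 a r) (mq _ ma) (fun r _ => q0 b r) (mq _ mb)).
by congr (_ * _)%E; apply: eq_integral => r _; rewrite -EFinD mulrDl.
Qed.
End complex_plancherel.

(** * The spatial weight *)

Definition sqmod (R : realType) (z : R[i]) : R := complex.Re z ^+ 2 + complex.Im z ^+ 2.

Lemma sqmod_ge0 (R : realType) (z : R[i]) : 0 <= sqmod z.
Proof. by rewrite addr_ge0 ?sqr_ge0. Qed.

Section weight.
Context {R : realType}.
Local Notation mu := (@lebesgue_measure R).
Local Notation D := (`]0%R, +oo[%classic : set R).

(** The value at 0 is arbitrary and is corrected by hand. *)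
Lemma measurable_comp_norm (g : R -> R) : measurable_fun D g ->
  measurable_fun setT (fun xi : R => g `|xi|).
Proof.
move=> mg.
have mgD : measurable_fun setT (g \_ D) by apply/(measurable_restrictT _ _).1.
rewrite (_ : (fun xi => g `|xi|) =
  (fun xi => (g \_ D) `|xi| + (g 0 - (g \_ D) 0) * \1_[set 0] xi)); last first.
  apply/funext => xi; rewrite indicE; have [->|x0] := eqVneq xi 0.
    by rewrite mem_set// mulr1 normr0 addrC subrK.
  rewrite memNset ?mulr0 ?addr0; last by move=> /= xi0; rewrite xi0 eqxx in x0.
  by rewrite patchE mem_set//= in_itv/= normr_gt0 x0.
apply: measurable_funD; first exact: measurableT_comp.
apply: measurable_funM; first exact: measurable_cst.
exact: measurable_indic.
Qed.

Variables (w Fw : R -> R).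
Hypothesis hw : weight_assumption w.
Hypothesis hFw : Fw_assumption w Fw.

(** The modulus of the spatial factor of S; its square is w(|x|) away from 0. *)
Definition sqrt_w (x : R) : R := Num.sqrt (w `|x|).

Lemma sqrt_w2E x : x != 0 -> sqrt_w x ^+ 2 = w `|x|.
Proof. by move=> x0; rewrite sqr_sqrtr// ltW//; case: hw => + _; apply; rewrite normr_gt0. Qed.

Let iw : mu.-integrable setT (EFin \o (fun x => w `|x|)). Proof. by case: hw. Qed.
Let mw : measurable_fun setT (fun x : R => w `|x|).
Proof. by case/integrableP : iw => /measurable_EFinP. Qed.

Lemma measurable_sqrt_w : measurable_fun setT sqrt_w.
Proof.
apply: (@measurableT_comp _ _ _ _ _ _ (@Num.sqrt R)) => //.
by apply: continuous_measurable_fun; exact: sqrt_continuous.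
Qed.

Lemma weight_cos y : \int[mu]_x (w `|x| * cos (x * y)) = Fw (2^-1 * y ^+ 2).
Proof.
case: hFw => /(_ y) + _ _; rewrite real_normK ?num_real// /fourier /cintegral => /(congr1 (@complex.Re R)) /= <-.
by apply: eq_Rintegral => x _; rewrite cosN mul0r subr0.
Qed.

(** The imaginary part of the Fourier transform of w(|.|), which is real. *)
Lemma weight_sin y : \int[mu]_x (w `|x| * sin (x * y)) = 0.
Proof.
case: hFw => /(_ (- y)) + _ _; rewrite /fourier /cintegral => /(congr1 (@complex.Im R)) /= <-.
by apply: eq_Rintegral => x _; rewrite mulrN opprK mul0r addr0.
Qed.

(** The only place where the Fourier transform of the weight enters: averaging a
trigonometric polynomial of frequency 2r over x keeps the mean and the cosine
coefficient. *)
Lemma weight_integral (c0 c1 c2 r : R) : (forall x, 0 <= c0 + c1 * cos (x * (2 * r)) + c2 * sin (x * (2 * r))) ->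
  (\int[mu]_x (sqrt_w x ^+ 2 * (c0 + c1 * cos (x * (2 * r)) + c2 * sin (x * (2 * r))))%:E
  = (c0 * weightL1 w + c1 * Fw (2 * r ^+ 2))%:E)%E.
Proof.
move=> c_ge0.
have mc : measurable_fun setT (fun x : R => cos (x * (2 * r))).
  by apply: measurable_cosf; exact: measurable_funM.
have ms : measurable_fun setT (fun x : R => sin (x * (2 * r))).
  by apply: measurable_sinf; exact: measurable_funM.
have mA : measurable_fun setT (fun x : R => c0 + c1 * cos (x * (2 * r)) + c2 * sin (x * (2 * r))).
  by apply: measurable_funD; [apply: measurable_funD => //|]; exact: measurable_funM.
have j1 : mu.-integrable setT (EFin \o (fun x => w `|x| * cos (x * (2 * r)))).
  under eq_fun do rewrite mulrC.
  by apply: (@integrable_mul_bounded _ _ _ 1) => // x; exact: normr_cos_le1.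
have j2 : mu.-integrable setT (EFin \o (fun x => w `|x| * sin (x * (2 * r)))).
  under eq_fun do rewrite mulrC.
  by apply: (@integrable_mul_bounded _ _ _ 1) => // x; exact: normr_sin_le1.
have k0 := integrableZl measurableT c0 iw.
have k1 := integrableZl measurableT c1 j1.
have k2 := integrableZl measurableT c2 j2.
have k01 := integrableD measurableT k0 k1.
have k012 := integrableD measurableT k01 k2.
transitivity (\int[mu]_x (c0 * w `|x| + c1 * (w `|x| * cos (x * (2 * r))) + c2 * (w `|x| * sin (x * (2 * r))))%:E)%E.
  apply: ae_eq_integral => //.
  - apply/measurable_EFinP; apply: measurable_funM => //; apply: measurable_funX; exact: measurable_sqrt_w.
  - by case/integrableP : k012.
  - exists [set 0]; split; [exact: measurable_set1|exact: lebesgue_measure_set1|].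
    move=> x /= h; apply: contrapT => /eqP x0; apply: h => _.
    by rewrite sqrt_w2E//; congr (_%:E); ring.
have -> : (c0 * weightL1 w + c1 * Fw (2 * r ^+ 2))%:E =
  (\int[mu]_x (c0 * w `|x| + c1 * (w `|x| * cos (x * (2 * r))) + c2 * (w `|x| * sin (x * (2 * r)))))%:E.
  rewrite RintegralD// RintegralD// !RintegralZl// weight_cos weight_sin mulr0 addr0.
  by congr (_ + _ * Fw _)%:E; field.
by rewrite /Rintegral fineK//; exact: integrable_fin_num.
Qed.

(** Were the integral 0, w would vanish almost everywhere on (0, 1). *)
Lemma weightL1_gt0 : 0 < weightL1 w.
Proof.
have := @weight_integral 1 0 0 0; rewrite mul1r mul0r addr0.
move=> /(_ _)/wrap[x|hW]; first by rewrite !mul0r !addr0.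
rewrite lt_neqAle -lee_fin -hW integral_ge0 ?andbT; last first.
  by move=> x _; rewrite lee_fin !mul0r !addr0 mulr1 sqr_ge0.
apply/eqP => W0.
have : (\int[mu]_x `|(sqrt_w x ^+ 2)%:E| = 0)%E.
  rewrite -[RHS]/(0%:E) W0 -hW; apply: eq_integral => x _.
  by rewrite gee0_abs ?lee_fin ?sqr_ge0// !mul0r !addr0 mulr1.
have msq : measurable_fun setT (fun x => (sqrt_w x ^+ 2)%:E).
  by apply/measurable_EFinP; apply: measurable_funX; exact: measurable_sqrt_w.
move/(@ae_eq_integral_abs _ (measurableTypeR R) R mu setT measurableT _ msq) => [N [mN N0 sN]].
have I01 : mu `]0%R, 1%R[%classic = 0%E.
  apply: (@subset_measure0 _ (measurableTypeR R) R mu _ N) => //.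
  move=> x /=; rewrite in_itv/= => /andP[x0 _]; apply: sN => /= /(_ I) [].
  rewrite sqrt_w2E ?lt0r_neq0// => wx.
  by case: hw => /(_ `|x|); rewrite normr_gt0 lt0r_neq0// wx ltxx => /(_ isT).
move: I01; rewrite lebesgue_measure_itv/= lte_fin ltr01 oppr0 adde0 => /eqP.
by rewrite eqe oner_eq0.
Qed.

(** The averages of 1 + cos and 1 - cos against the weight are nonnegative. *)
Lemma Fw_le r : `|Fw (2 * r ^+ 2)| <= weightL1 w.
Proof.
have h (c : R) : `|c| <= 1 -> 0 <= weightL1 w + c * Fw (2 * r ^+ 2).
  move=> c1.
  have c0 x : 0 <= 1 + c * cos (x * (2 * r)) + 0 * sin (x * (2 * r)).
    rewrite mul0r addr0 -lerBlDl sub0r.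
    have : `|c * cos (x * (2 * r))| <= 1 by rewrite normrM mulr_ile1// normr_cos_le1.
    by rewrite ler_norml => /andP[].
  rewrite -[weightL1 w]mul1r -lee_fin -(@weight_integral _ _ 0).
    apply: integral_ge0 => x _; rewrite lee_fin; apply: mulr_ge0; first exact: sqr_ge0.
    exact: c0.
  exact: c0.
rewrite ler_norml; apply/andP; split.
  by have := h 1; rewrite normr1 lexx mul1r => /(_ isT); lra.
by have := h (-1); rewrite normrN normr1 lexx => /(_ isT); lra.
Qed.

Lemma Fw_continuous : continuous (fun r : R => Fw (2 * r ^+ 2)).
Proof.
case: hFw => _ h _ r; apply/cvgrPdist_lt => e e0.
have [d d0 hd] := h e e0.
have p (s : R) : 0 <= 2 * s ^+ 2 by apply: mulr_ge0 => //; exact: sqr_ge0.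
near=> s; apply: hd => //.
near: s.
have : (fun s : R => 2 * s ^+ 2) @ r --> 2 * r ^+ 2.
  by apply: cvgM; [exact: cvg_cst|exact: exprn_continuous].
by move/cvgrPdist_lt; apply.
Unshelve. all: by end_near. Qed.
End weight.

(** * The energy identity for the integral formula *)

Section energy.
Context {R : realType}.
Local Notation mu := (@lebesgue_measure R).
Local Notation D := (`]0%R, +oo[%classic : set R).
Variables (w Fw psi phi : R -> R).
Hypothesis hw : weight_assumption w.
Hypothesis hFw : Fw_assumption w Fw.
Hypothesis hpsi : smoothing_assumption psi.
Hypothesis hphi : dispersion_assumption phi.
Local Notation Phi := (phase phi).
Local Notation rho := (speed phi).

(** Half of |f(r) + f(-r)|^2 and half of |f(r) - f(-r)|^2 are the contributions of the
pair {r, -r} to the squared norms of the even and odd parts of f. *)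
Definition energy_density (f : R -> R[i]) : R -> R := half (fun r =>
  lambda w Fw psi phi 0 r * (sqmod (f r + f (- r)) / 2) +
  lambda w Fw psi phi 1 r * (sqmod (f r - f (- r)) / 2)).

Lemma psi_continuous r : 0 < r -> {for r, continuous psi}.
Proof.
move=> r0; case: hpsi => + _; rewrite continuous_open_subspace; last exact: interval_open.
by apply; rewrite inE/= in_itv/= r0.
Qed.

Lemma measurable_psi : measurable_fun D psi.
Proof.
apply: open_continuous_measurable_fun; first exact: interval_open.
by move=> r; rewrite inE/= in_itv/= andbT; exact: psi_continuous.
Qed.

Lemma measurable_phi_norm : measurable_fun setT (fun xi : R => phi `|xi|).
Proof. by apply: measurable_comp_norm; apply: measurable_phi; case: hphi. Qed.

Lemma Re_integrand (a b c : R) (z : R[i]) :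
  complex.Re (expi a * c%:C * expi b * z) =
  cos b * (c * (cos a * complex.Re z - sin a * complex.Im z)) -
  sin b * (c * (sin a * complex.Re z + cos a * complex.Im z)).
Proof. by case: z => u v; rewrite /expi /=; ring. Qed.

Lemma Im_integrand (a b c : R) (z : R[i]) :
  complex.Im (expi a * c%:C * expi b * z) =
  sin b * (c * (cos a * complex.Re z - sin a * complex.Im z)) +
  cos b * (c * (sin a * complex.Re z + cos a * complex.Im z)).
Proof. by case: z => u v; rewrite /expi /=; ring. Qed.

Section f.
Variable f : R -> R[i].
Hypothesis mf : cmeasurable f.
Hypothesis jf : cintegrable (leb1 R) (fun xi => (psi `|xi|)%:C * f xi).

Let U xi := psi `|xi| * complex.Re (f xi).
Let V xi := psi `|xi| * complex.Im (f xi).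

Let jU : mu.-integrable setT (EFin \o U).
Proof.
case: jf => + _; apply: eq_integrable => // xi _ /=.
by rewrite /U; case: (f xi) => u v /=; rewrite mul0r subr0.
Qed.

Let jV : mu.-integrable setT (EFin \o V).
Proof.
case: jf => _; apply: eq_integrable => // xi _ /=.
by rewrite /V; case: (f xi) => u v /=; rewrite mul0r addr0.
Qed.

Let mU : measurable_fun setT U. Proof. by case/integrableP : jU => /measurable_EFinP. Qed.
Let mV : measurable_fun setT V. Proof. by case/integrableP : jV => /measurable_EFinP. Qed.

(** Real and imaginary parts of e^{ix xi} psi(|xi|) f(xi). *)
Let alpha x xi := cos (x * xi) * U xi - sin (x * xi) * V xi.
Let beta x xi := sin (x * xi) * U xi + cos (x * xi) * V xi.

Let mx (x : R) : measurable_fun setT (fun xi => x * xi). Proof. exact: measurable_funM. Qed.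

Let jalpha x : mu.-integrable setT (EFin \o alpha x).
Proof. exact: (integrableB measurableT (integrable_cosM (mx x) jU) (integrable_sinM (mx x) jV)). Qed.

Let jbeta x : mu.-integrable setT (EFin \o beta x).
Proof. exact: (integrableD measurableT (integrable_sinM (mx x) jU) (integrable_cosM (mx x) jV)). Qed.

(** Real and imaginary parts of the folded amplitude A_x(r), the function whose
Fourier integral along the phase is S f (x, .). *)
Definition foldA (x : R) : R -> R := half (fun r => alpha x r + alpha x (- r)).
Definition foldB (x : R) : R -> R := half (fun r => beta x r + beta x (- r)).

Let jA x : mu.-integrable setT (EFin \o foldA x).
Proof. exact: (integrable_half (integrableD measurableT (jalpha x) (integrable_reflect (jalpha x)))). Qed.

Let jB x : mu.-integrable setT (EFin \o foldB x).
Proof. exact: (integrable_half (integrableD measurableT (jbeta x) (integrable_reflect (jbeta x)))). Qed.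

Let mtphi (t : R) : measurable_fun setT (fun xi : R => t * phi `|xi|).
Proof. by apply: measurable_funM => //; exact: measurable_phi_norm. Qed.

Let mtPhi (t : R) : measurable_fun setT (fun xi : R => t * Phi xi).
Proof. by apply: measurable_funM => //; exact: measurable_phase. Qed.

Lemma Re_S_formula x t : complex.Re (S_formula w psi phi f (x, t)) =
  sqrt_w w x * (ctrans Phi (foldA x) t - strans Phi (foldB x) t).
Proof.
rewrite /S_formula /cintegral /= mul0r subr0; congr (_ * _).
under eq_Rintegral do rewrite Re_integrand.
have E : (fun xi => cos (t * phi `|xi|) * (psi `|xi| * (cos (x * xi) * complex.Re (f xi) - sin (x * xi) * complex.Im (f xi)))
  - sin (t * phi `|xi|) * (psi `|xi| * (sin (x * xi) * complex.Re (f xi) + cos (x * xi) * complex.Im (f xi)))) =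
  (fun xi => cos (t * phi `|xi|) * alpha x xi - sin (t * phi `|xi|) * beta x xi).
  by apply/funext => xi; rewrite /alpha /beta /U /V; ring.
rewrite E Rintegral_fold; last first.
  exact: (integrableB measurableT (integrable_cosM (mtphi t) (jalpha x)) (integrable_sinM (mtphi t) (jbeta x))).
rewrite /ctrans /strans -RintegralB//; last 2 first.
  exact: (integrable_cosM (mtPhi t) (jA x)).
  exact: (integrable_sinM (mtPhi t) (jB x)).
apply: eq_Rintegral => r _; rewrite /foldA /foldB.
have [r0|r0] := ltP 0 r; last by rewrite !half0// !mulr0 subr0.
by rewrite !halfE// normrN (gtr0_norm r0) phaseE//; ring.
Qed.

Lemma Im_S_formula x t : complex.Im (S_formula w psi phi f (x, t)) =
  sqrt_w w x * (strans Phi (foldA x) t + ctrans Phi (foldB x) t).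
Proof.
rewrite /S_formula /cintegral /= mul0r addr0; congr (_ * _).
under eq_Rintegral do rewrite Im_integrand.
have E : (fun xi => sin (t * phi `|xi|) * (psi `|xi| * (cos (x * xi) * complex.Re (f xi) - sin (x * xi) * complex.Im (f xi)))
  + cos (t * phi `|xi|) * (psi `|xi| * (sin (x * xi) * complex.Re (f xi) + cos (x * xi) * complex.Im (f xi)))) =
  (fun xi => sin (t * phi `|xi|) * alpha x xi + cos (t * phi `|xi|) * beta x xi).
  by apply/funext => xi; rewrite /alpha /beta /U /V; ring.
rewrite E Rintegral_fold; last first.
  exact: (integrableD measurableT (integrable_sinM (mtphi t) (jalpha x)) (integrable_cosM (mtphi t) (jbeta x))).
rewrite /ctrans /strans -RintegralD//; last 2 first.
  exact: (integrable_sinM (mtPhi t) (jA x)).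
  exact: (integrable_cosM (mtPhi t) (jB x)).
apply: eq_Rintegral => r _; rewrite /foldA /foldB.
have [r0|r0] := ltP 0 r; last by rewrite !half0// !mulr0 addr0.
by rewrite !halfE// normrN (gtr0_norm r0) phaseE//; ring.
Qed.

Lemma cintegrable_integrand x t : cintegrable (leb1 R) (fun xi =>
  expi (x * xi) * (psi `|xi|)%:C * expi (t * phi `|xi|) * f xi).
Proof.
split; under eq_fun do rewrite (Re_integrand, Im_integrand).
- rewrite (_ : (fun xi => _) =
    EFin \o (fun xi => cos (t * phi `|xi|) * alpha x xi - sin (t * phi `|xi|) * beta x xi)).
    exact: (integrableB measurableT (integrable_cosM (mtphi t) (jalpha x)) (integrable_sinM (mtphi t) (jbeta x))).
  by apply/funext => xi; rewrite /alpha /beta /U /V /=; congr EFin; ring.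
- rewrite (_ : (fun xi => _) =
    EFin \o (fun xi => sin (t * phi `|xi|) * alpha x xi + cos (t * phi `|xi|) * beta x xi)).
    exact: (integrableD measurableT (integrable_sinM (mtphi t) (jalpha x)) (integrable_cosM (mtphi t) (jbeta x))).
  by apply/funext => xi; rewrite /alpha /beta /U /V /=; congr EFin; ring.
Qed.

Let mxr : measurable_fun setT (fun p : R * R => p.1 * p.2).
Proof. exact: measurable_funM. Qed.

Let malpha : measurable_fun setT (fun p : R * R => alpha p.1 p.2).
Proof.
apply: measurable_funB; apply: measurable_funM.
- exact: measurable_cosf.
- exact: measurableT_comp.
- exact: measurable_sinf.
- exact: measurableT_comp.
Qed.

Let mbeta : measurable_fun setT (fun p : R * R => beta p.1 p.2).
Proof.
apply: measurable_funD; apply: measurable_funM.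
- exact: measurable_sinf.
- exact: measurableT_comp.
- exact: measurable_cosf.
- exact: measurableT_comp.
Qed.

Let m1N : measurable_fun setT (fun p : R * R => (p.1, - p.2)).
Proof. by apply: measurable_fun_pair => //; apply: measurableT_comp => //; exact: measurable_snd. Qed.

Let mI2 : measurable_fun setT (fun p : R * R => \1_D p.2 : R).
Proof. by apply: (measurableT_comp (f := \1_D : R -> R)) => //; exact: measurable_indic. Qed.

Let mA : measurable_fun setT (fun p : R * R => foldA p.1 p.2).
Proof.
apply: measurable_funM => //; apply: measurable_funD => //.
exact: (measurableT_comp malpha m1N).
Qed.

Let mB : measurable_fun setT (fun p : R * R => foldB p.1 p.2).
Proof.
apply: measurable_funM => //; apply: measurable_funD => //.
exact: (measurableT_comp mbeta m1N).
Qed.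

Let mct (G : R -> R -> R) : measurable_fun setT (fun p : R * R => G p.1 p.2) ->
  measurable_fun setT (fun p : R * R => ctrans Phi (G p.1) p.2).
Proof.
move=> mG.
apply: (@measurable_Rintegral_param _ _ _ _ _ mu (fun q : (R * R) * R => cos (q.1.2 * Phi q.2) * G q.1.1 q.2)).
apply: measurable_funM.
  apply: measurable_cosf; apply: measurable_funM.
    exact: (measurableT_comp measurable_snd measurable_fst).
  exact: (measurableT_comp (measurable_phase hphi) measurable_snd).
apply: (measurableT_comp mG (g := fun q : (R * R) * R => (q.1.1, q.2))).
apply: measurable_fun_pair; last exact: measurable_snd.
exact: (measurableT_comp measurable_fst measurable_fst).
Qed.

Let mst (G : R -> R -> R) : measurable_fun setT (fun p : R * R => G p.1 p.2) ->
  measurable_fun setT (fun p : R * R => strans Phi (G p.1) p.2).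
Proof.
move=> mG.
apply: (@measurable_Rintegral_param _ _ _ _ _ mu (fun q : (R * R) * R => sin (q.1.2 * Phi q.2) * G q.1.1 q.2)).
apply: measurable_funM.
  apply: measurable_sinf; apply: measurable_funM.
    exact: (measurableT_comp measurable_snd measurable_fst).
  exact: (measurableT_comp (measurable_phase hphi) measurable_snd).
apply: (measurableT_comp mG (g := fun q : (R * R) * R => (q.1.1, q.2))).
apply: measurable_fun_pair; last exact: measurable_snd.
exact: (measurableT_comp measurable_fst measurable_fst).
Qed.

Lemma cmeasurable_S_formula :
  @cmeasurable _ (measurableTypeR R * measurableTypeR R)%type R (S_formula w psi phi f).
Proof.
have msw : measurable_fun setT (fun p : R * R => sqrt_w w p.1).
  exact: (measurableT_comp (measurable_sqrt_w hw) measurable_fst).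
split.
- rewrite (_ : (fun p => _) = (fun p : R * R => sqrt_w w p.1 * (ctrans Phi (foldA p.1) p.2 - strans Phi (foldB p.1) p.2))).
    by apply: measurable_funM => //; apply: measurable_funB; [exact: mct|exact: mst].
  by apply/funext => -[x t]; rewrite Re_S_formula.
- rewrite (_ : (fun p => _) = (fun p : R * R => sqrt_w w p.1 * (strans Phi (foldA p.1) p.2 + ctrans Phi (foldB p.1) p.2))).
    by apply: measurable_funM => //; apply: measurable_funD; [exact: mst|exact: mct].
  by apply/funext => -[x t]; rewrite Im_S_formula.
Qed.

(** The expansion of |A_x(r)|^2: the mean and cosine coefficients are the half-sum
and half-difference of the even and odd masses. *)
Lemma fold_sqr x r : foldA x r ^+ 2 + foldB x r ^+ 2 =
  half (fun r => psi r ^+ 2 * ((sqmod (f r + f (- r)) + sqmod (f r - f (- r))) / 2)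
   + psi r ^+ 2 * ((sqmod (f r + f (- r)) - sqmod (f r - f (- r))) / 2) * cos (x * (2 * r))
   + psi r ^+ 2 * (2 * (complex.Re (f r) * complex.Im (f (- r)) - complex.Im (f r) * complex.Re (f (- r)))) * sin (x * (2 * r))) r.
Proof.
rewrite /foldA /foldB; have [r0|r0] := ltP 0 r; last by rewrite !half0// expr0n addr0.
rewrite !halfE// /alpha /beta /U /V normrN (gtr0_norm r0) mulrN cosN sinN /sqmod.
have -> : x * (2 * r) = x * r + x * r by ring.
rewrite cosD sinD.
have := cos2Dsin2 (x * r); move: (cos _) (sin _) => c s cs.
case: (f r) (f (- r)) => p1 p2 [q1 q2] /=.
set y := psi r; apply/eqP; rewrite -subr_eq0; apply/eqP.
transitivity ((c ^+ 2 + s ^+ 2 - 1) * (y ^+ 2 * (p1 ^+ 2 + p2 ^+ 2 + q1 ^+ 2 + q2 ^+ 2))); first by field.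
by rewrite cs subrr mul0r.
Qed.

(** A bound uniform in x. *)
Lemma fold_sqr_le x r : foldA x r ^+ 2 + foldB x r ^+ 2 <=
  half (fun r => 2 * (psi r ^+ 2 * (sqmod (f r) + sqmod (f (- r))))) r.
Proof.
rewrite /foldA /foldB; have [r0|r0] := ltP 0 r; last by rewrite !half0// expr0n addr0.
rewrite !halfE// /alpha /beta /U /V normrN (gtr0_norm r0) mulrN cosN sinN /sqmod.
have := cos2Dsin2 (x * r); move: (cos _) (sin _) => c s cs.
case: (f r) (f (- r)) => p1 p2 [q1 q2] /=.
rewrite -subr_ge0; set y := psi r.
rewrite (_ : _ - _ = (1 - (c ^+ 2 + s ^+ 2)) * (2 * y ^+ 2 * (p1 ^+ 2 + p2 ^+ 2 + q1 ^+ 2 + q2 ^+ 2)) + ((c * (y * p1) - s * (y * p2)) - (c * (y * q1) + s * (y * q2))) ^+ 2 +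
  ((s * (y * p1) + c * (y * p2)) - (- s * (y * q1) + c * (y * q2))) ^+ 2); last by ring.
by rewrite cs subrr mul0r add0r addr_ge0 ?sqr_ge0.
Qed.

(** This hypothesis controls |A_x|^2 / |phi'| and forces A_x to vanish at the zeros of
phi' without requiring lambda^* to be finite: it can hold on the support of f alone. *)
Variable C : R.
Hypothesis C0 : 0 <= C.
Hypothesis hC : forall r, 0 < r ->
  psi r ^+ 2 * (sqmod (f r) + sqmod (f (- r))) <= C * `|derive1 phi r| * (sqmod (f r) + sqmod (f (- r))).
Hypothesis fin : (\int[mu]_x (sqmod (f x))%:E < +oo)%E.

Let msqmod : measurable_fun setT (fun x => sqmod (f x)).
Proof. by case: mf => m1 m2; apply: measurable_funD; exact: measurable_funX. Qed.

Let m r := sqmod (f r) + sqmod (f (- r)).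

Let m0 r : 0 <= m r. Proof. by rewrite addr_ge0// sqmod_ge0. Qed.

Let mm : measurable_fun setT m.
Proof.
apply: measurable_funD => //.
by apply: (measurableT_comp msqmod); exact: oppr_measurable.
Qed.

Let quot_le x r : (foldA x r ^+ 2 + foldB x r ^+ 2) / rho r <= 2 * C * half m r.
Proof.
have [r0|r0] := ltP 0 r; last first.
  have := fold_sqr_le x r; rewrite !half0// => h.
  have -> : foldA x r ^+ 2 + foldB x r ^+ 2 = 0.
    by apply/eqP; rewrite eq_le h addr_ge0 ?sqr_ge0.
  by rewrite mul0r mulr0.
have := fold_sqr_le x r; rewrite !halfE// => h.
have h2 := hC r0.
rewrite speedE//; have [->|d0] := eqVneq (derive1 phi r) 0.
  by rewrite normr0 invr0 mulr0 mulr_ge0// mulr_ge0.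
rewrite ler_pdivrMr ?normr_gt0//.
rewrite (le_trans h)// /m; lra.
Qed.

Let fold0 x r : rho r = 0 -> foldA x r = 0 /\ foldB x r = 0.
Proof.
move=> r0; have := fold_sqr_le x r.
have h0 : half (fun r => 2 * (psi r ^+ 2 * (sqmod (f r) + sqmod (f (- r))))) r <= 0.
  have [rp|rn] := ltP 0 r; last by rewrite half0.
  rewrite halfE//; have := hC rp; rewrite -(speedE phi rp) r0 mulr0 mul0r; lra.
move=> /le_trans /(_ h0) h.
have : foldA x r ^+ 2 + foldB x r ^+ 2 == 0 by rewrite eq_le h addr_ge0 ?sqr_ge0.
by rewrite paddr_eq0 ?sqr_ge0// !sqrf_eq0 => /andP[/eqP -> /eqP ->].
Qed.

Let rhoV0 r : 0 <= (rho r)^-1. Proof. by rewrite invr_ge0; exact: speed_ge0. Qed.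

Let mAx x : measurable_fun setT (foldA x).
Proof. by case/integrableP : (jA x) => /measurable_EFinP. Qed.

Let mBx x : measurable_fun setT (foldB x).
Proof. by case/integrableP : (jB x) => /measurable_EFinP. Qed.

Let fin_quot x (g : R -> R) : measurable_fun setT g ->
  (forall r, 0 <= g r <= (foldA x r ^+ 2 + foldB x r ^+ 2) / rho r) ->
  (\int[mu]_r (g r)%:E < +oo)%E.
Proof.
move=> mg hg.
apply: (@le_lt_trans _ _ (\int[mu]_r (2 * C * half m r)%:E)%E).
  apply: ge0_le_integral => //.
  - by move=> r _; rewrite lee_fin; case/andP: (hg r).
  - exact/measurable_EFinP.
  - by apply/measurable_EFinP; apply: measurable_funM => //; exact: measurable_half.
  - by move=> r _; rewrite lee_fin; case/andP: (hg r) => _ /le_trans; apply; exact: quot_le.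
have mh : measurable_fun setT (fun r => (half m r)%:E) by apply/measurable_EFinP; exact: measurable_half.
have h0 r : (0 <= (half m r)%:E)%E.
  by rewrite lee_fin; apply: mulr_ge0 => //; rewrite indicE ler0n.
under eq_integral do rewrite EFinM.
have C2 : (0 <= (2 * C)%:E :> \bar R)%E by rewrite lee_fin mulr_ge0.
rewrite (@ge0_integralZl _ _ R mu setT measurableT _ mh _ (fun r _ => h0 r) C2).
rewrite -ge0_integral_fold//; last by move=> r; exact: sqmod_ge0.
have I0 : (0 <= \int[mu]_x (sqmod (f x))%:E)%E by apply: integral_ge0 => y _; rewrite lee_fin sqmod_ge0.
by apply: lte_mul_pinfty => //; rewrite ge0_fin_numE.
Qed.

Let mrV : measurable_fun setT (fun r => (rho r)^-1).
Proof. exact: measurable_speedV. Qed.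

(** Plancherel in t for each x, then Tonelli to integrate the weight in x for each r. *)
Theorem energy_identity :
  (\int[leb2 R]_p (sqmod (S_formula w psi phi f p))%:E =
   (2 * pi)%:E * \int[mu]_r (energy_density f r)%:E)%E.
Proof.
pose N x t := (ctrans Phi (foldA x) t - strans Phi (foldB x) t) ^+ 2 +
  (strans Phi (foldA x) t + ctrans Phi (foldB x) t) ^+ 2.
have N0 x t : 0 <= N x t by rewrite addr_ge0 ?sqr_ge0.
have SN x t : sqmod (S_formula w psi phi f (x, t)) = sqrt_w w x ^+ 2 * N x t.
  by rewrite /sqmod Re_S_formula Im_S_formula /N; ring.
have mS : measurable_fun setT (fun p : measurableTypeR R * measurableTypeR R => (sqmod (S_formula w psi phi f p))%:E).
  case: cmeasurable_S_formula => m1 m2.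
  by apply/measurable_EFinP; apply: measurable_funD; exact: measurable_funX.
rewrite /leb2 (@fubini_tonelli1 _ _ (measurableTypeR R) (measurableTypeR R) R mu mu _ mS); last first.
  by move=> p; rewrite lee_fin sqmod_ge0.
have pi20 : (0 <= (2 * pi)%:E :> \bar R)%E by rewrite lee_fin mulr_ge0// pi_ge0.
pose Q (p : R * R) := sqrt_w w p.1 ^+ 2 * ((foldA p.1 p.2 ^+ 2 + foldB p.1 p.2 ^+ 2) / rho p.2).
have q0 x r : 0 <= (foldA x r ^+ 2 + foldB x r ^+ 2) / rho r.
  by apply: mulr_ge0 => //; rewrite addr_ge0 ?sqr_ge0.
have Q0 p : (0 <= (Q p)%:E)%E by rewrite lee_fin; apply: mulr_ge0; [exact: sqr_ge0|exact: q0].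
have mQ : measurable_fun setT (fun p => (Q p)%:E).
  apply/measurable_EFinP; apply: measurable_funM.
    by apply: measurable_funX; exact: (measurableT_comp (measurable_sqrt_w hw) measurable_fst).
  apply: measurable_funM; last exact: (measurableT_comp mrV measurable_snd).
  by apply: measurable_funD; apply: measurable_funX; [exact: mA|exact: mB].
have inner x : (\int[mu]_t (sqmod (S_formula w psi phi f (x, t)))%:E =
    (2 * pi)%:E * \int[mu]_r (Q (x, r))%:E)%E.
  under eq_integral do rewrite SN EFinM.
  have s0 : (0 <= (sqrt_w w x ^+ 2)%:E)%E by rewrite lee_fin sqr_ge0.
  have mq : measurable_fun setT (fun r => ((foldA x r ^+ 2 + foldB x r ^+ 2) / rho r)%:E).
    apply/measurable_EFinP; apply: measurable_funM => //.
    by apply: measurable_funD; exact: measurable_funX.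
  have mN : measurable_fun setT (fun t => (N x t)%:E).
    have mPhi := measurable_phase hphi.
    apply/measurable_EFinP; apply: measurable_funD; apply: measurable_funX.
      by apply: measurable_funB; [exact: measurable_ctrans|exact: measurable_strans].
    by apply: measurable_funD; [exact: measurable_strans|exact: measurable_ctrans].
  rewrite (@ge0_integralZl _ _ R mu setT measurableT _ mN _ _ s0); last by move=> t _; rewrite lee_fin.
  rewrite plancherel_complex//.
  - rewrite muleCA; congr (_ * _)%E.
    rewrite -(@ge0_integralZl _ _ R mu setT measurableT _ mq _ _ s0); last by move=> r _; rewrite lee_fin.
    by apply: eq_integral => r _; rewrite -EFinM.
  - by move=> r /(fold0 x)[].
  - by move=> r /(fold0 x)[].
  - apply: (@fin_quot x) => [|r]; first by apply: measurable_funM => //; exact: measurable_funX.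
    rewrite mulr_ge0 ?sqr_ge0//=; apply: ler_wpM2r => //; by rewrite lerDl sqr_ge0.
  - apply: (@fin_quot x) => [|r]; first by apply: measurable_funM => //; exact: measurable_funX.
    rewrite mulr_ge0 ?sqr_ge0//=; apply: ler_wpM2r => //; by rewrite lerDr sqr_ge0.
rewrite /fubini_F; under eq_integral do rewrite inner.
have mQi : measurable_fun setT (fun x => \int[mu]_r (Q (x, r))%:E)%E.
  exact: (@measurable_fun_fubini_tonelli_F _ _ _ _ R mu (fun p => (Q p)%:E)).
have Qi0 x : (0 <= \int[mu]_r (Q (x, r))%:E)%E by apply: integral_ge0 => r _; exact: Q0.
rewrite (@ge0_integralZl _ _ R mu setT measurableT _ mQi _ (fun x _ => Qi0 x) pi20).
congr (_ * _)%E.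
rewrite (@fubini_tonelli _ _ _ _ _ mu mu (fun p => (Q p)%:E))//.
apply: eq_integral => r _ /=.
rewrite /energy_density; have [r0|r0] := ltP 0 r; last first.
  rewrite half0// (_ : (fun x => (Q (x, r))%:E) = cst 0%E) ?integral0//.
  by apply/funext => x; rewrite /Q /= /foldA /foldB !half0// expr0n addr0 mul0r mulr0.
pose c0 := psi r ^+ 2 * ((sqmod (f r + f (- r)) + sqmod (f r - f (- r))) / 2) / rho r.
pose c1 := psi r ^+ 2 * ((sqmod (f r + f (- r)) - sqmod (f r - f (- r))) / 2) / rho r.
pose c2 := psi r ^+ 2 * (2 * (complex.Re (f r) * complex.Im (f (- r)) - complex.Im (f r) * complex.Re (f (- r)))) / rho r.
have cE x : (foldA x r ^+ 2 + foldB x r ^+ 2) / rho r = c0 + c1 * cos (x * (2 * r)) + c2 * sin (x * (2 * r)).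
  by rewrite fold_sqr halfE// /c0 /c1 /c2; ring.
transitivity (\int[mu]_x (sqrt_w w x ^+ 2 * (c0 + c1 * cos (x * (2 * r)) + c2 * sin (x * (2 * r))))%:E)%E.
  by apply: eq_integral => x _; rewrite /Q /= cE.
rewrite (weight_integral hw hFw); last by move=> x; rewrite -cE.
rewrite halfE//; congr (_%:E); rewrite /lambda /= /c0 /c1 speedE//.
by move: (sqmod _) (sqmod _) (`|_|^-1) => X Y z; field.
Qed.
End f.
End energy.

(** * Square norms and completeness of L^2 *)

Section riesz_fischer.
Context d (T : measurableType d) (R : realType) (mu : {measure set T -> \bar R}).

(** Increments of size K 2^{-n} sum to a tail of size 2 K 2^{-n}. *)
Lemma geometric_cauchy_cvg (a : nat -> R) (K : R) : 0 <= K ->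
  (forall n, (a n.+1 - a n) ^+ 2 <= K ^+ 2 / 4 ^+ n) ->
  exists l, a @ \oo --> l /\ forall n, (l - a n) ^+ 2 <= 4 * K ^+ 2 / 4 ^+ n.
Proof.
move=> K0 ha.
have step n : `|a n.+1 - a n| <= K / 2 ^+ n.
  rewrite -(ler_pXn2r (n := 2))// ?nnegrE ?divr_ge0// real_normK ?num_real//.
  by rewrite (le_trans (ha n))// exprMn exprVn -exprM mulnC exprM (_ : 2 ^+ 2 = 4)//; ring.
have tele n m : `|a (n + m)%N - a n| <= 2 * (K / 2 ^+ n) - 2 * (K / 2 ^+ (n + m)).
  elim: m => [|m ih]; first by rewrite addn0 !subrr normr0.
  rewrite addnS (le_trans (ler_distD (a (n + m)%N) _ _))//.
  rewrite addrC (le_trans (lerD ih (step _)))// exprS invfM.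
  by move: (2 ^+ (n + m))^-1 => z; rewrite le_eqVlt; apply/orP; left; apply/eqP; field.
have tl n m : (n <= m)%N -> `|a m - a n| <= 2 * (K / 2 ^+ n).
  move=> nm; have := tele n (m - n)%N; rewrite subnKC// => /le_trans; apply.
  by rewrite gerBl mulr_ge0// divr_ge0.
have c2 : (fun n => 2 * (K / 2 ^+ n)) @ \oo --> (0 : R).
  rewrite -(mulr0 2); apply: cvgMr; rewrite -(mulr0 K); apply: cvgMr.
  under eq_fun do rewrite -exprVn.
  by apply: cvg_expr; rewrite ger0_norm// ?invr_ge0// invf_lt1// ltr1n.
have cvga : cvgn a.
  apply: cauchy_cvg; apply: cauchy_exP => e e0.
  have /cvgrPdist_lt /(_ e e0) [N _ hN] := c2.
  exists (a N); exists N => // m /= Nm; rewrite -ball_normE /= distrC.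
  rewrite (le_lt_trans (tl _ _ Nm))//.
  by have := hN N (leqnn N); rewrite sub0r normrN ger0_norm// mulr_ge0// divr_ge0.
exists (limn a); split => // n.
have : `|limn a - a n| <= 2 * (K / 2 ^+ n).
  have h : (fun m => `|a m - a n|) @ \oo --> `|limn a - a n|.
    by apply: cvg_norm; apply: cvgB => //; exact: cvg_cst.
  rewrite -(cvg_lim (@Rhausdorff R) h); apply: limr_le; first exact: cvgP h.
  by exists n => // m /= nm; exact: tl.
move=> h; rewrite -real_normK ?num_real//.
apply: le_trans (_ : (2 * (K / 2 ^+ n)) ^+ 2 <= _).
  by rewrite ler_pXn2r// nnegrE (le_trans _ h).
rewrite !exprMn exprVn -exprM (mulnC n) exprM (_ : 2 ^+ 2 = 4 :> R)//; last by ring.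
by rewrite mulrA.
Qed.

(** With G the sum of 4^n |a_{n+1} - a_n|^2, the increments are at most sqrt(G) 2^{-n}
wherever G is finite, and the hypothesis makes the integral of G at most 1. The
limit is therefore taken pointwise and its error is bounded by 4 G / 4^n. *)
Lemma fast_L2_limit (a : nat -> T -> R) : (forall n, measurable_fun setT (a n)) ->
  (forall n, (\int[mu]_x ((a n.+1 x - a n x) ^+ 2)%:E <= (4 ^+ n)^-1%:E * (1 / (2 ^ n.+1)%:R)%:E)%E) ->
  exists2 l : T -> R, measurable_fun setT l &
    forall n, (\int[mu]_x ((l x - a n x) ^+ 2)%:E <= (4 / 4 ^+ n)%:E)%E.
Proof.
move=> ma ha.
pose dd n x := (a n.+1 x - a n x) ^+ 2.
pose G x := (\sum_(n <oo) (4 ^+ n * dd n x)%:E)%E.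
have md n : measurable_fun setT (dd n) by apply: measurable_funX; exact: measurable_funB.
have mt n : measurable_fun setT (fun x => (4 ^+ n * dd n x)%:E).
  by apply/measurable_EFinP; exact: measurable_funM.
have t0 n x : (0 <= (4 ^+ n * dd n x)%:E)%E.
  by rewrite lee_fin mulr_ge0// ?sqr_ge0// exprn_ge0.
have G0 x : (0 <= G x)%E by apply: nneseries_ge0.
have mG : measurable_fun setT G by apply: ge0_emeasurable_sum.
have IG : (\int[mu]_x G x <= 1)%E.
  rewrite /G (@integral_nneseries _ _ _ _ _ measurableT (fun n x => (4 ^+ n * dd n x)%:E))//.
  apply: (le_trans _ (epsilon_trick0 xpredT (ler01 : 0 <= (1 : R)))).
  apply: lee_nneseries => n _.
    by move=> _; exact: integral_ge0.
  under eq_integral do rewrite EFinM.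
  rewrite (@ge0_integralZl _ _ R mu setT measurableT (fun x => (dd n x)%:E)).
  2: exact/measurable_EFinP.
  2: by move=> x _; rewrite lee_fin sqr_ge0.
  2: by rewrite lee_fin exprn_ge0.
  have p : (0 <= (4 ^+ n)%:E :> \bar R)%E by rewrite lee_fin exprn_ge0.
  apply: le_trans (lee_wpmul2l p (ha n)) _.
  by rewrite muleA -!EFinM divff ?expf_neq0// !mul1r.
have iG : mu.-integrable setT G.
  apply/integrableP; split=> //.
  by under eq_integral do rewrite gee0_abs//; rewrite (le_lt_trans IG)// ltry.
pose F := [set x | G x \is a fin_num].
have mF : measurable F.
  by have := emeasurable_fin_num measurableT mG; rewrite setTI.
(* Setting the sequence to 0 off the full-measure set F makes it converge
   everywhere, so that its limit is measurable. *)
pose b n x := \1_F x * a n x.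
have mb n : measurable_fun setT (b n) by apply: measurable_funM.
have bound x : F x -> forall n, (a n.+1 x - a n x) ^+ 2 <= Num.sqrt (fine (G x)) ^+ 2 / 4 ^+ n.
  move=> Fx n; rewrite sqr_sqrtr ?fine_ge0// ler_pdivlMr ?exprn_gt0// mulrC.
  rewrite -lee_fin fineK//.
  have := @nneseries_lim_ge R (fun n => (4 ^+ n * dd n x)%:E) xpredT 0 n.+1 (fun n _ _ => t0 n x).
  rewrite big_nat_recr//= => /(le_trans _); apply.
  by rewrite leeDr// sume_ge0.
have lim x : exists l, (fun n => b n x) @ \oo --> l /\
    forall n, F x -> (l - a n x) ^+ 2 <= 4 * fine (G x) / 4 ^+ n.
  have [Fx|Fx] := pselect (F x); last first.
    exists 0; split=> //; rewrite (_ : (fun n => _) = cst 0); first exact: cvg_cst.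
    by apply/funext => n; rewrite /b indicE memNset// mul0r.
  have [l [cl hl]] := geometric_cauchy_cvg (sqrtr_ge0 _) (bound x Fx).
  exists l; split.
    by rewrite (_ : (fun n => _) = (fun n => a n x))//; apply/funext => n; rewrite /b indicE mem_set// mul1r.
  by move=> n _; have := hl n; rewrite sqr_sqrtr ?fine_ge0.
pose l x := projT1 (cid (lim x)).
have ll x := projT2 (cid (lim x)).
exists l.
  by apply: (measurable_fun_cvg (h := b)) => // x _; case: (ll x).
move=> n.
have ml : measurable_fun setT l.
  by apply: (measurable_fun_cvg (h := b)) => // x _; case: (ll x).
apply: (@le_trans _ _ (\int[mu]_x ((4 / 4 ^+ n)%:E * G x))%E).
  apply: ae_ge0_le_integral => //.
  - by move=> x _; rewrite lee_fin sqr_ge0.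
  - by apply/measurable_EFinP; apply: measurable_funX; exact: measurable_funB.
  - by move=> x _; rewrite mule_ge0// lee_fin divr_ge0// exprn_ge0.
  - exact: measurable_funeM.
  have := integrable_ae measurableT iG; apply: filterS => x /(_ I) Fx _.
  rewrite -[G x]fineK// -EFinM lee_fin.
  by have [_ /(_ n Fx)] := ll x; rewrite mulrAC.
have p : (0 <= (4 / 4 ^+ n : R)%:E)%E by rewrite lee_fin divr_ge0// exprn_ge0.
rewrite (@ge0_integralZl _ _ R mu setT measurableT _ mG _ (fun x _ => G0 x) p).
by rewrite -[leRHS]mule1; apply: lee_wpmul2l.
Qed.
End riesz_fischer.

Lemma sqmodN (R : realType) (z : R[i]) : sqmod (- z) = sqmod z.
Proof. by case: z => a b; rewrite /sqmod /= !sqrrN. Qed.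

Lemma sqmod_eq0 (R : realType) (z : R[i]) : sqmod z = 0 -> z = 0.
Proof.
case: z => a b; rewrite /sqmod /= => /eqP.
by rewrite paddr_eq0 ?sqr_ge0// !sqrf_eq0 => /andP[/eqP -> /eqP ->].
Qed.

Lemma sqmod0 (R : realType) : sqmod (0 : R[i]) = 0.
Proof. by rewrite /sqmod /= expr0n addr0. Qed.

Lemma sqmodD_le (R : realType) (d : R) (x y : R[i]) : 0 < d ->
  sqmod (x + y) <= (1 + d) * sqmod x + (1 + d^-1) * sqmod y.
Proof.
move=> d0; case: x y => a b [x y]; rewrite /sqmod /=.
by have := sqrD_le a x d0; have := sqrD_le b y d0; lra.
Qed.

Section L2sq.
Context d (T : measurableType d) (R : realType) (mu : {measure set T -> \bar R}).
Implicit Types f g : T -> R[i].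

(** The squared L^2 norm, which is what all quadratic identities below are about. *)
Definition L2sq f : \bar R := (\int[mu]_x (sqmod (f x))%:E)%E.

Lemma L2sq_ge0 f : (0 <= L2sq f)%E.
Proof. by apply: integral_ge0 => x _; rewrite lee_fin sqmod_ge0. Qed.

Lemma L2normE f : L2norm mu f = (L2sq f `^ 2^-1)%E.
Proof.
rewrite /L2norm unlock /=; congr (_ `^ _)%E; apply: eq_integral => x _.
rewrite /= powR_mulrn ?normr_ge0//; congr EFin.
rewrite real_normK ?num_real//; case: (f x) => a b /=.
by rewrite sqr_sqrtr// addr_ge0 ?sqr_ge0.
Qed.

Lemma L2norm_ge0 f : (0 <= L2norm mu f)%E. Proof. exact: Lnorm_ge0. Qed.

Lemma L2norm_sqr f : (L2norm mu f ^+ 2 = L2sq f)%E.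
Proof.
have := L2sq_ge0 f; rewrite L2normE; case: (L2sq f) => [r| |]//.
- rewrite lee_fin => r0; rewrite poweR_EFin -EFin_expe; congr EFin.
  by rewrite -powR_mulrn ?powR_ge0// -powRrM mulVf// powRr1.
- by rewrite poweRyr ?invr_eq0.
Qed.

Lemma L2norm_le f (e : R) : 0 <= e -> (L2norm mu f <= e%:E)%E = (L2sq f <= (e ^+ 2)%:E)%E.
Proof.
move=> e0; rewrite -L2norm_sqr; have := L2norm_ge0 f; case: (L2norm mu f) => [r| |]//.
by rewrite lee_fin => r0; rewrite -EFin_expe !lee_fin ler_pXn2r// nnegrE.
Qed.

Lemma L2norm_lty f : (L2norm mu f < +oo)%E = (L2sq f < +oo)%E.
Proof.
rewrite -L2norm_sqr; have := L2norm_ge0 f; case: (L2norm mu f) => [r| |]//.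
by move=> _; rewrite -EFin_expe !ltry.
Qed.

Lemma L2norm_cvg0 (f_ : nat -> T -> R[i]) :
  (fun n => L2norm mu (f_ n)) @ \oo --> 0%E <->
  forall e : R, 0 < e -> \forall n \near \oo, (L2sq (f_ n) <= e%:E)%E.
Proof.
split=> [/fine_cvgP[fn /cvgrPdist_le h] e e0|h].
  have s0 : 0 < Num.sqrt e by rewrite sqrtr_gt0.
  near=> n; rewrite -(sqr_sqrtr (ltW e0)) -L2norm_le ?sqrtr_ge0//.
  have Fn : L2norm mu (f_ n) \is a fin_num by near: n.
  rewrite -(fineK Fn) lee_fin.
  have : `|0 - fine (L2norm mu (f_ n))| <= Num.sqrt e by near: n; exact: h.
  by rewrite sub0r normrN ger0_norm// fine_ge0// L2norm_ge0.
have h2 (e : R) : 0 < e -> \forall n \near \oo, (L2norm mu (f_ n) <= e%:E)%E.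
  move=> e0; have [N _ hN] := h _ (exprn_gt0 2 e0).
  by exists N => // n Nn; rewrite /= L2norm_le ?(ltW e0)//; exact: (hN n Nn).
have fin_of n (e : R) : (L2norm mu (f_ n) <= e%:E)%E -> L2norm mu (f_ n) \is a fin_num.
  by move=> hn; rewrite ge0_fin_numE ?L2norm_ge0// (le_lt_trans hn)// ltry.
apply/fine_cvgP; split.
  by have [N _ hN] := h2 1 ltr01; exists N => // n Nn; exact: (fin_of _ 1 (hN n Nn)).
apply/cvgrPdist_le => e e0; have [N _ hN] := h2 _ e0; exists N => // n Nn /=.
have hn := hN n Nn.
rewrite sub0r normrN ger0_norm ?fine_ge0 ?L2norm_ge0//.
by rewrite -lee_fin fineK//; exact: fin_of hn.
Unshelve. all: by end_near. Qed.

Lemma measurable_sqmod f : cmeasurable f -> measurable_fun setT (fun x => sqmod (f x)).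
Proof. by case=> m1 m2; apply: measurable_funD; exact: measurable_funX. Qed.

Lemma cmeasurableD f g : cmeasurable f -> cmeasurable g -> cmeasurable (fun x => f x + g x).
Proof.
move=> [f1 f2] [g1 g2]; split.
- rewrite (_ : (fun x => _) = (fun x => complex.Re (f x) + complex.Re (g x))); first exact: measurable_funD.
  by apply/funext => x; case: (f x) (g x) => ? ? [].
- rewrite (_ : (fun x => _) = (fun x => complex.Im (f x) + complex.Im (g x))); first exact: measurable_funD.
  by apply/funext => x; case: (f x) (g x) => ? ? [].
Qed.

Lemma cmeasurableN f : cmeasurable f -> cmeasurable (fun x => - f x).
Proof.
move=> [f1 f2]; split.
- rewrite (_ : (fun x => _) = (fun x => - complex.Re (f x))); first exact: measurableT_comp.
  by apply/funext => x; case: (f x).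
- rewrite (_ : (fun x => _) = (fun x => - complex.Im (f x))); first exact: measurableT_comp.
  by apply/funext => x; case: (f x).
Qed.

Lemma cmeasurableB f g : cmeasurable f -> cmeasurable g -> cmeasurable (fun x => f x - g x).
Proof. by move=> mf mg; apply: cmeasurableD => //; exact: cmeasurableN. Qed.

Lemma cmeasurable_realM (a : T -> R) f : measurable_fun setT a -> cmeasurable f ->
  cmeasurable (fun x => (a x)%:C * f x).
Proof.
move=> ma [f1 f2]; split.
- rewrite (_ : (fun x => _) = (fun x => a x * complex.Re (f x))); first exact: measurable_funM.
  by apply/funext => x; case: (f x) => u v /=; rewrite mul0r subr0.
- rewrite (_ : (fun x => _) = (fun x => a x * complex.Im (f x))); first exact: measurable_funM.
  by apply/funext => x; case: (f x) => u v /=; rewrite mul0r addr0.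
Qed.

Lemma L2sqB f g : L2sq (fun x => f x - g x) = L2sq (fun x => g x - f x).
Proof. by apply: eq_integral => x _; rewrite -sqmodN opprB. Qed.

(** A substitute for the triangle inequality that stays within squared norms. *)
Lemma L2sqD_le (e : R) f g : 0 < e -> cmeasurable f -> cmeasurable g ->
  (L2sq (fun x => f x + g x)%R <= (1 + e)%:E * L2sq f + (1 + e^-1)%:E * L2sq g)%E.
Proof.
move=> e0 mf mg; apply: ge0_le_integral_comb.
- exact: measurable_sqmod.
- exact: measurable_sqmod.
- by apply: measurable_sqmod; exact: cmeasurableD.
- by move=> t; exact: sqmod_ge0.
- by move=> t; exact: sqmod_ge0.
- by move=> t; exact: sqmod_ge0.
- by rewrite addr_ge0// ltW.
- by rewrite addr_ge0// invr_ge0 ltW.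
- by move=> t; exact: sqmodD_le.
Qed.

Lemma L2sq_eq0 f : cmeasurable f -> L2sq f = 0%E -> {ae mu, forall x, f x = 0}.
Proof.
move=> mf f0.
have : (\int[mu]_x `|(sqmod (f x))%:E| = 0)%E.
  by rewrite -[RHS]f0; apply: eq_integral => x _; rewrite gee0_abs// lee_fin sqmod_ge0.
move/(@ae_eq_integral_abs _ _ _ mu setT measurableT) => h.
have /h : measurable_fun setT (fun x => (sqmod (f x))%:E) by apply/measurable_EFinP; exact: measurable_sqmod.
by apply: filterS => x /(_ I) [] /sqmod_eq0.
Qed.

Lemma ae_eq_L2sq f g : cmeasurable f -> cmeasurable g ->
  {ae mu, forall x, f x = g x} -> L2sq f = L2sq g.
Proof.
move=> mf mg fg; apply: ae_eq_integral => //.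
- by apply/measurable_EFinP; exact: measurable_sqmod.
- by apply/measurable_EFinP; exact: measurable_sqmod.
- by move: fg; apply: filterS => x -> _.
Qed.

Lemma fast_complex_L2_limit (a : nat -> T -> R[i]) : (forall n, cmeasurable (a n)) ->
  (forall n, (L2sq (fun x => a n.+1 x - a n x)%R <= (4 ^+ n)^-1%:E * (1 / (2 ^ n.+1)%:R)%:E)%E) ->
  exists2 l, cmeasurable l & forall n, (L2sq (fun x => l x - a n x)%R <= (8 / 4 ^+ n)%:E)%E.
Proof.
move=> ma ha.
have mRe n : measurable_fun setT (fun x => complex.Re (a n x)) by case: (ma n).
have mIm n : measurable_fun setT (fun x => complex.Im (a n x)) by case: (ma n).
have [l1 ml1 hl1] : exists2 l : T -> R, measurable_fun setT l &
    forall n, (\int[mu]_x ((l x - complex.Re (a n x)) ^+ 2)%:E <= (4 / 4 ^+ n)%:E)%E.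
  apply: fast_L2_limit => // n; apply: le_trans (ha n); apply: ge0_le_integral => //.
  - by move=> x _; rewrite lee_fin sqr_ge0.
  - by apply/measurable_EFinP; apply: measurable_funX; exact: measurable_funB.
  - by apply/measurable_EFinP; apply: measurable_sqmod; exact: cmeasurableB.
  - move=> x _; rewrite lee_fin; case: (a n.+1 x) (a n x) => u v [u' v'].
    by rewrite /sqmod /= lerDl sqr_ge0.
have [l2 ml2 hl2] : exists2 l : T -> R, measurable_fun setT l &
    forall n, (\int[mu]_x ((l x - complex.Im (a n x)) ^+ 2)%:E <= (4 / 4 ^+ n)%:E)%E.
  apply: fast_L2_limit => // n; apply: le_trans (ha n); apply: ge0_le_integral => //.
  - by move=> x _; rewrite lee_fin sqr_ge0.
  - by apply/measurable_EFinP; apply: measurable_funX; exact: measurable_funB.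
  - by apply/measurable_EFinP; apply: measurable_sqmod; exact: cmeasurableB.
  - move=> x _; rewrite lee_fin; case: (a n.+1 x) (a n x) => u v [u' v'].
    by rewrite /sqmod /= lerDr sqr_ge0.
exists (fun x => l1 x +i* l2 x); first by split.
move=> n.
have -> : (8 / 4 ^+ n : R)%:E = ((4 / 4 ^+ n : R)%:E + (4 / 4 ^+ n : R)%:E)%E.
  by rewrite -EFinD -mulrDl; congr (_ / _)%:E; ring.
apply: le_trans (leeD (hl1 n) (hl2 n)).
rewrite -ge0_integralD//.
- rewrite le_eqVlt; apply/orP; left; apply/eqP; apply: eq_integral => x _.
  by rewrite -EFinD; congr EFin; case: (a n x).
- by move=> x _; rewrite lee_fin sqr_ge0.
- by apply/measurable_EFinP; apply: measurable_funX; exact: measurable_funB.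
- by move=> x _; rewrite lee_fin sqr_ge0.
- by apply/measurable_EFinP; apply: measurable_funX; exact: measurable_funB.
Qed.
End L2sq.

(** * The multipliers lambda_k *)

Section lambda_facts.
Context {R : realType}.
Local Notation D := (`]0%R, +oo[%classic : set R).
Variables (w Fw psi phi : R -> R).
Hypothesis hw : weight_assumption w.
Hypothesis hFw : Fw_assumption w Fw.
Hypothesis hpsi : smoothing_assumption psi.
Hypothesis hphi : dispersion_assumption phi.
Local Notation W := (weightL1 w).
Local Notation lam := (lambda w Fw psi phi).
Local Notation lamS := (lambda_star w Fw psi phi).

Definition ratio (r : R) : R := psi r ^+ 2 / `|derive1 phi r|.

Lemma ratio_ge0 r : 0 <= ratio r.
Proof. by rewrite divr_ge0// sqr_ge0. Qed.

Lemma lambdaE k r : lam k r = ratio r * (W + (if k == 0 then 1 else -1) * Fw (2 * r ^+ 2)).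
Proof. by rewrite /lambda; case: ifP => _; rewrite ?mul1r ?mulN1r. Qed.

Lemma lambda_ge0 k r : 0 <= lam k r.
Proof.
rewrite lambdaE mulr_ge0 ?ratio_ge0//.
by have := Fw_le hw hFw r; rewrite ler_norml => /andP[h1 h2]; case: ifP => _; rewrite ?mul1r ?mulN1r; lra.
Qed.

Lemma lambda_le k r : lam k r <= 2 * W * ratio r.
Proof.
rewrite lambdaE mulrC ler_wpM2r ?ratio_ge0//.
by have := Fw_le hw hFw r; rewrite ler_norml => /andP[h1 h2]; case: ifP => _; rewrite ?mul1r ?mulN1r; lra.
Qed.

(** Both signs of F_w are available, and the common factor is nonnegative. *)
Lemma lambda_maxE r : Num.max (lam 0 r) (lam 1 r) = ratio r * (W + `|Fw (2 * r ^+ 2)|).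
Proof.
rewrite !lambdaE/= mul1r mulN1r -maxr_pMr ?ratio_ge0//; congr (_ * _).
rewrite -addr_maxr; congr (_ + _).
have [h|h] := leP 0 (Fw (2 * r ^+ 2)).
  by rewrite ger0_norm// max_l//; lra.
by rewrite ltr0_norm// max_r//; lra.
Qed.

Lemma lambda_le_star k r : 0 < r -> ((lam k r)%:E <= lamS)%E.
Proof.
move=> r0; apply: (@le_trans _ _ (Num.max (lam 0 r) (lam 1 r))%:E).
  rewrite lee_fin le_max; case: (eqVneq k 0) => [->|k0]; first by rewrite lexx.
  by rewrite /lambda (negbTE k0) /= lexx orbT.
by apply: ereal_sup_ubound; exists r => //=; rewrite in_itv/= r0.
Qed.

Lemma lambda_star_ge0 : (0 <= lamS)%E.
Proof. by apply: le_trans (lambda_le_star 0 ltr01); rewrite lee_fin lambda_ge0. Qed.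

Lemma lambda_star_gt (c : R) : (c%:E < lamS)%E -> exists k : 'I_2, exists2 r, 0 < r & c < lam k r.
Proof.
move/ereal_sup_gt => [_ [r /= + <-]]; rewrite in_itv/= andbT => r0.
rewrite lte_fin lt_max => /orP[h|h]; first by exists 0, r.
by exists 1, r.
Qed.

Lemma psi_sqr_continuous r : 0 < r -> {for r, continuous (fun s => psi s ^+ 2)}.
Proof.
move=> r0; apply: (@continuous_comp _ _ _ psi (fun x => x ^+ 2)).
  exact: psi_continuous.
exact: exprn_continuous.
Qed.

Lemma ratio_continuous r : 0 < r -> derive1 phi r != 0 -> {for r, continuous ratio}.
Proof.
move=> r0 d0; apply: cvgM.
  exact: psi_sqr_continuous.
apply: cvgV; first by rewrite normr_eq0.
by apply: cvg_norm; case: hphi => _ c _; exact: dphi_continuous.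
Qed.

Lemma lambda_continuous k r : 0 < r -> derive1 phi r != 0 -> {for r, continuous (lam k)}.
Proof.
move=> r0 d0; rewrite (_ : lam k = (fun s => ratio s * (W + (if k == 0 then 1 else -1) * Fw (2 * s ^+ 2)))); last first.
  by apply/funext => s; rewrite lambdaE.
apply: cvgM; first exact: ratio_continuous.
apply: cvgD; first exact: cvg_cst.
apply: cvgM; first exact: cvg_cst.
exact: (Fw_continuous hFw).
Qed.

(** The strict inequality is an open condition; if phi' vanished wherever it holds,
phi would be constant near r, against injectivity. *)
Lemma dphi_neq0_near r (C : R) : 0 < r -> `|derive1 phi r| * C < psi r ^+ 2 ->
  exists2 s, 0 < s & `|derive1 phi s| * C < psi s ^+ 2 /\ derive1 phi s != 0.
Proof.
move=> r0 hr; apply: contrapT => H.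
have [dphi cphi iphi] := hphi.
have : \forall s \near r, 0 < s /\ `|derive1 phi s| * C < psi s ^+ 2.
  near=> s; split.
    by near: s; apply: (@cvgr_gt _ _ _ _ id r) => //; exact: cvg_id.
  rewrite -subr_gt0; near: s.
  apply: (@cvgr_gt _ _ _ _ (fun s => psi s ^+ 2 - `|derive1 phi s| * C) (psi r ^+ 2 - `|derive1 phi r| * C)).
    apply: cvgB; first exact: psi_sqr_continuous.
    apply: cvgM; last exact: cvg_cst.
    by apply: cvg_norm; exact: dphi_continuous.
  by rewrite subr_gt0.
move=> /nbhs_ballP[e /= e0 he].
have z s : r <= s < r + e -> derive1 phi s = 0.
  move=> /andP[rs se]; apply/eqP/negP => /negP ds; apply: H.
  have [s0 hs] : 0 < s /\ `|derive1 phi s| * C < psi s ^+ 2.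
    by apply: he; rewrite /ball /= distrC ger0_norm ?subr_ge0//; lra.
  by exists s.
have rs : r < r + e / 2 by rewrite ltrDl divr_gt0.
have [c cI hc] : exists2 c, c \in `]r, r + e / 2[%R &
    phi (r + e / 2) - phi r = derive1 phi c * (r + e / 2 - r).
  apply: MVT => //.
    move=> x; rewrite in_itv/= => /andP[rx _].
    by rewrite derive1E; apply: DeriveDef => //; apply: dphi; exact: lt_trans rx.
  apply: continuous_in_subspaceT => x; rewrite inE/= in_itv/= => /andP[rx _].
  by apply/differentiable_continuous/derivable1_diffP/dphi; exact: lt_le_trans rx.
move: hc; rewrite z ?mul0r; last by move: cI; rewrite in_itv/= => /andP[]; lra.
move/eqP; rewrite subr_eq0 => /eqP /(iphi _ _ _ _) E.
have : r + e / 2 = r by apply: E; rewrite in_itv/= andbT//; lra.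
lra.
Unshelve. all: by end_near. Qed.

(** Where phi' is nonzero this is psi^2 |w|_1 / |phi'| <= lambda^*; a violation at a zero
of phi' would produce a violation nearby at a point where phi' is nonzero. *)
Lemma psi_sqr_le (L r : R) : lamS = L%:E -> 0 < r -> psi r ^+ 2 <= L / W * `|derive1 phi r|.
Proof.
move=> hL r0; have W0 := weightL1_gt0 hw hFw.
rewrite leNgt; apply/negP; rewrite mulrC => /(dphi_neq0_near r0) [s s0 [hs ds]].
have : ratio s * W <= L.
  rewrite -lee_fin -hL; apply: le_trans (_ : (Num.max (lam 0 s) (lam 1 s))%:E <= _)%E.
    by rewrite lambda_maxE lee_fin ler_wpM2l ?ratio_ge0// lerDl.
  by apply: ereal_sup_ubound; exists s => //=; rewrite in_itv/= s0.
rewrite -ler_pdivlMr// /ratio ler_pdivrMr ?normr_gt0// mulrC => h.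
by have := lt_le_trans hs h; rewrite ltxx.
Qed.

Lemma measurable_half_on (g : R -> R) : measurable_fun D g -> measurable_fun setT (half g).
Proof.
move=> mg; rewrite (_ : half g = g \_ D); first exact/(measurable_restrictT _ _).1.
by apply/funext => r; rewrite /half patchE indicE; case: (r \in D); rewrite ?mul1r ?mul0r.
Qed.

Lemma measurable_lambda k : measurable_fun D (lam k).
Proof.
rewrite (_ : lam k = (fun s => ratio s * (W + (if k == 0 then 1 else -1) * Fw (2 * s ^+ 2)))); last first.
  by apply/funext => s; rewrite lambdaE.
apply: measurable_funM; last first.
  apply: measurable_funD => //; apply: measurable_funM => //.
  apply: (measurable_funS measurableT) => //.
  by apply: continuous_measurable_fun; exact: (Fw_continuous hFw).
apply: measurable_funM; first by apply: measurable_funX; exact: measurable_psi.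
rewrite (_ : (fun x => `|_|^-1) = (fun x => `|derive1 phi x|^-1))//.
apply: (eq_measurable_fun (fun r => (speed phi r)^-1)).
  by move=> r; rewrite inE/= in_itv/= andbT => r0; rewrite speedE.
apply: (measurable_funS measurableT) => //; exact: measurable_speedV.
Qed.

Lemma measurable_E_set k : measurable (E_set w Fw psi phi k).
Proof.
have := lambda_star_ge0; rewrite /E_set; case: lamS => [L| |]// _; last first.
  by rewrite (_ : [set _ | _] = set0)//; apply/seteqP; split=> r // [].
rewrite (_ : [set _ | _] = D `&` lam k @^-1` [set L]).
  by apply: (measurable_lambda k); [exact: measurable_itv|exact: measurable_set1].
apply/seteqP; split=> r /=; rewrite in_itv/= andbT.
  by move=> [r0 [->]].
by move=> [r0 ->].
Qed.
End lambda_facts.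

(** * The energy functional and absolutely convergent inputs *)

Section operator.
Context {R : realType}.
Local Notation mu := (@lebesgue_measure R).
Local Notation D := (`]0%R, +oo[%classic : set R).
Variables (w Fw psi phi : R -> R).
Hypothesis hw : weight_assumption w.
Hypothesis hFw : Fw_assumption w Fw.
Hypothesis hpsi : smoothing_assumption psi.
Hypothesis hphi : dispersion_assumption phi.
Local Notation W := (weightL1 w).
Local Notation lam := (lambda w Fw psi phi).
Local Notation lamS := (lambda_star w Fw psi phi).
Local Notation dens := (energy_density w Fw psi phi).
Local Notation S := (S_formula w psi phi).
Implicit Types f g u v : R -> R[i].

Definition mass f (r : R) : R := sqmod (f r) + sqmod (f (- r)).

Lemma mass_ge0 f r : 0 <= mass f r.
Proof. by rewrite addr_ge0// sqmod_ge0. Qed.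

Lemma half_ge0 (g : R -> R) r : (forall s, 0 <= g s) -> 0 <= half g r.
Proof. by move=> g0; rewrite mulr_ge0// indicE ler0n. Qed.

(** The parallelogram identity. *)
Lemma massE f r : mass f r = sqmod (f r + f (- r)) / 2 + sqmod (f r - f (- r)) / 2.
Proof. by rewrite /mass; case: (f r) (f (- r)) => a b [c d]; rewrite /sqmod /=; field. Qed.

Lemma cmeasurable_reflect f : cmeasurable f -> cmeasurable (fun r : R => f (- r)).
Proof.
by move=> [m1 m2]; split; [apply: (measurableT_comp m1)|apply: (measurableT_comp m2)];
  exact: oppr_measurable.
Qed.

Lemma measurable_mass f : cmeasurable f -> measurable_fun setT (mass f).
Proof.
move=> mf; apply: measurable_funD; apply: measurable_sqmod => //.
exact: cmeasurable_reflect.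
Qed.

Lemma L2sq_mass f : cmeasurable f -> L2sq (leb1 R) f = (\int[mu]_r (half (mass f) r)%:E)%E.
Proof.
move=> mf; apply: ge0_integral_fold; first exact: measurable_sqmod.
by move=> x; exact: sqmod_ge0.
Qed.

Lemma measurable_dens f : cmeasurable f -> measurable_fun setT (dens f).
Proof.
move=> mf; apply: measurable_half_on; apply: measurable_funD; apply: measurable_funM.
- exact: measurable_lambda.
- apply: (measurable_funS measurableT) => //; apply: measurable_funM => //.
  by apply: measurable_sqmod; apply: cmeasurableD => //; exact: cmeasurable_reflect.
- exact: measurable_lambda.
- apply: (measurable_funS measurableT) => //; apply: measurable_funM => //.
  by apply: measurable_sqmod; apply: cmeasurableB => //; exact: cmeasurable_reflect.
Qed.

Lemma dens_ge0 f r : 0 <= dens f r.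
Proof.
apply: half_ge0 => s.
apply: addr_ge0; apply: mulr_ge0; try exact: lambda_ge0.
  by rewrite divr_ge0// sqmod_ge0.
by rewrite divr_ge0// sqmod_ge0.
Qed.

Definition total_energy f : \bar R := (\int[mu]_r (dens f r)%:E)%E.
Local Notation energy := total_energy.

Lemma energy_ge0 f : (0 <= energy f)%E.
Proof. by apply: integral_ge0 => r _; rewrite lee_fin dens_ge0. Qed.

Lemma energy_le_L2sq f (K : R) : cmeasurable f -> 0 <= K ->
  (forall r, 0 < r -> dens f r <= K * mass f r) -> (energy f <= K%:E * L2sq (leb1 R) f)%E.
Proof.
move=> mf K0 h; rewrite L2sq_mass//.
have mh : measurable_fun setT (fun r => (half (mass f) r)%:E).
  by apply/measurable_EFinP; apply: measurable_half; exact: measurable_mass.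
have h0 r : (0 <= (half (mass f) r)%:E)%E by rewrite lee_fin half_ge0// => s; exact: mass_ge0.
have KE : (0 <= K%:E)%E by rewrite lee_fin.
rewrite -(@ge0_integralZl _ _ R mu setT measurableT _ mh _ (fun r _ => h0 r) KE).
apply: ge0_le_integral => //.
- by move=> r _; rewrite lee_fin dens_ge0.
- by apply/measurable_EFinP; exact: measurable_dens.
- exact: measurable_funeM.
- move=> r _; rewrite -EFinM lee_fin; have [r0|r0] := ltP 0 r.
    by rewrite halfE//; exact: h.
  by rewrite /energy_density !half0// mulr0.
Qed.

Lemma dens_le_star f (L r : R) : lamS = L%:E -> 0 < r -> dens f r <= L * mass f r.
Proof.
move=> hL r0; rewrite /energy_density halfE// massE mulrDr.
have h k : lam k r <= L by rewrite -lee_fin -hL; exact: lambda_le_star.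
by apply: lerD; apply: ler_wpM2r => //; rewrite divr_ge0// sqmod_ge0.
Qed.

Lemma energy_le_star f (L : R) : lamS = L%:E -> cmeasurable f ->
  (energy f <= L%:E * L2sq (leb1 R) f)%E.
Proof.
move=> hL mf; apply: energy_le_L2sq => //.
  by rewrite -lee_fin -hL; exact: lambda_star_ge0.
by move=> r; exact: dens_le_star.
Qed.

(** The energy is a nonnegative quadratic form, so it satisfies the same weighted
triangle inequality as the squared norm. *)
Lemma energyD_le (e : R) f g : 0 < e -> cmeasurable f -> cmeasurable g ->
  (energy (fun x => f x + g x)%R <= (1 + e)%:E * energy f + (1 + e^-1)%:E * energy g)%E.
Proof.
move=> e0 mf mg; apply: ge0_le_integral_comb.
- exact: measurable_dens.
- exact: measurable_dens.
- by apply: measurable_dens; exact: cmeasurableD.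
- by move=> t; exact: dens_ge0.
- by move=> t; exact: dens_ge0.
- by move=> t; exact: dens_ge0.
- by rewrite addr_ge0// ltW.
- by rewrite addr_ge0// invr_ge0 ltW.
move=> r; rewrite /energy_density; have [r0|r0] := ltP 0 r; last by rewrite !half0// !mulr0 addr0.
rewrite !halfE//.
have := sqmodD_le (f r + f (- r)) (g r + g (- r)) e0.
have := sqmodD_le (f r - f (- r)) (g r - g (- r)) e0.
rewrite (_ : f r - f (- r) + _ = f r + g r - (f (- r) + g (- r))); last by ring.
rewrite (_ : f r + f (- r) + _ = f r + g r + (f (- r) + g (- r))); last by ring.
set c1 := sqmod (f r + g r - _); set c0 := sqmod (f r + g r + _).
set a1 := sqmod (f r - _); set a0 := sqmod (f r + _); set b1 := sqmod (g r - _); set b0 := sqmod (g r + _).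
move: c1 c0 a1 a0 b1 b0 => c1 c0 a1 a0 b1 b0 h1 h0.
have := ler_wpM2l (lambda_ge0 psi phi hw hFw 0 r) h0.
have := ler_wpM2l (lambda_ge0 psi phi hw hFw 1 r) h1.
move: (lam 0 r) (lam 1 r) (e^-1) => l0 l1 e'.
by lra.
Qed.

Lemma psi_bounded (a b : R) : 0 < a -> a <= b ->
  exists2 M, 0 <= M & forall r, a <= r <= b -> `|psi r| <= M.
Proof.
move=> a0 ab.
have ci : {within `[a, b], continuous psi}.
  apply: continuous_in_subspaceT => x; rewrite inE/= in_itv/= => /andP[ax _].
  by apply: psi_continuous => //; exact: lt_le_trans ax.
have [c _ hc] := EVT_max ab ci.
exists `|psi c|; first exact: normr_ge0.
move=> r rab; have r0 : 0 < r by case/andP: rab => ar _; exact: lt_le_trans ar.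
rewrite ger0_norm; last by case: hpsi => _; apply.
by apply: le_trans (ler_norm _); apply: hc; rewrite in_itv.
Qed.

(** On frequencies in a compact subset of (0, oo) psi is bounded, and |z| <= 1 + |z|^2
makes a square-integrable function of bounded support integrable. *)
Lemma cintegrable_cutoff f (a b : R) : 0 < a -> a <= b -> L2 (leb1 R) f ->
  (forall xi, ~~ (a <= `|xi| <= b) -> f xi = 0) ->
  cintegrable (leb1 R) (fun xi => (psi `|xi|)%:C * f xi).
Proof.
move=> a0 ab [mf]; rewrite L2norm_lty => finf f0.
have [M M0 hM] := psi_bounded a0 ab.
have mpsi : measurable_fun setT (fun xi : R => psi `|xi|).
  by apply: measurable_comp_norm; exact: measurable_psi.
have mc := measurable_sqmod mf.
have jc : mu.-integrable setT (EFin \o (fun x => sqmod (f x))).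
  apply/integrableP; split; first exact/measurable_EFinP.
  rewrite (_ : (\int[mu]_x _)%E = L2sq (leb1 R) f)//.
  by apply: eq_integral => x _; rewrite /= ger0_norm// sqmod_ge0.
have j1 : mu.-integrable setT (EFin \o (\1_(`[- b, b]%classic) : R -> R)).
  exact: (integrable_indic_itv _ _ true false).
pose G x := M * (\1_(`[- b, b]%classic) x + sqmod (f x)).
have jG : mu.-integrable setT (EFin \o G).
  apply: (@integrable_mul_bounded _ (cst M) (fun x => \1_(`[- b, b]%classic) x + sqmod (f x)) M) => //.
    exact: (integrableD measurableT j1 jc).
  by move=> x; rewrite /= ger0_norm.
have bd (h : R -> R) : measurable_fun setT h -> (forall x, h x ^+ 2 <= sqmod (f x)) ->
    mu.-integrable setT (EFin \o (fun x => psi `|x| * h x)).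
  move=> mh hh; apply: le_integrable jG => //.
    by apply/measurable_EFinP; exact: measurable_funM.
  move=> x _; rewrite /= lee_fin normrM.
  apply: le_trans (ler_norm _).
  have [xI|xI] := boolP (a <= `|x| <= b).
    apply: ler_pM => //; first exact: hM.
    rewrite indicE mem_set; last first.
      by rewrite /= in_itv/=; case/andP: xI => _; rewrite ler_norml.
    apply: le_trans (_ : 1 + h x ^+ 2 <= _); last by rewrite lerD2l.
    have := sqr_ge0 (`|h x| - 1); rewrite sqrrB1 real_normK ?num_real//.
    by have := normr_ge0 (h x); have := sqr_ge0 (h x); lra.
  have := hh x; rewrite f0// sqmod0 => h0.
  have -> : h x = 0 by apply/eqP; rewrite -sqrf_eq0 eq_le h0 sqr_ge0.
  by rewrite normr0 mulr0 mulr_ge0// addr_ge0 ?sqmod_ge0// indicE ler0n.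
case: mf => m1 m2; split.
- rewrite (_ : (fun xi => _) = EFin \o (fun x => psi `|x| * complex.Re (f x))).
    by apply: bd => // x; rewrite lerDl sqr_ge0.
  by apply/funext => x /=; case: (f x) => p q /=; rewrite mul0r subr0.
- rewrite (_ : (fun xi => _) = EFin \o (fun x => psi `|x| * complex.Im (f x))).
    by apply: bd => // x; rewrite lerDr sqr_ge0.
  by apply/funext => x /=; case: (f x) => p q /=; rewrite mul0r addr0.
Qed.

(** The domain condition that S f be square integrable is a consequence of the
energy identity. *)
Lemma S_domain_energy f (C : R) : L2 (leb1 R) f ->
  cintegrable (leb1 R) (fun xi => (psi `|xi|)%:C * f xi) -> 0 <= C ->
  (forall r, 0 < r -> psi r ^+ 2 * mass f r <= C * `|derive1 phi r| * mass f r) ->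
  S_domain w psi phi f /\ L2sq (leb2 R) (S f) = ((2 * pi)%:E * energy f)%E.
Proof.
move=> hf jf C0 hC; have [mf] := hf; rewrite L2norm_lty => finf.
have E : L2sq (leb2 R) (S f) = ((2 * pi)%:E * energy f)%E.
  exact: (energy_identity hw hFw hphi mf jf C0 hC finf).
split => //; split => //; split; first exact: cmeasurable_S_formula.
rewrite L2norm_lty E.
have W0 := weightL1_gt0 hw hFw.
have en : (energy f <= (2 * W * C)%:E * L2sq (leb1 R) f)%E.
  apply: energy_le_L2sq => //; first by rewrite !mulr_ge0// ltW.
  move=> r r0; rewrite /energy_density halfE//.
  apply: (@le_trans _ _ (2 * W * (ratio psi phi r * mass f r))).
    rewrite massE [leRHS]mulrA [leRHS]mulrDr; apply: lerD; apply: ler_wpM2r;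
      rewrite ?divr_ge0 ?sqmod_ge0//; exact: lambda_le.
  rewrite -[leRHS]mulrA; apply: ler_wpM2l; first by apply: mulr_ge0 => //; exact: ltW.
  rewrite /ratio.
  have [->|d0] := eqVneq (derive1 phi r) 0.
    by rewrite normr0 invr0 mulr0 mul0r mulr_ge0// mass_ge0.
  by rewrite mulrAC ler_pdivrMr ?normr_gt0// [leRHS]mulrAC; exact: hC.
have fe : (energy f < +oo)%E.
  apply: le_lt_trans en _; apply: lte_mul_pinfty => //.
  by rewrite lee_fin !mulr_ge0// ltW.
apply: lte_mul_pinfty => //.
by rewrite lee_fin mulr_ge0// pi_ge0.
Qed.

Lemma S_formulaB u v p :
  cintegrable (leb1 R) (fun xi => (psi `|xi|)%:C * u xi) ->
  cintegrable (leb1 R) (fun xi => (psi `|xi|)%:C * v xi) ->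
  S (fun xi => u xi - v xi) p = S u p - S v p.
Proof.
move=> ju jv; case: p => x t.
have [u1 u2] := cintegrable_integrand hphi ju x t.
have [v1 v2] := cintegrable_integrand hphi jv x t.
rewrite /S_formula -mulrBr; congr (_ * _).
have -> : (fun xi => expi (x * xi) * (psi `|xi|)%:C * expi (t * phi `|xi|) * (u xi - v xi)) =
  (fun xi => expi (x * xi) * (psi `|xi|)%:C * expi (t * phi `|xi|) * u xi -
             expi (x * xi) * (psi `|xi|)%:C * expi (t * phi `|xi|) * v xi).
  by apply/funext => xi; rewrite mulrBr.
move: u1 u2 v1 v2.
set h := fun xi => _ * u xi; set k := fun xi => _ * v xi => u1 u2 v1 v2.
rewrite /cintegral; apply/eqP; rewrite eq_complex /=; apply/andP; split; apply/eqP.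
- rewrite -RintegralB//; apply: eq_Rintegral => xi _.
  by rewrite -/(h xi) -/(k xi); case: (h xi) (k xi) => ? ? [].
- rewrite -RintegralB//; apply: eq_Rintegral => xi _.
  by rewrite -/(h xi) -/(k xi); case: (h xi) (k xi) => ? ? [].
Qed.
End operator.

(** * Extending the energy identity to the closure *)

(** Write f = g + (f - g). *)
Lemma L2sq_perturb d (T : measurableType d) (R : realType)
    (mu : {measure set T -> \bar R}) (e : R) (f g : T -> R[i]) :
  0 < e -> cmeasurable f -> cmeasurable g ->
  (L2sq mu f <= (1 + e)%:E * L2sq mu g + (1 + e^-1)%:E * L2sq mu (fun x => g x - f x)%R)%E.
Proof.
move=> e0 mf mg; rewrite (L2sqB mu g f).
have := L2sqD_le mu e0 mg (cmeasurableB mf mg); congr (_ <= _)%E.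
by apply: eq_integral => x _; rewrite addrC subrK.
Qed.

Lemma near_geometric (R : realType) (c e : R) : 0 < e -> \forall n \near \oo, c / 4 ^+ n <= e.
Proof.
move=> e0.
have h : (fun n => c / 4 ^+ n) @ \oo --> (0 : R).
  rewrite -(mulr0 c); apply: cvgMr; under eq_fun do rewrite -exprVn.
  by apply: cvg_expr; rewrite ger0_norm// ?invr_ge0// invf_lt1// ltr1n.
move/cvgrPdist_le : h => /(_ e e0) [N _ hN]; exists N => // n Nn.
by have := hN n Nn; rewrite sub0r normrN => /(le_trans (ler_norm _)).
Qed.

Lemma EFin_comb_le (R : realDomainType) (x a y b : R) (X : \bar R) : 0 <= y ->
  (X <= b%:E -> x%:E * a%:E + y%:E * X <= (x * a + y * b)%:E)%E.
Proof.
by move=> y0 Xb; rewrite EFinD !EFinM; apply: leeD => //; apply: lee_wpmul2l => //; rewrite lee_fin.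
Qed.

Lemma eventually_and (P Q : nat -> Prop) : (\forall n \near \oo, P n) ->
  (\forall n \near \oo, Q n) -> exists n, P n /\ Q n.
Proof.
move=> [N _ hN] [M _ hM]; exists (maxn N M).
by split; [apply: hN; exact: leq_maxl|apply: hM; exact: leq_maxr].
Qed.

Section operator.
Context {R : realType}.
Local Notation mu := (@lebesgue_measure R).
Variables (w Fw psi phi : R -> R).
Hypothesis hw : weight_assumption w.
Hypothesis hFw : Fw_assumption w Fw.
Hypothesis hpsi : smoothing_assumption psi.
Hypothesis hphi : dispersion_assumption phi.
Local Notation W := (weightL1 w).
Local Notation lamS := (lambda_star w Fw psi phi).
Local Notation energy := (total_energy w Fw psi phi).
Local Notation S := (S_formula w psi phi).
Implicit Types f g u v : R -> R[i].
Variable L : R.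
Hypothesis hL : lamS = L%:E.

Let L0 : 0 <= L.
Proof. by rewrite -lee_fin -hL; exact: lambda_star_ge0. Qed.

Lemma S_domain_bounded u : L2 (leb1 R) u ->
  cintegrable (leb1 R) (fun xi => (psi `|xi|)%:C * u xi) ->
  S_domain w psi phi u /\ L2sq (leb2 R) (S u) = ((2 * pi)%:E * energy u)%E.
Proof.
move=> hu ju; have W0 := weightL1_gt0 hw hFw.
apply: (@S_domain_energy _ _ _ _ _ hw hFw hpsi hphi u (L / W)) => //.
  by rewrite divr_ge0// ltW.
by move=> r r0; rewrite ler_wpM2r ?mass_ge0//; exact: (psi_sqr_le hw hFw hpsi hphi hL).
Qed.

Lemma energy_perturb (e : R) f g : 0 < e -> cmeasurable f -> cmeasurable g ->
  (energy f <= (1 + e)%:E * energy g + (1 + e^-1)%:E * (L%:E * L2sq (leb1 R) (fun x => g x - f x)%R))%E.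
Proof.
move=> e0 mf mg; rewrite (L2sqB (leb1 R) g f).
apply: (@le_trans _ _ ((1 + e)%:E * energy g + (1 + e^-1)%:E * energy (fun x => f x - g x)%R)%E).
  have := energyD_le hw hFw hpsi hphi e0 mg (cmeasurableB mf mg); congr (_ <= _)%E.
  by congr (energy _); apply/funext => x; rewrite addrC subrK.
apply: leeD => //; apply: lee_wpmul2l; first by rewrite lee_fin addr_ge0// invr_ge0 ltW.
exact: (energy_le_star hw hFw hpsi hphi hL (cmeasurableB mf mg)).
Qed.

Lemma energy_lty f : L2 (leb1 R) f -> (energy f < +oo)%E.
Proof.
move=> [mf]; rewrite L2norm_lty => ff.
apply: le_lt_trans (energy_le_star hw hFw hpsi hphi hL mf) _.
by apply: lte_mul_pinfty => //; rewrite lee_fin.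
Qed.

(** With S u_n close to g and u_n close to f, two perturbations with parameter d
compare the squared norm of g to the energy of f, in both directions. *)
Theorem S_op_energy f (g : R * R -> R[i]) : S_op w psi phi f g -> L2sq (leb2 R) g = ((2 * pi)%:E * energy f)%E.
Proof.
move=> [hf hg [u hu [cu cS]]].
have [mf ff] := hf; have [mg fg] := hg; rewrite !L2norm_lty in ff fg.
have finE (T := R) (x : \bar R) : (0 <= x)%E -> (x < +oo)%E -> x = (fine x)%:E.
  by move=> x0 xoo; rewrite fineK// ge0_fin_numE.
set A := fine (L2sq (leb2 R) g); set b := fine (energy f).
have EA : L2sq (leb2 R) g = A%:E by apply: finE => //; exact: L2sq_ge0.
have Eb : energy f = b%:E by apply: finE; [exact: energy_ge0|exact: energy_lty].
have A0 : 0 <= A by rewrite -lee_fin -EA L2sq_ge0.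
have b0 : 0 <= b by rewrite -lee_fin -Eb energy_ge0.
have p0 : 0 < 2 * pi :> R by rewrite mulr_gt0// pi_gt0.
have step d e : 0 < d -> 0 < e -> exists s : R,
    [/\ A <= (1 + d) * s + (1 + d^-1) * e, s <= (1 + d) * (2 * pi * b) + (1 + d^-1) * e,
      2 * pi * b <= (1 + d) * s + (1 + d^-1) * e & s <= (1 + d) * A + (1 + d^-1) * e].
  move=> d0 e0; pose K := 1 + 2 * pi * L.
  have K0 : 0 < K by rewrite ltr_pwDl// mulr_ge0// ltW.
  have [n [h1 h2]] := eventually_and ((L2norm_cvg0 _ _).1 cu (e / K) (divr_gt0 e0 K0))
    ((L2norm_cvg0 _ _).1 cS e e0).
  have [hun jun [mSu]] := hu n; rewrite L2norm_lty => fSu.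
  have [mu_ _] := hun.
  have [_ ES] := S_domain_bounded hun jun.
  set s := fine (L2sq (leb2 R) (S (u n))).
  set c := fine (energy (u n)).
  have Es : L2sq (leb2 R) (S (u n)) = s%:E by apply: finE => //; exact: L2sq_ge0.
  have Ec : energy (u n) = c%:E by apply: finE; [exact: energy_ge0|exact: energy_lty].
  have sc : s = 2 * pi * c by move: ES; rewrite Es Ec -EFinM => -[].
  have d1 : 0 <= 1 + d by rewrite addr_ge0// ltW.
  have d2 : 0 <= 1 + d^-1 by rewrite addr_ge0// invr_ge0 ltW.
  have Le : 2 * pi * (L * (e / K)) <= e.
    rewrite (_ : 2 * pi * (L * (e / K)) = e * ((2 * pi * L) / K)); last by ring.
    by rewrite ler_piMr ?(ltW e0)// ler_pdivrMr// mul1r lerDr.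
  have eS : (energy f <= ((1 + d) * c + (1 + d^-1) * (L * (e / K)))%:E)%E.
    apply: le_trans (energy_perturb d0 mf mu_) _; rewrite Ec; apply: EFin_comb_le => //.
    by rewrite [leRHS]EFinM; apply: lee_wpmul2l; rewrite ?lee_fin.
  have eS' : (energy (u n) <= ((1 + d) * b + (1 + d^-1) * (L * (e / K)))%:E)%E.
    apply: le_trans (energy_perturb d0 mu_ mf) _; rewrite Eb; apply: EFin_comb_le => //.
    by rewrite [leRHS]EFinM; apply: lee_wpmul2l; rewrite ?lee_fin// L2sqB.
  have gS : (L2sq (leb2 R) g <= ((1 + d) * s + (1 + d^-1) * e)%:E)%E.
    apply: le_trans (L2sq_perturb (leb2 R) d0 mg mSu) _; rewrite Es.
    exact: EFin_comb_le.
  have gS' : (L2sq (leb2 R) (S (u n)) <= ((1 + d) * A + (1 + d^-1) * e)%:E)%E.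
    apply: le_trans (L2sq_perturb (leb2 R) d0 mSu mg) _; rewrite EA.
    by apply: EFin_comb_le => //; rewrite L2sqB.
  have L2' := ler_wpM2l d2 Le.
  move: eS eS' gS gS'; rewrite Eb Ec EA Es !lee_fin => q1 q2 q3 q4.
  exists s; split=> //.
    rewrite sc; apply: le_trans (ler_wpM2l (ltW p0) q2) _.
    by rewrite mulrDr; apply: lerD; [rewrite mulrCA|rewrite mulrCA].
  apply: le_trans (ler_wpM2l (ltW p0) q1) _.
  by rewrite sc mulrDr; apply: lerD; [rewrite mulrCA|rewrite mulrCA].
rewrite EA Eb -EFinM; congr EFin; apply/eqP; rewrite eq_le; apply/andP; split.
  apply: le_two_step_approx => [|d e d0 e0]; first by rewrite mulr_ge0// ltW.
  have [s [h1 h2 _ _]] := step d e d0 e0.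
  apply: le_trans h1 _; rewrite lerD2r; apply: ler_wpM2l => //.
  by rewrite addr_ge0// ltW.
apply: le_two_step_approx => // d e d0 e0.
have [s [_ _ h1 h2]] := step d e d0 e0.
apply: le_trans h1 _; rewrite lerD2r; apply: ler_wpM2l => //.
by rewrite addr_ge0// ltW.
Qed.

(** These sets of frequencies stay away from 0 and from infinity, where psi may be
unbounded. *)
Let cut (n : nat) : set R := `[n.+1%:R^-1, n.+1%:R]%classic.
Let trunc f n : R -> R[i] := fun xi => (\1_(cut n) `|xi|)%:C * f xi.

Let sqmod_trunc f n xi : sqmod (trunc f n xi - f xi) = (1 - \1_(cut n) `|xi|) * sqmod (f xi).
Proof.
rewrite /trunc indicE; case: (_ \in _) => /=; first by rewrite mul1r !subrr sqmod0 mul0r.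
by rewrite mul0r sub0r sqmodN subr0 mul1r.
Qed.

Let mcut n : measurable_fun setT (fun xi : R => \1_(cut n) `|xi| : R).
Proof.
apply: (@measurableT_comp _ _ _ _ _ _ (\1_(cut n) : R -> R)) => //.
by apply: measurable_indic; exact: measurable_itv.
Qed.

Let cmeasurable_trunc f n : cmeasurable f -> cmeasurable (trunc f n).
Proof. by move=> mf; apply: cmeasurable_realM. Qed.

Let L2_trunc f n : L2 (leb1 R) f -> L2 (leb1 R) (trunc f n).
Proof.
move=> [mf ff]; split; first exact: cmeasurable_trunc.
rewrite !L2norm_lty in ff *; apply: le_lt_trans ff; apply: ge0_le_integral => //.
- by move=> x _; rewrite lee_fin sqmod_ge0.
- by apply/measurable_EFinP; apply: measurable_sqmod; exact: cmeasurable_trunc.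
- by apply/measurable_EFinP; exact: measurable_sqmod.
move=> x _; rewrite lee_fin /trunc indicE; case: (_ \in _) => /=; first by rewrite mul1r.
by rewrite mul0r sqmod0 sqmod_ge0.
Qed.

Let S_domain_trunc f n : L2 (leb1 R) f -> S_domain w psi phi (trunc f n).
Proof.
move=> hf; have hu := L2_trunc n hf.
apply: (S_domain_bounded hu _).1.
apply: (@cintegrable_cutoff _ _ hpsi _ n.+1%:R^-1 n.+1%:R) => //.
  by rewrite (@le_trans _ _ 1)// ?invf_le1// ?ler1n.
move=> xi h; rewrite /trunc indicE memNset ?mul0r//.
by rewrite /cut /= in_itv/=; exact/negP.
Qed.

Let L2sq_trunc_cvg f : L2 (leb1 R) f ->
  (fun n => L2sq (leb1 R) (fun xi => trunc f n xi - f xi)) @ \oo --> 0%E.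
Proof.
move=> [mf ff]; rewrite L2norm_lty in ff.
have mc : measurable_fun setT (fun x => (sqmod (f x))%:E) by apply/measurable_EFinP; exact: measurable_sqmod.
have jc : mu.-integrable setT (fun x => (sqmod (f x))%:E).
  apply/integrableP; split => //.
  rewrite (_ : (\int[mu]_x _)%E = L2sq (leb1 R) f)//.
  by apply: eq_integral => x _; rewrite /= ger0_norm// sqmod_ge0.
have := @dominated_convergence _ (measurableTypeR R) R mu setT measurableT
  (fun n x => (sqmod (trunc f n x - f x))%:E) (fun=> 0%E) (fun x => (sqmod (f x))%:E).
case=> //.
- move=> n; apply/measurable_EFinP; apply: measurable_sqmod.
  by apply: cmeasurableB => //; exact: cmeasurable_trunc.
- exists [set 0]; split; [exact: measurable_set1|exact: lebesgue_measure_set1|].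
  move=> x /= h; apply: contrapT => x0; apply: h => _.
  apply: cvg_near_cst.
  have x1 : 0 < `|x| by rewrite normr_gt0; exact/eqP.
  have [N1 hN1] : exists N, forall n, (N <= n)%N -> n.+1%:R^-1 <= `|x|.
    exists (Num.trunc (`|x|^-1)) => n Nn; rewrite invf_ple ?posrE//.
    apply/ltW; apply: lt_le_trans (truncnS_gt _) _; by rewrite ler_nat ltnS.
  exists (maxn N1 (Num.trunc `|x|)) => // n /=; rewrite geq_max => /andP[h1 h2].
  rewrite sqmod_trunc indicE mem_set ?subrr ?mul0r//.
  rewrite /cut /= in_itv/= hN1//=; apply/ltW; apply: lt_le_trans (truncnS_gt _) _.
  by rewrite ler_nat ltnS.
- exists set0; split => // x /= h; apply: h => n _.
  rewrite lee_fin ger0_norm ?sqmod_ge0// sqmod_trunc ler_piMl ?sqmod_ge0// gerBl indicE ler0n//.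
by move=> _ _ h; rewrite integral0 in h.
Qed.

(** Truncations of f converge to f; a subsequence converges so fast that its images,
whose distances are governed by the energy, meet the hypothesis of the
completeness lemma. *)
Theorem S_op_exists f : L2 (leb1 R) f -> exists g : R * R -> R[i], S_op w psi phi f g.
Proof.
move=> hf; have [mf ff] := hf.
pose K := 1 + 2 * pi * L.
have p0 : 0 < 2 * pi :> R by rewrite mulr_gt0// pi_gt0.
have K1 : 1 <= K by rewrite lerDl mulr_ge0// ltW.
have K0 : 0 < K by exact: lt_le_trans K1.
(* The increments required by [fast_complex_L2_limit]; dividing by 4 K leaves
   room for the two triangle inequalities and for the factor 2 pi L of the
   energy bound. *)
pose q (n : nat) : R := (4 ^+ n)^-1 * (1 / (2 ^ n.+1)%:R).
have q0 n : 0 < q n by rewrite mulr_gt0// ?invr_gt0 ?exprn_gt0// divr_gt0// ltr0n expn_gt0.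
have qS n : q n.+1 <= q n.
  apply: ler_pM; rewrite ?invr_ge0 ?exprn_ge0//.
  - by rewrite lef_pV2 ?posrE ?exprn_gt0// ler_eXn2l// ltr1n.
  - by rewrite !div1r lef_pV2 ?posrE ?ltr0n ?expn_gt0// ler_nat leq_exp2l.
have /choice[k hk] : forall n, exists k,
    (L2sq (leb1 R) (fun xi => trunc f k xi - f xi)%R <= (q n / (4 * K))%:E)%E.
  move=> n; have e0 : 0 < q n / (4 * K) by rewrite divr_gt0// mulr_gt0.
  have /fine_cvgP[[N1 _ fN] /cvgrPdist_le /(_ _ e0) [N _ hN]] := L2sq_trunc_cvg hf.
  exists (maxn N1 N).
  have F := fN _ (leq_maxl N1 N); rewrite -(fineK F) lee_fin.
  have := hN _ (leq_maxr N1 N); rewrite /= sub0r normrN; exact: le_trans (ler_norm _).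
pose v n := trunc f (k n).
have hv n : S_domain w psi phi (v n) by exact: S_domain_trunc.
have mv n : cmeasurable (v n) by exact: cmeasurable_trunc.
have mSv n : @cmeasurable _ (measurableTypeR R * measurableTypeR R)%type R (S (v n)) by case: (hv n) => _ _ [].
have [l ml hl] : exists2 l : R * R -> R[i], @cmeasurable _ (measurableTypeR R * measurableTypeR R)%type R l &
    forall n, (L2sq (leb2 R) (fun x => l x - S (v n) x)%R <= (8 / 4 ^+ n)%:E)%E.
  apply: (@fast_complex_L2_limit _ _ R (leb2 R) (fun n => S (v n)) mSv) => n.
  have [h1 j1 _] := hv n.+1; have [h0 j0 _] := hv n.
  rewrite (_ : (fun p => _) = S (fun xi => v n.+1 xi - v n xi)); last first.
    by apply/funext => p; rewrite S_formulaB.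
  have hB : (L2sq (leb1 R) (fun xi => v n.+1 xi - v n xi)%R <= (q n / K)%:E)%E.
    have := L2sqD_le (leb1 R) ltr01 (cmeasurableB (mv n.+1) mf) (cmeasurableB mf (mv n)).
    rewrite invr1 (_ : (fun x => _) = (fun xi => v n.+1 xi - v n xi)); last first.
      by apply/funext => x; rewrite addrA subrK.
    move/le_trans; apply; rewrite (L2sqB (leb1 R) f).
    have two : (0 <= (1 + 1 : R)%:E)%E by rewrite lee_fin.
    apply: le_trans (leeD (lee_wpmul2l two (hk n.+1)) (lee_wpmul2l two (hk n))) _.
    rewrite -!EFinM -EFinD lee_fin.
    have : q n.+1 / (4 * K) <= q n / (4 * K).
      by apply: ler_wpM2r => //; rewrite invr_ge0 mulr_ge0// ltW.
    rewrite (_ : q n / K = 4 * (q n / (4 * K))); last by field; rewrite lt0r_neq0.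
    lra.
  have fB : (L2sq (leb1 R) (fun xi => v n.+1 xi - v n xi)%R < +oo)%E by exact: le_lt_trans hB (ltry _).
  have mB := cmeasurableB (mv n.+1) (mv n).
  have jB : cintegrable (leb1 R) (fun xi => (psi `|xi|)%:C * (v n.+1 xi - v n xi)).
    rewrite (_ : (fun xi => _) = (fun xi => (psi `|xi|)%:C * v n.+1 xi - (psi `|xi|)%:C * v n xi)); last first.
      by apply/funext => x; rewrite mulrBr.
    case: j1 => a1 a2; case: j0 => b1 b2; split.
    - rewrite (_ : (fun xi => _) = (fun xi => (complex.Re ((psi `|xi|)%:C * v n.+1 xi))%:E -
        (complex.Re ((psi `|xi|)%:C * v n xi))%:E)%E); first exact: (integrableB measurableT a1 b1).
      by apply/funext => x; rewrite -EFinB; case: (_ * v n.+1 x) (_ * v n x) => ? ? [].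
    - rewrite (_ : (fun xi => _) = (fun xi => (complex.Im ((psi `|xi|)%:C * v n.+1 xi))%:E -
        (complex.Im ((psi `|xi|)%:C * v n xi))%:E)%E); first exact: (integrableB measurableT a2 b2).
      by apply/funext => x; rewrite -EFinB; case: (_ * v n.+1 x) (_ * v n x) => ? ? [].
  have hd : L2 (leb1 R) (fun xi => v n.+1 xi - v n xi) by split => //; rewrite L2norm_lty.
  have [_ ->] := S_domain_bounded hd jB.
  have pE : (0 <= (2 * pi : R)%:E)%E by rewrite lee_fin ltW.
  have LE : (0 <= L%:E)%E by rewrite lee_fin.
  apply: le_trans (lee_wpmul2l pE (le_trans (energy_le_star hw hFw hpsi hphi hL mB) (lee_wpmul2l LE hB))) _.
  rewrite -!EFinM lee_fin -/(q n).
  rewrite (_ : 2 * pi * _ = q n * ((2 * pi * L) / K)); last by ring.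
  by rewrite ler_piMr ?(ltW (q0 n))// ler_pdivrMr// mul1r lerDr.
exists l; split => //.
  split => //; rewrite L2norm_lty.
  have [_ _ [_]] := hv 0; rewrite L2norm_lty => f0.
  apply: le_lt_trans (L2sq_perturb (leb2 R) ltr01 ml (mSv 0)) _.
  rewrite L2sqB; apply: lte_add_pinfty; apply: lte_mul_pinfty => //.
  exact: le_lt_trans (hl 0) (ltry _).
exists v => //; split; apply/L2norm_cvg0 => e e0.
  have [N _ hN] := near_geometric 1 e0; exists N => // n Nn /=.
  apply: le_trans (hk n) _; rewrite lee_fin; apply: le_trans (hN n Nn).
  have K4 : 1 <= 4 * K by lra.
  have h1 : q n / (4 * K) <= q n.
    by rewrite ler_pdivrMr ?(lt_le_trans ltr01)// ler_peMr// ltW.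
  apply: le_trans h1 _; rewrite /q !mul1r ler_piMr ?invr_ge0 ?exprn_ge0//.
  by rewrite invf_le1 ?ler1n ?ltr0n expn_gt0.
have [N _ hN] := near_geometric 8 e0; exists N => // n Nn /=.
by rewrite L2sqB; apply: le_trans (hl n) _; rewrite lee_fin; exact: hN.
Qed.
End operator.

(** * The operator norm *)

Lemma ae_imp d (T : measurableType d) (R : realType) (mu : {measure set T -> \bar R})
    (P Q : T -> Prop) : (forall x, P x -> Q x) -> {ae mu, forall x, P x} -> {ae mu, forall x, Q x}.
Proof. by move=> PQ; apply: filterS. Qed.

Lemma ae_and d (T : measurableType d) (R : realType) (mu : {measure set T -> \bar R})
    (P Q : T -> Prop) : {ae mu, forall x, P x} -> {ae mu, forall x, Q x} ->
  {ae mu, forall x, P x /\ Q x}.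
Proof. by move=> hP hQ; near=> x; split; near: x. Unshelve. all: by end_near. Qed.

Section bump.
Context {R : realType}.
Local Notation mu := (@lebesgue_measure R).
Local Notation D := (`]0%R, +oo[%classic : set R).
Implicit Types (k : 'I_2) (A : set R).

(** For real a, an even (k = 0) or odd (k = 1) function of constant modulus |a| on the
set of frequencies with |xi| in A: it lives entirely in the k-th component. *)
Definition bump k (a : R) A : R -> R[i] := fun xi =>
  (a * ((if k == 0 then 1 else Num.sg xi) * \1_A `|xi|))%:C.

Lemma bump_pos k a A r : 0 < r -> bump k a A r = (a * \1_A r)%:C.
Proof. by move=> r0; rewrite /bump (gtr0_norm r0) (gtr0_sg r0) if_same mul1r. Qed.

Lemma bump_neg k a A r : 0 < r ->
  bump k a A (- r) = (a * ((if k == 0 then 1 else -1) * \1_A r))%:C.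
Proof. by move=> r0; rewrite /bump normrN (gtr0_norm r0) sgrN (gtr0_sg r0). Qed.

Lemma sqmod_real (x : R) : sqmod (x%:C) = x ^+ 2.
Proof. by rewrite /sqmod /= expr0n addr0. Qed.

Lemma indic_sqr A (r : R) : \1_A r ^+ 2 = \1_A r :> R.
Proof. by rewrite indicE; case: (_ \in _); rewrite ?expr1n ?expr0n. Qed.

Lemma mass_bump k a A r : 0 < r -> mass (bump k a A) r = 2 * a ^+ 2 * \1_A r.
Proof.
move=> r0; rewrite /mass bump_pos// bump_neg// !sqmod_real !exprMn indic_sqr.
by case: ifP => _; rewrite ?sqrrN !expr1n; ring.
Qed.

Lemma bump_sumdiff k a A r : 0 < r ->
  bump k a A r + bump k a A (- r) = (if k == 0 then 2 * a * \1_A r else 0)%:C /\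
  bump k a A r - bump k a A (- r) = (if k == 0 then 0 else 2 * a * \1_A r)%:C.
Proof.
move=> r0; rewrite bump_pos// bump_neg//; case: ifP => _; split; apply/eqP;
  rewrite eq_complex /= ?addr0 ?subr0 ?eqxx ?andbT ?oppr0; apply/eqP; ring.
Qed.

Lemma measurable_sg : measurable_fun setT (@Num.sg R : measurableTypeR R -> measurableTypeR R).
Proof.
rewrite (_ : Num.sg = (fun x : R => \1_D x - \1_(`]-oo, 0%R[%classic) x)).
  by apply: measurable_funB; exact: measurable_indic.
apply/funext => x; rewrite !indicE; case: sgrP => x0.
- by rewrite !memNset ?subr0//= in_itv/= x0 ltxx.
- rewrite mem_set ?memNset ?subr0//= in_itv/= ?x0//.
  by rewrite ltNge ltW.
- rewrite memNset ?mem_set ?sub0r//= in_itv/= ?x0//.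
  by rewrite andbT ltNge ltW.
Qed.

Lemma cmeasurable_bump k a A : measurable A -> @cmeasurable _ (measurableTypeR R) R (bump k a A).
Proof.
move=> mA; split => /=; last exact: measurable_cst.
apply: measurable_funM => //; apply: measurable_funM.
  by case: (k == 0); [exact: measurable_cst|exact: measurable_sg].
apply: (@measurableT_comp _ _ _ _ _ _ (\1_A : R -> R)) => //; exact: measurable_indic.
Qed.

Lemma L2sq_bump k a A : measurable A -> A `<=` D ->
  L2sq (leb1 R) (bump k a A) = ((2 * a ^+ 2)%:E * mu A)%E.
Proof.
move=> mA AD; rewrite L2sq_mass; last exact: cmeasurable_bump.
rewrite -[A in RHS]setIT -integral_indic//.
have c0 : (0 <= (2 * a ^+ 2)%:E)%E by rewrite lee_fin mulr_ge0// sqr_ge0.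
have mI : measurable_fun setT (fun r : R => (\1_A r : R)%:E).
  by apply/measurable_EFinP; exact: measurable_indic.
rewrite -(@ge0_integralZl _ _ R mu setT measurableT _ mI _ _ c0); last first.
  by move=> r _; rewrite lee_fin indicE ler0n.
apply: eq_integral => r _; rewrite -EFinM; congr EFin.
have [r0|r0] := ltP 0 r; first by rewrite halfE// mass_bump.
rewrite half0// indicE memNset ?mulr0// => /AD /=; rewrite in_itv/= andbT; lra.
Qed.
End bump.

Section opnorm.
Context {R : realType}.
Local Notation mu := (@lebesgue_measure R).
Local Notation D := (`]0%R, +oo[%classic : set R).
Variables (w Fw psi phi : R -> R).
Hypothesis hw : weight_assumption w.
Hypothesis hFw : Fw_assumption w Fw.
Hypothesis hpsi : smoothing_assumption psi.
Hypothesis hphi : dispersion_assumption phi.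
Local Notation lam := (lambda w Fw psi phi).
Local Notation lamS := (lambda_star w Fw psi phi).
Local Notation energy := (total_energy w Fw psi phi).
Local Notation S := (S_formula w psi phi).

Lemma energy_bump k (a : R) A : measurable A -> A `<=` D ->
  energy (bump k a A) = (\int[mu]_(r in A) (lam k r * (2 * a ^+ 2))%:E)%E.
Proof.
move=> mA AD; rewrite integral_mkcond; apply: eq_integral => r _.
rewrite patchE; case: ifPn => [/set_mem Ar|rA].
  have r0 : 0 < r by have := AD _ Ar; rewrite /= in_itv/= andbT.
  rewrite /energy_density halfE//; have [-> ->] := bump_sumdiff k a A r0.
  rewrite !sqmod_real indicE mem_set//; congr EFin.
  by rewrite /lambda; case: (k == 0); rewrite ?expr0n/=; move: (weightL1 w + _) (weightL1 w - _) (_ / _) => ? ? ?; field.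
rewrite /energy_density; have [r0|r0] := ltP 0 r; last by rewrite half0.
rewrite halfE//; have [-> ->] := bump_sumdiff k a A r0.
by rewrite !sqmod_real indicE (negbTE rA) mulr0 !if_same expr0n/= mul0r !mulr0 addr0.
Qed.

(** lambda_k and psi^2 / |phi'| are continuous where phi' is nonzero, and phi' is nonzero
where lambda_k is positive by the convention at its zeros. *)
Lemma lambda_gt_interval (c : R) : 0 <= c -> (c%:E < lamS)%E ->
  exists k : 'I_2, exists a : R, exists2 b : R, 0 < a < b &
  exists2 C : R, 0 <= C & forall r, a <= r <= b ->
    c <= lam k r /\ psi r ^+ 2 <= C * `|derive1 phi r|.
Proof.
move=> c0 /lambda_star_gt[k [r r0 cr]].
have d0 : derive1 phi r != 0.
  apply/eqP => d0; move: cr; rewrite lambdaE /ratio d0 normr0 invr0 mulr0 mul0r; lra.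
have H : \forall s \near r, [/\ 0 < s, c < lam k s, ratio psi phi s < ratio psi phi r + 1 &
    0 < `|derive1 phi s| ].
  near=> s; split.
  - by near: s; apply: (@cvgr_gt _ _ _ _ id r) => //; exact: cvg_id.
  - by near: s; apply: (cvgr_gt (lam k r)) => //; exact: lambda_continuous.
  - near: s; apply: (cvgr_lt (ratio psi phi r)); last by rewrite ltrDl.
    exact: ratio_continuous.
  - near: s; apply: (cvgr_gt `|derive1 phi r|); last by rewrite normr_gt0.
    by apply: cvg_norm; case: hphi => _ ? _; exact: dphi_continuous.
move: H => /nbhs_ballP[e /= e0 he].
have P s : r <= s <= r + e / 2 -> ball r e s.
  by move=> /andP[rs se]; rewrite /ball /= distrC ger0_norm ?subr_ge0//; lra.
exists k, r; exists (r + e / 2); first by rewrite r0 ltrDl divr_gt0.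
exists (ratio psi phi r + 1); first by rewrite addr_ge0// ratio_ge0.
move=> s /P /he[s0 cs rs ds]; split; first exact: ltW.
by rewrite -ler_pdivrMr//; exact: ltW.
Unshelve. all: by end_near. Qed.

Lemma S_op_of_domain f : S_domain w psi phi f -> S_op w psi phi f (S f).
Proof.
move=> hf; have [h1 _ h2] := hf; split=> //; exists (fun=> f) => //.
by split; apply/L2norm_cvg0 => e e0; apply: nearW => n;
  rewrite /L2sq; under eq_integral do rewrite subrr sqmod0; rewrite integral0 lee_fin ltW.
Qed.

(** A normalised bump on an interval where lambda_k >= c has energy at least c; the
argument is local, so it also covers lambda^* = +oo. *)
Lemma opnorm_ge (c : R) : 0 <= c -> (c%:E < lamS)%E ->
  ((Num.sqrt (2 * pi * c))%:E <= S_opnorm w psi phi)%E.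
Proof.
move=> c0 /(lambda_gt_interval c0)[k [a [b /andP[a0 ab] [C C0 hC]]]].
have b0 : 0 < b by exact: lt_trans ab.
pose A : set R := `[a, b]%classic.
have mA : measurable A by exact: measurable_itv.
have AD : A `<=` D.
  by move=> r; rewrite /A /= !in_itv/= andbT => /andP[ar _]; exact: lt_le_trans ar.
have muA : mu A = (b - a)%:E by rewrite lebesgue_measure_itv/= lte_fin ab.
have ba0 : 0 < b - a by rewrite subr_gt0.
pose al := Num.sqrt ((2 * (b - a))^-1).
have al2 : al ^+ 2 = (2 * (b - a))^-1 by rewrite sqr_sqrtr// invr_ge0 mulr_ge0// ltW.
pose f := bump k al A.
have mf : @cmeasurable _ (measurableTypeR R) R f by exact: cmeasurable_bump.
have f1 : L2sq (leb1 R) f = 1%E.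
  rewrite L2sq_bump// muA al2 -EFinM; congr EFin; field; rewrite lt0r_neq0//.
have hf : L2 (leb1 R) f by split => //; rewrite L2norm_lty f1 ltry.
have jf : cintegrable (leb1 R) (fun xi => (psi `|xi|)%:C * f xi).
  apply: (cintegrable_cutoff hpsi a0 (ltW ab)) => // xi h.
  by rewrite /f /bump indicE memNset ?mulr0// /A /= in_itv/=; exact/negP.
have hfC r : 0 < r -> psi r ^+ 2 * mass f r <= C * `|derive1 phi r| * mass f r.
  move=> r0; have [rA|rA] := boolP (a <= r <= b).
    by apply: ler_wpM2r; [exact: mass_ge0|case: (hC _ rA)].
  rewrite mass_bump// indicE memNset ?mulr0// /A /= in_itv/=; exact/negP.
have [dom E] := S_domain_energy hw hFw hpsi hphi hf jf C0 hfC.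
apply: (@le_trans _ _ (L2norm (leb2 R) (S f))); last first.
  apply: ereal_sup_ubound; exists f, (S f); split => //; first exact: S_op_of_domain.
  by rewrite L2norm_le// f1 expr1n.
rewrite leNgt; apply/negP => h.
have s0 : 0 <= 2 * pi * c :> R by rewrite !mulr_ge0// pi_ge0.
have F : L2norm (leb2 R) (S f) \is a fin_num.
  by rewrite ge0_fin_numE ?L2norm_ge0// (lt_trans h)// ltry.
have e1 : (c%:E <= energy f)%E.
  rewrite energy_bump//.
  have mI : measurable_fun A (fun r => (lam k r * (2 * al ^+ 2))%:E).
    apply/measurable_EFinP; apply: measurable_funM => //.
    by apply: (measurable_funS _ AD); [exact: measurable_itv|exact: measurable_lambda].
  apply: le_trans (_ : \int[mu]_(r in A) (cst (c * (2 * al ^+ 2))%:E r) <= _)%E.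
    rewrite integral_cst//= [X in (_ * X)%E]muA -EFinM al2 lee_fin.
    by rewrite (_ : c * _ * _ = c)//; field; rewrite lt0r_neq0.
  apply: ge0_le_integral => //.
  - by move=> r _; rewrite lee_fin; apply: mulr_ge0 => //; apply: mulr_ge0 => //; exact: sqr_ge0.
  - move=> r; rewrite /A /= in_itv/= => /hC[cr _]; rewrite lee_fin.
    by apply: ler_wpM2r => //; rewrite mulr_ge0// sqr_ge0.
have h2 : ((2 * pi * c)%:E <= L2norm (leb2 R) (S f) ^+ 2)%E.
  rewrite L2norm_sqr E EFinM; apply: lee_wpmul2l => //.
  by rewrite lee_fin mulr_ge0// pi_ge0.
move: h h2 (L2norm_ge0 (leb2 R) (S f)); rewrite -(fineK F) -EFin_expe !lee_fin lte_fin => h h2 n0.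
have : fine (L2norm (leb2 R) (S f)) ^+ 2 < Num.sqrt (2 * pi * c) ^+ 2.
  by rewrite ltr_pXn2r// nnegrE sqrtr_ge0.
by rewrite sqr_sqrtr// ltNge h2.
Qed.

Lemma S_op0 : S_op w psi phi (fun=> 0) (fun=> 0).
Proof.
have L20 d (T : measurableType d) (m : {measure set T -> \bar R}) : L2 m (fun=> 0 : R[i]).
  split; first by split; exact: measurable_cst.
  by rewrite L2norm_lty /L2sq; under eq_integral do rewrite sqmod0; rewrite integral0 ltry.
have S0 : S (fun=> 0) = (fun=> 0).
  apply/funext => p; rewrite /S_formula (_ : cintegral _ _ = 0) ?mulr0//.
  rewrite (_ : (fun xi => _) = (fun=> 0)); last by apply/funext => xi; rewrite mulr0.
  by rewrite /cintegral /Rintegral /= !integral0.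
have dom : S_domain w psi phi (fun=> 0).
  split; [exact: L20| |by rewrite S0; exact: L20].
  rewrite (_ : (fun xi => _) = (fun=> 0)); last by apply/funext => xi; rewrite mulr0.
  by split; exact: integrable0.
by have := S_op_of_domain dom; rewrite S0.
Qed.

(** The upper bound is the energy identity; the lower bound lets c tend to
lambda^*. *)
Theorem opnorm_sqr : (S_opnorm w psi phi ^+ 2 = (2 * pi)%:E * lamS)%E.
Proof.
have p0 : 0 < 2 * pi :> R by rewrite mulr_gt0// pi_gt0.
have op0 : (0 <= S_opnorm w psi phi)%E.
  apply: ereal_sup_ubound; exists (fun=> 0), (fun=> 0).
  have E d (T : measurableType d) (m : {measure set T -> \bar R}) : L2norm m (fun=> 0 : R[i]) = 0%E.
    by rewrite L2normE /L2sq; under eq_integral do rewrite sqmod0; rewrite integral0 poweR0r// invr_eq0.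
  by split; rewrite ?E//; exact: S_op0.
have := lambda_star_ge0 psi phi hw hFw; have := opnorm_ge.
have := @S_op_energy _ _ _ _ _ hw hFw hpsi hphi.
have := @energy_le_star _ _ _ psi phi hw hFw hpsi hphi.
case: lamS => [L| |]//.
- move=> enle Sen opge; rewrite lee_fin => L0.
  have s0 : 0 <= 2 * pi * L by rewrite mulr_ge0// ltW.
  have ub : (S_opnorm w psi phi <= (Num.sqrt (2 * pi * L))%:E)%E.
    apply: ge_ereal_sup => y [f [g [Sfg f1 ->]]].
    rewrite L2norm_le ?sqrtr_ge0// sqr_sqrtr// (Sen L erefl _ _ Sfg).
    rewrite [leRHS]EFinM; apply: lee_wpmul2l; first by rewrite lee_fin ltW.
    have [[mf _] _ _] := Sfg.
    apply: le_trans (enle _ L erefl mf) _; rewrite -[leRHS]mule1; apply: lee_wpmul2l.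
      by rewrite lee_fin.
    by move: f1; rewrite L2norm_le// expr1n.
  have F : S_opnorm w psi phi \is a fin_num by rewrite ge0_fin_numE// (le_lt_trans ub)// ltry.
  move: op0 ub opge; rewrite -(fineK F); move: (fine _) => o; rewrite !lee_fin => o0 ub opge.
  rewrite -EFin_expe -EFinM; congr EFin; apply/eqP; rewrite eq_le; apply/andP; split.
    by rewrite -(sqr_sqrtr s0) ler_pXn2r// nnegrE// sqrtr_ge0.
  apply/ler_addgt0Pr => e e0.
  have [Le|Le] := ltP (L - e / (2 * pi)) 0.
    apply: (@le_trans _ _ e); last by rewrite lerDr sqr_ge0.
    by move: Le; rewrite subr_lt0 ltr_pdivlMr// mulrC => /ltW.
  have lt : ((L - e / (2 * pi))%:E < L%:E)%E by rewrite lte_fin gtrBl divr_gt0.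
  have := opge _ Le lt; rewrite lee_fin => h.
  have s1 : 0 <= 2 * pi * (L - e / (2 * pi)) by rewrite mulr_ge0// ltW.
  have : 2 * pi * (L - e / (2 * pi)) <= o ^+ 2.
    by rewrite -(sqr_sqrtr s1) ler_pXn2r// nnegrE sqrtr_ge0.
  rewrite mulrBr (_ : 2 * pi * (e / (2 * pi)) = e) ?lerBlDr//.
  by rewrite mulrC divfK// lt0r_neq0.
- move=> _ _ opge _.
  have oo : S_opnorm w psi phi = +oo%E.
    apply/eqyP => A A0; apply: le_trans (opge (A ^+ 2 / (2 * pi)) _ (ltry _)); last first.
      by rewrite divr_ge0// ?sqr_ge0// ltW.
    by rewrite (mulrC (2 * pi)) divfK ?lt0r_neq0// sqrtr_sqr lee_fin ler_norm.
  by rewrite oo gt0_muley// lte_fin.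
Qed.
End opnorm.

(** * Extremisers *)

Section extremisers.
Context {R : realType}.
Local Notation mu := (@lebesgue_measure R).
Local Notation D := (`]0%R, +oo[%classic : set R).
Variables (w Fw psi phi : R -> R).
Hypothesis hw : weight_assumption w.
Hypothesis hFw : Fw_assumption w Fw.
Hypothesis hpsi : smoothing_assumption psi.
Hypothesis hphi : dispersion_assumption phi.
Local Notation lam := (lambda w Fw psi phi).
Local Notation lamS := (lambda_star w Fw psi phi).
Local Notation energy := (total_energy w Fw psi phi).
Local Notation E_ := (E_set w Fw psi phi).
Implicit Types f : R -> R[i].

Lemma ae_reflect (P : R -> Prop) : {ae (leb1 R), forall x, P x} -> {ae (leb1 R), forall x : R, P (- x)}.
Proof.
move=> [N [mN N0 sN]].
have mO : measurable_fun setT (-%R : measurableTypeR R -> measurableTypeR R) by exact: oppr_measurable.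
exists (-%R @^-1` N); split.
- by rewrite -[X in measurable X]setTI; exact: mO.
- by transitivity (mu N); [exact: lebesgue_measureN mN|exact: N0].
- by move=> x h; apply: sN => /= hP; exact: h.
Qed.

Definition ae_half (P : R -> Prop) := {ae (leb1 R), forall r, 0 < r -> P r}.

Lemma ae_integral_half_eq0 (h : R -> R) : measurable_fun setT (half h) ->
  (forall r, 0 < r -> 0 <= h r) ->
  (\int[mu]_r (half h r)%:E = 0)%E <-> ae_half (fun r => h r = 0).
Proof.
move=> mh h0.
have hh0 r : 0 <= half h r.
  by have [r0|r0] := ltP 0 r; [rewrite halfE// h0|rewrite half0].
rewrite (_ : (\int[mu]_r (half h r)%:E)%E = (\int[leb1 R]_r `|(half h r)%:E|)%E); last first.
  by apply: eq_integral => r _; rewrite gee0_abs// lee_fin.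
have mE : measurable_fun [set: measurableTypeR R] (fun r => (half h r)%:E) by exact/measurable_EFinP.
split.
- move/(ae_eq_integral_abs (leb1 R) measurableT mE); apply: ae_imp => r hr r0.
  by have /= := hr I; rewrite halfE// => -[].
- move=> hae; apply/(ae_eq_integral_abs (leb1 R) measurableT mE).
  move: hae; apply: ae_imp => r hr _ /=; have [r0|r0] := ltP 0 r; last by rewrite half0.
  by rewrite halfE// hr.
Qed.

Lemma L2sq_eq0_half f : cmeasurable f ->
  L2sq (leb1 R) f = 0%E <-> ae_half (fun r => f r = 0 /\ f (- r) = 0).
Proof.
move=> mf; rewrite L2sq_mass//.
have mm : measurable_fun setT (half (mass f)) by apply: measurable_half; exact: measurable_mass.
have [h1 h2] := ae_integral_half_eq0 mm (fun r _ => mass_ge0 f r); split.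
- move/h1; apply: ae_imp => r /[apply] /eqP.
  rewrite paddr_eq0 ?sqmod_ge0// => /andP[/eqP a /eqP b].
  by split; exact: sqmod_eq0.
- move=> H; apply: h2; move: H; apply: ae_imp => r /[apply] -[a b].
  by rewrite /mass a b sqmod0 addr0.
Qed.

(** Even part carried by E_0, odd part carried by E_1, expressed through f itself. *)
Let concentrated f := ae_half (fun r =>
  (~ E_ 0 r -> f r + f (- r) = 0) /\ (~ E_ 1 r -> f r - f (- r) = 0)).

Lemma addr_subr_eq0 (p q : R[i]) : p + q = 0 -> p - q = 0 -> p = 0 /\ q = 0.
Proof.
case: p q => a b [c d] /eqP + /eqP; rewrite !eq_complex /= => /andP[/eqP h1 /eqP h2] /andP[/eqP h3 /eqP h4].
by split; apply/eqP; rewrite eq_complex /=; apply/andP; split; apply/eqP; lra.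
Qed.

(** lambda^* ||f||^2 minus the energy is the integral of the nonnegative function
(lambda^* - lambda_0) |f(r) + f(-r)|^2 / 2 + (lambda^* - lambda_1) |f(r) - f(-r)|^2 / 2,
which vanishes almost everywhere exactly when f is concentrated. *)
Lemma energy_defect (L : R) f : lamS = L%:E -> L2 (leb1 R) f ->
  energy f = (L%:E * L2sq (leb1 R) f)%E <-> concentrated f.
Proof.
move=> hL hf; have [mf ff] := hf; rewrite L2norm_lty in ff.
have lamL k r : 0 < r -> 0 <= L - lam k r.
  by move=> r0; rewrite subr_ge0 -lee_fin -hL; exact: lambda_le_star.
pose X r := sqmod (f r + f (- r)) / 2; pose Y r := sqmod (f r - f (- r)) / 2.
have X0 r : 0 <= X r by rewrite divr_ge0// sqmod_ge0.
have Y0 r : 0 <= Y r by rewrite divr_ge0// sqmod_ge0.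
pose df r := (L - lam 0 r) * X r + (L - lam 1 r) * Y r.
have df0 r : 0 < r -> 0 <= df r.
  by move=> r0; apply: addr_ge0; apply: mulr_ge0 => //; exact: lamL.
have mdf : measurable_fun setT (half df).
  apply: measurable_half_on; apply: measurable_funD; apply: measurable_funM.
  - by apply: measurable_funB => //; exact: measurable_lambda.
  - apply: (measurable_funS measurableT) => //; apply: measurable_funM => //.
    by apply: measurable_sqmod; apply: cmeasurableD => //; exact: cmeasurable_reflect.
  - by apply: measurable_funB => //; exact: measurable_lambda.
  - apply: (measurable_funS measurableT) => //; apply: measurable_funM => //.
    by apply: measurable_sqmod; apply: cmeasurableB => //; exact: cmeasurable_reflect.
have hdf0 r : 0 <= half df r.
  by have [r0|r0] := ltP 0 r; [rewrite halfE// df0|rewrite half0].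
have L0 : 0 <= L by rewrite -lee_fin -hL; exact: lambda_star_ge0.
have sumE : (energy f + \int[mu]_r (half df r)%:E = L%:E * L2sq (leb1 R) f)%E.
  have md := measurable_dens hFw hpsi hphi mf.
  have md' : measurable_fun setT (fun r => (energy_density w Fw psi phi f r)%:E) by exact/measurable_EFinP.
  have mdf' : measurable_fun setT (fun r => (half df r)%:E) by exact/measurable_EFinP.
  have d0 r : (0 <= (energy_density w Fw psi phi f r)%:E)%E by rewrite lee_fin dens_ge0.
  have e0 r : (0 <= (half df r)%:E)%E by rewrite lee_fin.
  rewrite /total_energy -(@ge0_integralD _ _ R mu setT measurableT _ _ (fun r _ => d0 r) md' (fun r _ => e0 r) mdf').
  rewrite L2sq_mass//.
  have mh : measurable_fun setT (fun r => (half (mass f) r)%:E).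
    by apply/measurable_EFinP; apply: measurable_half; exact: measurable_mass.
  have h0 r : (0 <= (half (mass f) r)%:E)%E by rewrite lee_fin half_ge0// => s; exact: mass_ge0.
  have LE : (0 <= L%:E)%E by rewrite lee_fin.
  rewrite -(@ge0_integralZl _ _ R mu setT measurableT _ mh _ (fun r _ => h0 r) LE).
  apply: eq_integral => r _; rewrite -EFinD -EFinM; congr EFin.
  rewrite /energy_density; have [r0|r0] := ltP 0 r; last by rewrite !half0// addr0 mulr0.
  by rewrite !halfE// massE /df /X /Y; ring.
have en : (energy f < +oo)%E by exact: (energy_lty hw hFw hpsi hphi hL hf).
have F : energy f \is a fin_num by rewrite ge0_fin_numE// energy_ge0.
have [h1 h2] := ae_integral_half_eq0 mdf df0.
apply: (@iff_trans _ (\int[mu]_r (half df r)%:E = 0)%E).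
  rewrite -sumE; split=> [|->]; last by rewrite adde0.
  move: F; case: (energy f) => // e _; case: (\int[mu]_r _)%E => [s| |]//.
  by rewrite -EFinD => -[] h; congr EFin; lra.
apply: (@iff_trans _ (ae_half (fun r => df r = 0))); first by split.
split; apply: ae_imp => r H r0.
- have /eqP := H r0; rewrite paddr_eq0; [|exact: mulr_ge0 (lamL 0 r r0) (X0 r)|exact: mulr_ge0 (lamL 1 r r0) (Y0 r)].
  rewrite !mulf_eq0 ?invr_eq0 !subr_eq0 => /andP[h3 h4].
  have nE k : ~ E_ k r -> L != lam k r.
    by move=> h; apply/eqP => h'; apply: h; split => //; rewrite hL -h'.
  split=> /nE /negPf hk.
    by move: h3; rewrite hk /= (negbTE (lt0r_neq0 (ltr0Sn R 1))) orbF => /eqP /sqmod_eq0.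
  by move: h4; rewrite hk /= (negbTE (lt0r_neq0 (ltr0Sn R 1))) orbF => /eqP /sqmod_eq0.
- have [c0 c1] := H r0; rewrite /df.
  have z (k : 'I_2) (x : R[i]) : (~ E_ k r -> x = 0) -> (L - lam k r) * (sqmod x / 2) = 0.
    move=> hx; have [[_ e]|/hx ->] := pselect (E_ k r); last by rewrite sqmod0 mul0r mulr0.
    by move: e; rewrite hL => -[->]; rewrite subrr mul0r.
  by rewrite /X /Y (z 0)// (z 1)// addr0.
Qed.

(** If lambda^* = +oo both sides say that f = 0: the sets E_k are empty, and a
nonzero f would make the right-hand side of the equality infinite. *)
Theorem S_equality_concentrated f : L2 (leb1 R) f ->
  S_equality w Fw psi phi f <-> concentrated f.
Proof.
move=> hf; have [mf ff] := hf; rewrite L2norm_lty in ff.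
have p0 : 0 < 2 * pi :> R by rewrite mulr_gt0// pi_gt0.
have := lambda_star_ge0 psi phi hw hFw; case hL : lamS => [L| |]// _.
- rewrite -(energy_defect hL hf).
  have F : energy f \is a fin_num.
    by rewrite ge0_fin_numE ?energy_ge0//; exact: (energy_lty hw hFw hpsi hphi hL hf).
  split=> [[g Sfg]|e].
    rewrite !L2norm_sqr hL (S_op_energy hw hFw hpsi hphi hL Sfg) -muleA.
    move: F ff (L2sq_ge0 (leb1 R) f); case: (energy f) => // e _; case: (L2sq (leb1 R) f) => [s| |]// _ _.
    rewrite -!EFinM => -[] /(mulfI (lt0r_neq0 p0)) ->; by [].
  have [g Sfg] := S_op_exists hw hFw hpsi hphi hL hf.
  exists g => //; rewrite !L2norm_sqr hL (S_op_energy hw hFw hpsi hphi hL Sfg) -muleA.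
  by rewrite e.
- have E0 k r : ~ E_ k r by rewrite /E_set hL => -[].
  have CE : concentrated f <-> L2sq (leb1 R) f = 0%E.
    apply: iff_trans; last exact: (iff_sym (L2sq_eq0_half mf)).
    split; apply: ae_imp => r /[apply].
      by move=> [/(_ (E0 _ _)) a /(_ (E0 _ _)) b]; exact: addr_subr_eq0.
    by move=> [-> ->]; rewrite addr0 subr0.
  rewrite CE; split=> [[g [_ [_ fg] _]]|f0].
    rewrite L2norm_lty in fg; rewrite !L2norm_sqr hL => eq.
    apply: contrapT => /eqP sf.
    have spos : (0 < L2sq (leb1 R) f)%E by rewrite lt_neqAle eq_sym sf L2sq_ge0.
    by move: fg; rewrite eq gt0_muley ?lte_fin// gt0_mulye// ltxx.
  exists (fun=> 0).
    have [_ hg [u hu [cu cS]]] := S_op0 w psi phi.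
    split=> //; exists u => //; split => //.
    apply/L2norm_cvg0 => e e0.
    have [N _ hN] := (L2norm_cvg0 _ _).1 cu (e / 4) (divr_gt0 e0 (ltr0Sn R 3)).
    exists N => // n Nn.
    have [[mu_ _] _ _] := hu n.
    have m0 : @cmeasurable _ (measurableTypeR R) R (fun=> 0) by split; exact: measurable_cst.
    rewrite (_ : (fun xi => _) = (fun xi => (u n xi - 0) + (0 - f xi))); last first.
      by apply/funext => x; rewrite subr0 sub0r.
    apply: le_trans (L2sqD_le (leb1 R) ltr01 (cmeasurableB mu_ m0) (cmeasurableB m0 mf)) _.
    have Z : L2sq (leb1 R) (fun x => 0 - f x)%R = 0%E.
      by rewrite -f0; apply: eq_integral => x _; rewrite sub0r sqmodN.
    rewrite Z mule0 adde0.
    have t0 : (0 <= (1 + 1 : R)%:E)%E by rewrite lee_fin.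
    apply: le_trans (lee_wpmul2l t0 (hN n Nn)) _.
    by rewrite -EFinM lee_fin; lra.
  rewrite !L2norm_sqr f0 mule0.
  by rewrite /L2sq; under eq_integral do rewrite sqmod0; rewrite integral0.
Qed.

(** The sums f(r) + f(-r) and f(r) - f(-r) determine f_0 and f_1 up to a factor 2. *)
Lemma concentrated_supp f f0 f1 :
  {ae (leb1 R), forall xi : R, f xi = f0 `|xi| + (Num.sg xi)%:C * f1 `|xi|} ->
  concentrated f <-> supp_in f0 (E_ 0) /\ supp_in f1 (E_ 1).
Proof.
move=> hf.
have hpm : ae_half (fun r => f r + f (- r) = 2%:R * f0 r /\ f r - f (- r) = 2%:R * f1 r).
  move: (ae_and hf (ae_reflect hf)); apply: ae_imp => r [-> ->] r0.
  by rewrite normrN sgrN !(gtr0_norm r0) !(gtr0_sg r0) rmorphN1 rmorph1; split; ring.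
have two (z : R[i]) : 2%:R * z = 0 -> z = 0.
  by move/eqP; rewrite mulf_eq0 pnatr_eq0 => /eqP.
split.
- move=> hc; split; move: (ae_and hpm hc); apply: ae_imp => r [h1 h2] r0 nE.
    by apply: two; have [<- _] := h1 r0; exact: (h2 r0).1.
  by apply: two; have [_ <-] := h1 r0; exact: (h2 r0).2.
- move=> [s0 s1]; move: (ae_and hpm (ae_and s0 s1)); apply: ae_imp => r [h1 [h2 h3]] r0.
  have [-> ->] := h1 r0; split=> nE; first by rewrite h2 ?mulr0.
  by rewrite h3 ?mulr0.
Qed.

Lemma null_E_set (k : 'I_2) : ~ (0 < leb1 R (E_ k))%E -> {ae (leb1 R), forall r, ~ E_ k r}.
Proof.
move=> h; exists (E_ k); split; first exact: measurable_E_set.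
  by apply/eqP; rewrite eq_le measure_ge0 andbT leNgt; exact/negP.
by move=> r /= /contrapT.
Qed.

Lemma extremiser_E_set f : extremiser w Fw psi phi f ->
  exists k : 'I_2, (0 < leb1 R (E_ k))%E.
Proof.
move=> [hf nf /(S_equality_concentrated hf) hc]; apply: contrapT => H.
apply: nf; have [mf _] := hf.
apply: L2sq_eq0 => //; apply/(L2sq_eq0_half mf).
have n0 : ~ (0 < leb1 R (E_ 0%R))%E by move=> h; apply: H; exists 0.
have n1 : ~ (0 < leb1 R (E_ 1%R))%E by move=> h; apply: H; exists 1.
move: (ae_and hc (ae_and (null_E_set n0) (null_E_set n1))).
apply: ae_imp => r [h [e0 e1]] r0; have [h0 h1] := h r0.
by apply: addr_subr_eq0; [exact: h0|exact: h1].
Qed.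

Let box (n : nat) : set R := `[- n%:R, n%:R]%classic.

(** A bounded piece is needed for its bump to be square integrable. *)
Lemma bounded_part (A : set R) : measurable A -> (0 < leb1 R A)%E ->
  exists n : nat, (0 < leb1 R (A `&` box n))%E.
Proof.
move=> mA A0; apply: contrapT => H.
have mB n : measurable (A `&` box n) by apply: measurableI => //; exact: measurable_itv.
have : (leb1 R).-negligible (\bigcup_n (A `&` box n)).
  apply: negligible_bigcup => n; exists (A `&` box n); split; [exact: mB| |by []].
  apply/eqP; rewrite eq_le measure_ge0 andbT leNgt; apply/negP => h; apply: H; by exists n.
rewrite (_ : \bigcup_n _ = A) => [h|].
  by move: A0; rewrite (@measure_negligible _ _ _ (leb1 R) A mA h) ltxx.
apply/seteqP; split=> r; first by case=> n _ [].
move=> Ar; exists (Num.trunc `|r|).+1 => //; split => //=.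
by rewrite /box /= in_itv/= -ler_norml ltW// truncnS_gt.
Qed.

(** The bump of parity k on a bounded piece of E_k. *)
Lemma E_set_extremiser (k : 'I_2) : (0 < leb1 R (E_ k))%E ->
  exists f, extremiser w Fw psi phi f.
Proof.
have mE := measurable_E_set hw hFw hpsi hphi k.
move=> /(bounded_part mE)[n]; set A := _ `&` _ => A0.
have mA : measurable A by apply: measurableI => //; exact: measurable_itv.
have AD : A `<=` D by move=> r [[r0 _] _]; rewrite /= in_itv/= r0.
have Aoo : (leb1 R A < +oo)%E.
  apply: (@le_lt_trans _ _ (mu (box n))).
    by apply: le_measure; rewrite ?inE//; [exact: measurable_itv|move=> r []].
  by rewrite lebesgue_measure_itv/=; case: ifP => _; rewrite -?EFinD ltry.
pose f := bump k 1 A.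
have mf : @cmeasurable _ (measurableTypeR R) R f by exact: cmeasurable_bump.
have sf : L2sq (leb1 R) f = (2%:E * leb1 R A)%E by rewrite L2sq_bump// expr1n mulr1.
have hf : L2 (leb1 R) f.
  by split => //; rewrite L2norm_lty sf; apply: lte_mul_pinfty => //; rewrite lee_fin.
exists f; split => //.
  move=> f0.
  have : L2sq (leb1 R) f = L2sq (leb1 R) (fun=> 0).
    by apply: ae_eq_L2sq => //; split; exact: measurable_cst.
  rewrite sf /L2sq; under eq_integral do rewrite sqmod0.
  rewrite integral0 => /eqP; rewrite mule_eq0 eqe pnatr_eq0/= => /eqP z.
  have {}z : leb1 R A = 0%E := z.
  by move: A0; rewrite z ltxx.
apply/(S_equality_concentrated hf).
apply: aeW => r r0.
have [-> ->] := bump_sumdiff k 1 A r0.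
have nA : ~ E_ k r -> \1_A r = 0 :> R.
  by move=> nE; rewrite indicE memNset// => -[].
have [k0|k0] := eqVneq k 0.
  by split => //; rewrite -k0 => /nA ->; rewrite mulr0.
have k1 : k = 1 by apply/val_inj; move: k0; clear; case: k => -[|[|//]].
by split => //; rewrite -k1 => /nA ->; rewrite mulr0.
Qed.
End extremisers.

Theorem theorem2p2 (R : realType) (w Fw psi phi : R -> R)
    (hw : weight_assumption w) (hFw : Fw_assumption w Fw)
    (hpsi : smoothing_assumption psi) (hphi : dispersion_assumption phi) :
  [/\ lambda_star w Fw psi phi
        = ereal_sup [set (psi r ^+ 2 / `|derive1 phi r|
                          * (weightL1 w + `|Fw (2 * r ^+ 2)|))%:E
                    | r in `]0, +oo[%classic],
      (S_opnorm w psi phi ^+ 2 = (2 * pi)%:E * lambda_star w Fw psi phi)%E,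
      forall f f0 f1 : R -> R[i],
        L2 (leb1 R) f ->
        {ae (leb1 R), forall xi : R,
          f xi = f0 `|xi| + (Num.sg xi)%:C * f1 `|xi|} ->
        (S_equality w Fw psi phi f <->
         supp_in f0 (E_set w Fw psi phi 0) /\
         supp_in f1 (E_set w Fw psi phi 1))
    & (exists f : R -> R[i], extremiser w Fw psi phi f) <->
      (exists k : 'I_2, (0 < leb1 R (E_set w Fw psi phi k))%E)].
Proof.
split.
- by rewrite /lambda_star; congr ereal_sup; apply: eq_imagel => r _; rewrite lambda_maxE.
- exact: opnorm_sqr.
- move=> f f0 f1 hf hd.
  exact: iff_trans (S_equality_concentrated hw hFw hpsi hphi hf) (concentrated_supp _ _ _ _ hd).
- split=> [[f]|[k]]; first exact: extremiser_E_set.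
  exact: E_set_extremiser.
Qed.
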